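(* Let $y_0 > 0$ and let $f,g$ be entire functions of finite order, neither identically zero. Then $|f| = |g|$ on $\mathbb{R} \cup (\mathbb{R} + i y_0)$ if and only if $f$ and $g$ factor as $$f(z) = e^{Q_f(z)} P_{\mathrm c}(z) \prod_{\substack{a \in \operatorname{supp}(M_{\mathrm d}) \\ \operatorname{Im} a \in (-y_0,y_0]}} \prod_{k \in \mathbb{Z}} E\left( \frac{z}{\tau_{2 y_0}^k a} ; p \right)^{M_{\mathrm d}(a)},$$ $$g(z) = e^{Q_g(z)} P_{\mathrm c}(z) \prod_{\substack{a \in \operatorname{supp}(M_{\mathrm d}) \\ \operatorname{Im} a \in (-y_0,y_0]}} \prod_{k \in \mathbb{Z}} E\left( \frac{z}{\tau_{2 y_0}^k \overline a} ; p \right)^{M_{\mathrm d}(a)}.$$ Here, $p \in \mathbb{N}_0$ is the genus of the canonical product formed with the zeroes of $f$, $P_{\mathrm c}$ is the canonical product formed with the common zeroes of $f$ and $g$, and $Q_f, Q_g \in \mathbb{C}[z]$ are polynomials of the same order (degree) $d \in \mathbb{N}_0$, whose coefficients have the same real parts and whose imaginary parts $(\lambda_\ell)_{\ell=0}^d$ (for $Q_f$) and $(\mu_\ell)_{\ell=0}^d$ (for $Q_g$), all real, satisfy $$\sum_{\ell = 1}^d (\lambda_\ell - \mu_\ell) \operatorname{Im}[ (x + i y_0)^\ell ] = \sum_{\substack{a \in \operatorname{supp}(M_{\mathrm d}) \\ \operatorname{Im} a \in (-y_0,y_0]}} M_{\mathrm d}(a) \sum_{k \in \mathbb{Z}} \Bigg(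 \log \left| 1 - \frac{2 i y_0}{\tau_{2y_0}^k a} \right| + \sum_{\ell = 1}^p \ell^{-1} \operatorname{Re} \Bigg[ \left( \frac{x + i y_0}{\tau_{2y_0}^k a} \right)^\ell - \left( \frac{x + i y_0}{\tau_{2y_0}^{-k} \overline a + 2 i y_0} \right)^\ell \Bigg] \Bigg)$$ for all $x \in \mathbb{R}$.
   Context: $\mathbb{N} = \{1,2,\dots\}$, $\mathbb{N}_0 = \mathbb{N}\cup\{0\}$; $\tau_{2y_0}$ denotes the translation $z \mapsto z + 2 i y_0$ of $\mathbb{C}$, so $\tau_{2y_0}^k z = z + 2 i k y_0$ for $k \in \mathbb{Z}$. An entire function $f$ is of finite order if $f(z) = O(\exp(|z|^c))$ as $z\to\infty$ for some $c>0$. For a nonzero entire function $f$, $M_f : \mathbb{C} \to \mathbb{N}_0$ maps $z$ to the multiplicity of $z$ as a zero of $f$ (and to $0$ if $f(z) \neq 0$). For $f,g$ put $M_{\mathrm c} := \min\{M_f, M_g\}$ (common zeroes) and $M_{\mathrm d} := \max\{M_f - M_g, 0\}$ (zeroes of $f$ that are not zeroes of $g$), pointwise; $\operatorname{supp}$ denotes the support of a function (here, the set where it is nonzero). Primary factors: $E(z;0) = 1-z$ and $E(z;p) = (1-z)\exp\big(\sum_{j=1}^p z^j/j\big)$ for $p \in \mathbb{N}$. The genus of the canonical product formed with the zeroes of a finite order $f$ is the smallest $p \in \mathbb{N}_0$ such that $\sum_{a \in \operatorname{supp}(M_f)\setminus\{0\}} M_f(a)/|a|^{p+1} < \infty$.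 With this $p$ and with $m = M_f(0)$ the multiplicity of the zero of $f$ at the origin, the canonical product formed with the common zeroes of $f$ and $g$ is $P_{\mathrm c}(z) := z^m \prod_{a \in \operatorname{supp}(M_{\mathrm c})\setminus\{0\}} E(z/a;p)^{M_{\mathrm c}(a)}$.
   Formalization: The requirement that Q_f and Q_g have the same degree d is replaced by both having degree at most d (leading coefficients may vanish), since exact equality of degrees fails, e.g. for suitable sinh-type f, g with degrees 1 and 0. *)

(* Defs.v *)
From HB Require Import structures.
From mathcomp Require Import all_boot all_order all_algebra.
From mathcomp Require Import finmap complex.
From mathcomp Require Import all_classical all_reals all_analysis.
From mathcomp Require summability.
Set Implicit Arguments.
Unset Strict Implicit.
Unset Printing Implicit Defensive.
Import Order.TTheory GRing.Theory Num.Theory numFieldNormedType.Exports.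
Import complex.
Local Open Scope classical_set_scope.
Local Open Scope ring_scope.
Local Open Scope complex_scope.

Section complex_functions.
Context {R : realType}.
Implicit Types (f g : R[i] -> R[i]) (z a : R[i]) (M : R[i] -> nat).

Definition cabs z : R := ComplexField.Normc.normc z.

Definition expC z : R[i] := (expR (Re z))%:C * (cos (Im z) +i* sin (Im z)).

(* [R[i]^o] carries the structure of normed space over [R[i]] itself, so that
   [derivable] is complex differentiability. *)
Definition entire f :=
  forall z : R[i]^o, derivable (f : R[i]^o -> R[i]^o) z 1.

Definition finite_order f :=
  exists c K r : R, 0 < c /\
    forall z, r <= cabs z -> cabs (f z) <= K * expR (cabs z `^ c).

(* For [f] entire and not identically zero there is exactly one such [n]. *)
Definition has_mult f z (n : nat) :=
  exists h : R[i] -> R[i],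
    [/\ entire h, h z != 0 & forall w, f w = (w - z) ^+ n * h w].

Definition mult f z : nat := xget 0%N [set n | has_mult f z n].

Definition common_mult f g z : nat := minn (mult f z) (mult g z).

(* Subtraction on [nat] is truncated, so this is [max (M_f - M_g, 0)]. *)
Definition diff_mult f g z : nat := (mult f z - mult g z)%N.

Definition msupp M : set R[i] := [set a | M a != 0%N].

(* The primary factor E(z;p). *)
Definition primary (p : nat) z : R[i] :=
  (1 - z) * expC (\sum_(1 <= j < p.+1) z ^+ j / j%:R).

Definition zeros_summable M (p : nat) : Prop :=
  (\esum_(a in msupp M `\ 0%R) ((M a)%:R / cabs a ^+ p.+1)%:E < +oo)%E.

(* The default value 0 is only taken when no exponent is admissible, which does
   not happen for [f] of finite order. *)
Definition genus f : nat :=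
  xget 0%N [set p | zeros_summable (mult f) p /\
                    forall q, zeros_summable (mult f) q -> (p <= q)%N].

Definition tau (y0 : R) (k : int) z : R[i] := z + 0 +i* (2 * k%:~R * y0).

Definition strip (y0 : R) : set R[i] := [set a | - y0 < Im a <= y0].

End complex_functions.

Section infinite_products.
Context {R : realType} {T : choiceType}.
Implicit Types (A : set T).

(* Unordered products and sums over an arbitrary index set: limits along the
   filter of finite subsets.  The value is meaningful when the net converges,
   in particular under absolute convergence. *)
Definition uprod A (F : T -> R[i]) : R[i] :=
  lim ((fun X : {fset T} => (\prod_(i <- X | i \in A) F i : R[i]^o))
         @ summability.totally).

Definition usum A (F : T -> R) : R :=
  lim ((fun X : {fset T} => \sum_(i <- X | i \in A) F i)
         @ summability.totally).

Definition abs_cvg_prod A (F : T -> R[i]) : Prop :=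
  (\esum_(i in A) (cabs (F i - 1))%:E < +oo)%E.

Definition abs_cvg_sum A (F : T -> R) : Prop := summable A (EFin \o F).

End infinite_products.

(* The canonical product formed with the common zeroes; its exponent and its
   order at the origin are those attached to [f], not to the common zeroes. *)
Definition common_product {R : realType} (f g : R[i] -> R[i]) (z : R[i]) : R[i] :=
  z ^+ mult f 0 *
  uprod (msupp (common_mult f g) `\ 0)
    (fun a => primary (genus f) (z / a) ^+ common_mult f g a).

(* The summand, for the zero [b] = tau^k a, of the series that governs the
   moduli on the line Im z = y0.  There [c] is the zero of [g] paired with [b]
   by reflection across that line, c = tau^(-k) (conj a) + 2 i y0. *)
Definition line_term {R : realType} (y0 : R) (p : nat) (x : R) (a : R[i]) (k : int) : R :=
  let b := tau y0 k a in
  let c := tau y0 (- k) (conjc a) + 0 +i* (2 * y0) in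
  ln (cabs (1 - (0 +i* (2 * y0)) / b)) +
  \sum_(1 <= l < p.+1)
     l%:R^-1 * Re (((x +i* y0) / b) ^+ l - ((x +i* y0) / c) ^+ l).

(* Main.v *)
Require Import Defs.
From HB Require Import structures.
From mathcomp Require Import all_boot all_order all_algebra.
From mathcomp Require Import finmap complex.
From mathcomp Require Import all_classical all_reals all_analysis.
From mathcomp Require Import ring lra zify.
From mathcomp Require summability.
Set Implicit Arguments.
Unset Strict Implicit.
Unset Printing Implicit Defensive.
Import Order.TTheory GRing.Theory Num.Theory numFieldNormedType.Exports.
Import complex.
Local Open Scope classical_set_scope.
Local Open Scope ring_scope.
Local Open Scope complex_scope.

(** Why the theorem holds.

    On the line [Im z = y] the entire function [f z * conj (f (refl y z))],
    with [refl y] the reflection across that line, is the square of the modulus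
    of [f]. If [f] and [g] have the same modulus on the line, the two functions
    built in this way agree along a line, hence everywhere, and comparing their
    zeroes gives [M_f a + M_f (refl y a) = M_g a + M_g (refl y a)]
    ([mult_reflect]). Thus [M_f - M_g] changes sign under the reflections
    across both lines. So the zeroes that [g] has in excess are the conjugates
    of those that [f] has in excess, the excess [M_d] is invariant under the
    composition of the two reflections, which is the translation by [2 i y0]
    ([diff_tau]), and the origin has the same multiplicity for both. The
    support of [M_d] is therefore a union of orbits of the translation, each
    with one representative in the half-open strip.

    Hadamard's theorem writes [f] and [g] as the exponential of a polynomial
    times a canonical product ([hadamard]). With [M_f = M_c + M_d] and
    [M_g = M_c + M_d o conj], the canonical products split into the common one
    and one over the orbits ([f_pcvg], [g_pcvg]).

    What remains is the comparison of moduli, which serves both implications.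
    On the real line the two products over the orbits are conjugate
    ([orbit_modulus_real]), so the moduli of [f] and [g] agree there exactly
    when the coefficients of the polynomials have the same real parts. On
    [Im z = y0] the factor of [f] at [b = tau k a] is matched with the factor of
    [g] at [refl y0 b], whose modulus differs by the exponential of
    [line_term] ([line_factor]); hence the two products differ in modulus by
    the exponential of the double series ([orbit_modulus_line]), and the moduli
    of [f] and [g] agree exactly when the imaginary parts of the coefficients
    compensate that series. The logarithm can be taken only where [f] does not
    vanish; finite differences in [x] extend the identity to the remaining
    points ([line_identity]), because each term of the series is a polynomial
    in [x] of degree at most [p].

    Hadamard's theorem is proved from the definition of an entire function:
    Goursat's theorem yields primitives on discs, hence Cauchy's formula, Taylor
    expansions, logarithms of zero-free functions and the Borel-Caratheodory
    inequality; a crude form of Jensen's bound controls the number of zeroes. On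
    each disc, dividing out the zeroes leaves an exponential whose exponent is a
    polynomial up to an error that vanishes for large discs ([local_factor]);
    the polynomial is independent of the disc, being determined near the
    origin. Unordered products and sums are handled by one notion of
    convergence along finite sets, [ucvg]. *)

(** * Modulus and exponential of complex numbers *)

Section modulus.
Context {R : realType}.
Implicit Types (z w : R[i]) (x y : R).

Lemma normE z : `|z| = (cabs z)%:C. Proof. by []. Qed.

Lemma cabs_sqr z : cabs z ^+ 2 = Re z ^+ 2 + Im z ^+ 2.
Proof.
case: z => x y; rewrite /cabs /= sqr_sqrtr //.
by rewrite addr_ge0 ?sqr_ge0.
Qed.

Lemma cabs_ge0 z : 0 <= cabs z.
Proof. by case: z => x y; apply: sqrtr_ge0. Qed.

Lemma cabs0 : cabs (0 : R[i]) = 0.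
Proof. exact: ComplexField.Normc.normc0. Qed.

Lemma cabs1 : cabs (1 : R[i]) = 1.
Proof. exact: ComplexField.Normc.normc1. Qed.

Lemma cabsM z w : cabs (z * w) = cabs z * cabs w.
Proof. exact: ComplexField.Normc.normcM. Qed.

Lemma cabsN z : cabs (- z) = cabs z.
Proof. exact: normcN. Qed.

Lemma cabsV z : cabs z^-1 = (cabs z)^-1.
Proof. exact: ComplexField.Normc.normcV. Qed.

Lemma cabsf z w : cabs (z / w) = cabs z / cabs w.
Proof. by rewrite cabsM cabsV. Qed.

Lemma cabsD z w : cabs (z + w) <= cabs z + cabs w.
Proof. exact: le_normcD. Qed.

Lemma cabsBC z w : cabs (z - w) = cabs (w - z).
Proof. by rewrite -cabsN opprB. Qed.

Lemma cabsB z w : cabs (z - w) <= cabs z + cabs w.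
Proof. by rewrite (le_trans (cabsD _ _))// cabsN. Qed.

Lemma cabs_lerB z w : cabs z - cabs w <= cabs (z - w).
Proof. by rewrite lerBlDr -[X in cabs X <= _](subrK w) cabsD. Qed.

Lemma cabs_eq0 z : (cabs z == 0) = (z == 0).
Proof.
apply/eqP/eqP => [|->]; last exact: cabs0.
exact: ComplexField.Normc.eq0_normc.
Qed.

Lemma cabs_gt0 z : (0 < cabs z) = (z != 0).
Proof. by rewrite lt_def cabs_ge0 andbT cabs_eq0. Qed.

Lemma cabsX z n : cabs (z ^+ n) = cabs z ^+ n.
Proof. by elim: n => [|n IH]; rewrite ?expr0 ?cabs1 // !exprS cabsM IH. Qed.

Lemma cabs_real x : cabs x%:C = `|x|.
Proof. by rewrite /cabs /= expr0n /= addr0 sqrtr_sqr. Qed.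

Lemma cabs_nat n : cabs (n%:R : R[i]) = n%:R.
Proof. by rewrite -(rmorph_nat (real_complex R)) cabs_real normr_nat. Qed.

Lemma cabs_conj z : cabs z^* = cabs z.
Proof. by case: z => x y; rewrite /cabs /= sqrrN. Qed.

Lemma Re_le_cabs z : `|Re z| <= cabs z.
Proof.
rewrite -(@ler_pXn2r _ 2) ?nnegrE ?cabs_ge0// cabs_sqr real_normK ?num_real//.
by rewrite lerDl sqr_ge0.
Qed.

Lemma Im_le_cabs z : `|Im z| <= cabs z.
Proof.
rewrite -(@ler_pXn2r _ 2) ?nnegrE ?cabs_ge0// cabs_sqr real_normK ?num_real//.
by rewrite lerDr sqr_ge0.
Qed.

Lemma complexRI z : z = (Re z)%:C + 'i * (Im z)%:C.
Proof. by case: z => x y; simpc. Qed.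

Lemma cabsi : cabs ('i : R[i]) = 1.
Proof. by rewrite /cabs /= expr0n /= add0r expr1n sqrtr1. Qed.

Lemma cabs_le_ReIm z : cabs z <= `|Re z| + `|Im z|.
Proof.
rewrite [X in cabs X]complexRI (le_trans (cabsD _ _))//.
by rewrite cabsM cabsi mul1r !cabs_real.
Qed.

Lemma cabs_sum I (r : seq I) (P : pred I) (F : I -> R[i]) :
  cabs (\sum_(i <- r | P i) F i) <= \sum_(i <- r | P i) cabs (F i).
Proof.
elim/big_rec2: _ => [|i y z _ le_zy]; first by rewrite cabs0.
by rewrite (le_trans (cabsD _ _))// lerD.
Qed.

Lemma cabs_prod I (r : seq I) (P : pred I) (F : I -> R[i]) :
  cabs (\prod_(i <- r | P i) F i) = \prod_(i <- r | P i) cabs (F i).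
Proof. by apply: big_morph; [exact: cabsM|exact: cabs1]. Qed.

Lemma cReD z w : Re (z + w) = Re z + Re w. Proof. by case: z; case: w. Qed.
Lemma cImD z w : Im (z + w) = Im z + Im w. Proof. by case: z; case: w. Qed.
Lemma cReN z : Re (- z) = - Re z. Proof. by case: z. Qed.
Lemma cImN z : Im (- z) = - Im z. Proof. by case: z. Qed.
Lemma cReB z w : Re (z - w) = Re z - Re w. Proof. by rewrite cReD cReN. Qed.
Lemma cImB z w : Im (z - w) = Im z - Im w. Proof. by rewrite cImD cImN. Qed.
Lemma cReM z w : Re (z * w) = Re z * Re w - Im z * Im w.
Proof. by case: z; case: w. Qed.
Lemma cImM z w : Im (z * w) = Re z * Im w + Im z * Re w.
Proof. by case: z => a b; case: w => c d /=. Qed.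

Lemma eq_ReIm z w : Re z = Re w -> Im z = Im w -> z = w.
Proof. by case: z => a b; case: w => c d /= -> ->. Qed.

End modulus.

Section exponential.
Context {R : realType}.
Implicit Types (z w : R[i]).

Lemma expCD z w : expC (z + w) = expC z * expC w.
Proof.
case: z => a b; case: w => c d; rewrite /expC /=; simpc.
rewrite expRD cosD sinD; apply: eq_ReIm => /=; ring.
Qed.

Lemma expC0 : expC (0 : R[i]) = 1.
Proof. by rewrite /expC /= expR0 cos0 sin0 mul1r. Qed.

Lemma cabs_expC z : cabs (expC z) = expR (Re z).
Proof.
rewrite /expC cabsM cabs_real ger0_norm ?expR_ge0// /cabs /= cos2Dsin2.
by rewrite sqrtr1 mulr1.
Qed.

Lemma expC_neq0 z : expC z != 0.
Proof. by rewrite -cabs_eq0 cabs_expC gt_eqF ?expR_gt0. Qed.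

Lemma expCN z : expC (- z) = (expC z)^-1.
Proof.
apply: (mulIf (expC_neq0 z)); rewrite mulVf ?expC_neq0//.
by rewrite -expCD addNr expC0.
Qed.

Lemma expC_sum I (r : seq I) (P : pred I) (F : I -> R[i]) :
  expC (\sum_(i <- r | P i) F i) = \prod_(i <- r | P i) expC (F i).
Proof. by apply: big_morph; [exact: expCD|exact: expC0]. Qed.

Lemma expCMn z n : expC (z *+ n) = expC z ^+ n.
Proof. by elim: n => [|n IH]; rewrite ?mulr0n ?expC0// mulrS expCD IH exprS. Qed.

Lemma expC_conj z : (expC z)^* = expC z^*.
Proof. by case: z => a b; rewrite /expC /= cosN sinN; simpc. Qed.

End exponential.

(** * Limits and continuity over the complex numbers *)

Section topology.
Context {R : realType}.
Local Notation C := (R[i]^o).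

Lemma nbhs_cabsP (z : C) (P : set C) :
  nbhs z P <-> exists2 d : R, 0 < d & forall w, cabs (w - z) < d -> P w.
Proof.
split.
  move=> /nbhs_ballP[e /= e0 He].
  have /andP[/eqP Ie Re0] : (Im e == 0) && (0 < Re e).
    by move: e0; case: (e) => a b /=; rewrite ltcE /= eq_sym.
  exists (Re e) => // w wd; apply: He => /=.
  rewrite -ball_normE /ball_ /= -opprB normrN normE ltcE /= Ie eqxx /=; exact: wd.
move=> [d d0 Hd]; apply/nbhs_ballP; exists d%:C; first by rewrite /= ltcR.
move=> w; rewrite -ball_normE /ball_ /= => wd.
by apply: Hd; rewrite -ltcR -normE -opprB normrN.
Qed.

Lemma cvg_cabsP T (F : set_system T) {FF : Filter F} (f : T -> C) (l : C) :
  f @ F --> l <-> forall e : R, 0 < e -> \forall t \near F, cabs (f t - l) < e.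
Proof.
split=> [fl e e0|H].
  apply: (fl [set w | cabs (w - l) < e]); apply/nbhs_cabsP.
  by exists e.
move=> P /nbhs_cabsP[d d0 Hd]; have := H d d0.
by apply: filterS => t; exact: Hd.
Qed.

(** Continuity of a complex function at a point, with real radii. *)
Definition ccont (f : R[i] -> R[i]) (z : R[i]) := forall e : R, 0 < e ->
  exists2 d : R, 0 < d & forall w, cabs (w - z) < d -> cabs (f w - f z) < e.

Implicit Types (f g : R[i] -> R[i]) (z w : R[i]).

Lemma ccont_cst w z : ccont (fun=> w) z.
Proof. by move=> e e0; exists 1 => // v _; rewrite subrr cabs0. Qed.

Lemma ccont_id z : ccont id z.
Proof. by move=> e e0; exists e. Qed.

Lemma ccont_conj z : ccont conjc z.
Proof.
by move=> e e0; exists e => // w we; rewrite -(rmorphB (conjc : {rmorphism R[i] -> R[i]})) cabs_conj.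
Qed.

Lemma ccont_comp f g z : ccont g z -> ccont f (g z) -> ccont (fun w => f (g w)) z.
Proof.
move=> Hg Hf e /Hf[d d0 Hd]; have [d' d0' Hd'] := Hg d d0.
by exists d' => // w /Hd' /Hd.
Qed.

Lemma ccontD f g z : ccont f z -> ccont g z -> ccont (fun w => f w + g w) z.
Proof.
move=> Hf Hg e e0; have e2 : 0 < e / 2 by rewrite divr_gt0.
have [d d0 Hd] := Hf _ e2; have [d' d0' Hd'] := Hg _ e2.
exists (Order.min d d'); first by rewrite lt_min d0.
move=> w; rewrite lt_min => /andP[/Hd A /Hd' B].
have -> : f w + g w - (f z + g z) = (f w - f z) + (g w - g z) by ring.
by rewrite (le_lt_trans (cabsD _ _))// [e]splitr ltrD.
Qed.

Lemma ccontM f g z : ccont f z -> ccont g z -> ccont (fun w => f w * g w) z.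
Proof.
move=> Hf Hg e e0.
pose B := cabs (f z) + cabs (g z) + 1; have B0 : 0 < B by rewrite ltr_wpDl ?addr_ge0 ?cabs_ge0.
pose k := Order.min 1 (e / (2 * B)).
have k0 : 0 < k by rewrite lt_min ltr01 divr_gt0// mulr_gt0.
have [d d0 Hd] := Hf _ k0; have [d' d0' Hd'] := Hg _ k0.
exists (Order.min d d'); first by rewrite lt_min d0.
move=> w; rewrite lt_min => /andP[/Hd a /Hd' b].
have -> : f w * g w - f z * g z =
  (f w - f z) * (g w - g z) + ((f w - f z) * g z + f z * (g w - g z)) by ring.
rewrite (le_lt_trans (cabsD _ _))// (@le_lt_trans _ _ (k * B))//.
  rewrite (_ : k * B = k * 1 + (k * cabs (g z) + cabs (f z) * k)); last by rewrite /B; ring.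
  have k1 : k <= 1 by rewrite ge_min lexx.
  rewrite lerD// ?cabsM.
    by rewrite ler_pM ?cabs_ge0// ?ltW// (lt_le_trans b).
  rewrite (le_trans (cabsD _ _))// lerD// cabsM.
    by rewrite ler_wpM2r ?cabs_ge0// ltW.
  by rewrite ler_wpM2l ?cabs_ge0// ltW.
rewrite -ltr_pdivlMr// (@le_lt_trans _ _ (e / (2 * B)))//.
  by rewrite ge_min lexx orbT.
rewrite ltr_pM2l// ltf_pV2 ?posrE ?mulr_gt0//; lra.
Qed.

Lemma ccontN f z : ccont f z -> ccont (fun w => - f w) z.
Proof.
move=> H e /H[d d0 Hd]; exists d => // w /Hd.
by rewrite -opprD cabsN.
Qed.

Lemma ccontB f g z : ccont f z -> ccont g z -> ccont (fun w => f w - g w) z.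
Proof. by move=> Hf Hg; apply: ccontD => //; exact: ccontN. Qed.

Lemma ccontV z : z != 0 -> ccont (fun w => w^-1) z.
Proof.
move=> z0 e e0; have r0 : 0 < cabs z by rewrite cabs_gt0.
exists (Order.min (cabs z / 2) (e * cabs z ^+ 2 / 2)).
  by rewrite lt_min !divr_gt0// mulr_gt0// exprn_gt0.
move=> w; rewrite lt_min => /andP[a b].
have wz : cabs z / 2 < cabs w.
  by have := cabs_lerB z w; rewrite cabsBC; lra.
have w0 : w != 0 by rewrite -cabs_gt0 (lt_trans _ wz)// divr_gt0.
have -> : w^-1 - z^-1 = - (w - z) / (w * z) by field; rewrite w0 z0.
rewrite cabsf cabsN cabsM ltr_pdivrMr ?mulr_gt0 ?cabs_gt0// (lt_trans b)//.
by rewrite -mulrA ltr_pM2l// expr2 mulrAC ltr_pM2r.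
Qed.

End topology.

(** * Complex derivatives *)

Section derivative.
Context {R : realType}.
Local Notation C := (R[i]^o).
Implicit Types (f g : R[i] -> R[i]) (z w l m : R[i]).

(** Caratheodory's form of the derivative: [f] has the derivative [l] at [z]
    when its difference quotient extends continuously to [z] by [l].  The
    rules of differentiation then reduce to those for continuous functions. *)
Definition cder f z l := exists phi : R[i] -> R[i],
  [/\ ccont phi z, phi z = l &
      forall w, f w = f z + (w - z) * phi w].

Lemma cderP f z l : cder f z l <->
  forall e : R, 0 < e -> exists2 d : R, 0 < d & forall w, cabs (w - z) < d ->
    cabs (f w - f z - (w - z) * l) <= e * cabs (w - z).
Proof.
split=> [[phi [phic phiz fE]] e e0|H].
  have [d d0 Hd] := phic e e0; exists d => // w wd.
  have -> : f w - f z - (w - z) * l = (w - z) * (phi w - l) by rewrite fE; ring.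
  rewrite cabsM mulrC ler_wpM2r ?cabs_ge0//.
  by rewrite -phiz ltW// Hd.
exists (fun w => if w == z then l else (f w - f z) / (w - z)); split; last 2 first.
  by rewrite eqxx.
  move=> w; case: eqVneq => [->|wz]; first by rewrite subrr mul0r addr0.
  by rewrite mulrC divfK ?subr_eq0// addrC subrK.
move=> e e0; have e2 : 0 < e / 2 by rewrite divr_gt0.
have [d d0 Hd] := H _ e2; exists d => // w wd; rewrite eqxx.
case: (eqVneq w z) => [_|wz]; first by rewrite subrr cabs0.
have wz0 : w - z != 0 by rewrite subr_eq0.
rewrite -[l](mulfK wz0) -mulrBl cabsf ltr_pdivrMr ?cabs_gt0//.
rewrite [l * _]mulrC; apply: le_lt_trans (Hd w wd) _.
by rewrite ltr_pM2r ?cabs_gt0// gtr_pMr// invf_lt1 ?ltr1n.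
Qed.

Lemma cder_cont f z l : cder f z l -> ccont f z.
Proof.
move=> [phi [phic _ fE]].
rewrite (_ : f = (fun w => f z + (w - z) * phi w)); last exact/funext.
apply: ccontD; first exact: ccont_cst.
by apply: ccontM => //; apply: ccontB; [exact: ccont_id|exact: ccont_cst].
Qed.

Lemma cder_uniq f z l m : cder f z l -> cder f z m -> l = m.
Proof.
move=> /cderP Hl /cderP Hm; apply/eqP; rewrite -subr_eq0 -cabs_eq0.
apply/eqP/le_anti; rewrite cabs_ge0 andbT; apply/ler_addgt0Pl => e e0; rewrite addr0.
have e2 : 0 < e / 2 by rewrite divr_gt0.
have [d d0 Hd] := Hl _ e2; have [d' d0' Hd'] := Hm _ e2.
pose r := Order.min d d' / 2.
have r0 : 0 < r by rewrite divr_gt0// lt_min d0.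
have rd : r < d by rewrite /r ltr_pdivrMr// gt_min ltr_pMr ?ltr1n.
have rd' : r < d' by rewrite /r ltr_pdivrMr// gt_min ltr_pMr ?ltr1n ?orbT.
have cr : cabs ((z + r%:C) - z) = r by rewrite addrC addKr cabs_real gtr0_norm.
have := Hd (z + r%:C); have := Hd' (z + r%:C); rewrite !cr => /(_ rd') A /(_ rd) B.
rewrite -(ler_pM2r r0).
have -> : cabs (l - m) * r = cabs ((f (z + r%:C) - f z - (z + r%:C - z) * m)
    - (f (z + r%:C) - f z - (z + r%:C - z) * l)).
  rewrite -[X in _ * X]cr -cabsM; congr cabs; ring.
by rewrite (le_trans (cabsB _ _))// (splitr e) [X in _ <= X]mulrDl lerD.
Qed.

Lemma cder_near f g z l : (exists2 d : R, 0 < d &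
  forall w, cabs (w - z) < d -> f w = g w) -> cder f z l -> cder g z l.
Proof.
move=> [d d0 fg] /cderP H; apply/cderP => e e0; have [d' d0' Hd'] := H e e0.
exists (Order.min d d'); first by rewrite lt_min d0.
move=> w; rewrite lt_min => /andP[wd wd']; rewrite -!fg//; first exact: Hd'.
by rewrite subrr cabs0.
Qed.

Lemma cder_cst m z : cder (fun=> m) z 0.
Proof.
exists (fun=> 0); split=> [|//|w]; last by rewrite mulr0 addr0.
exact: ccont_cst.
Qed.

Lemma cder_id z : cder id z 1.
Proof.
exists (fun=> 1); split=> [|//|w]; first exact: ccont_cst.
by rewrite mulr1 addrC subrK.
Qed.

Lemma cderD f g z l m : cder f z l -> cder g z m -> cder (fun w => f w + g w) z (l + m).
Proof.
move=> [p [pc <- fE]] [q [qc <- gE]]; exists (fun w => p w + q w); split=> [|//|w].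
  exact: ccontD.
by rewrite fE [g w]gE; ring.
Qed.

Lemma cderM f g z l m : cder f z l -> cder g z m ->
  cder (fun w => f w * g w) z (l * g z + f z * m).
Proof.
move=> Hf Hg; have gc := cder_cont Hg.
move: Hf Hg => [p [pc <- fE]] [q [qc <- gE]].
exists (fun w => p w * g w + f z * q w); split=> [|//|w].
  apply: ccontD; first exact: ccontM.
  by apply: ccontM => //; exact: ccont_cst.
by rewrite [in LHS]fE [in LHS]gE [g w]gE; ring.
Qed.

Lemma cderN f z l : cder f z l -> cder (fun w => - f w) z (- l).
Proof.
move=> H; have := cderM (cder_cst (-1) z) H; rewrite mul0r add0r mulN1r.
by under eq_fun do rewrite mulN1r.
Qed.

Lemma cderB f g z l m : cder f z l -> cder g z m -> cder (fun w => f w - g w) z (l - m).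
Proof. by move=> Hf Hg; apply: cderD => //; exact: cderN. Qed.

Lemma cderZ a f z l : cder f z l -> cder (fun w => a * f w) z (a * l).
Proof. by move=> H; have := cderM (cder_cst a z) H; rewrite mul0r add0r. Qed.

Lemma cder_comp f g z l m : cder g z m -> cder f (g z) l ->
  cder (fun w => f (g w)) z (l * m).
Proof.
move=> Hg [p [pc <- fE]]; have gc := cder_cont Hg.
move: Hg => [q [qc <- gE]]; exists (fun w => p (g w) * q w); split=> [|//|w].
  by apply: ccontM => //; exact: ccont_comp.
have dg : g w - g z = (w - z) * q w by rewrite gE addrC addKr.
by rewrite fE dg mulrCA mulrA [p _ * _]mulrC -mulrA mulrAC -mulrA [q w * _]mulrC mulrA.
Qed.

Lemma cderV z : z != 0 -> cder (fun w => w^-1) z (- (z ^- 2)).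
Proof.
move=> z0; apply: (@cder_near (fun w => z^-1 + (w - z) * (- (z * w)^-1))) .
  exists (cabs z); rewrite ?cabs_gt0// => w wz.
  have w0 : w != 0.
    by apply: contraTneq wz => ->; rewrite sub0r cabsN ltxx.
  by field; rewrite z0 w0.
exists (fun w => - (z * w)^-1); split => //; last first.
  by move=> w; rewrite subrr mul0r addr0.
apply: ccontN; apply: (@ccont_comp _ (fun v => v^-1)); last by apply: ccontV; rewrite mulf_neq0.
by apply: ccontM; [exact: ccont_cst|exact: ccont_id].
Qed.

Lemma cder_inv f z l : cder f z l -> f z != 0 ->
  cder (fun w => (f w)^-1) z (- l / f z ^+ 2).
Proof.
move=> Hf f0; have := cder_comp Hf (cderV f0).
by rewrite mulNr mulrC -mulNr.
Qed.

Lemma cderX z n : cder (fun w => w ^+ n) z (n%:R * z ^+ n.-1).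
Proof.
elim: n => [|n IH]; first by rewrite mul0r; exact: cder_cst.
have := cderM (cder_id z) IH; under eq_fun do rewrite -exprS.
rewrite mul1r mulrCA; case: n {IH} => [|n]; first by rewrite !mul0r expr0 addr0 mulr1.
by rewrite -exprS -{1}[z ^+ n.+1]mul1r -mulrDl nat1r.
Qed.

(** Trades differentiability in the sense of normed spaces for Caratheodory's
    form, which is used from here on. *)
Lemma entireP f : entire f <-> forall z, exists l, cder f z l.
Proof.
split=> H z.
  have /cvg_ex[l /= Hl] := H z; exists l; apply/cderP => e e0.
  have [d d0 Hd] : exists2 d : R, 0 < d & forall h : C, cabs (h - 0) < d -> h != 0 ->
      cabs (h^-1 * (f (h * 1 + z) - f z) - l) < e.
    by move: Hl => /cvg_cabsP => /(_ e e0); rewrite /dnbhs /within => /nbhs_cabsP.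
  exists d => // w wd; have [->|wz] := eqVneq w z.
    by rewrite !subrr mul0r subr0 cabs0 mulr0.
  have wz0 : w - z != 0 by rewrite subr_eq0.
  move: (Hd (w - z)); rewrite subr0 mulr1 subrK => /(_ wd wz0) /ltW.
  rewrite -(ler_pM2r (_ : 0 < cabs (w - z))) ?cabs_gt0// -cabsM mulrBl.
  by rewrite mulrAC mulVf// mul1r [l * _]mulrC.
have [l /cderP Hl] := H z; apply/cvg_ex; exists l; apply/cvg_cabsP => e e0 /=.
have e2 : 0 < e / 2 by rewrite divr_gt0.
have [d d0 Hd] := Hl _ e2; rewrite /dnbhs near_withinE; apply/nbhs_cabsP.
exists d => // h; rewrite subr0 => hd h0.
have := Hd (z + h); rewrite addrC addKr [z + h]addrC => /(_ hd) /le_lt_trans A.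
have : cabs (f (h + z) - f z - h * l) < e * cabs h.
  by apply: A; rewrite ltr_pM2r ?cabs_gt0// gtr_pMr// invf_lt1 ?ltr1n.
rewrite -ltr_pdivrMr ?cabs_gt0// -cabsf mulrBl [h * l]mulrC mulfK//.
by rewrite /GRing.scale /= mulr1 [_ / h]mulrC.
Qed.

End derivative.

(** * Real derivatives and primitives *)

Section real_calculus.
Context {R : realType}.
Implicit Types (u U : R -> R) (a b x : R).

Lemma is_deriveP u x (l : R) : is_derive x 1 u l <->
  forall e : R, 0 < e -> exists2 d : R, 0 < d & forall y, `|y - x| < d ->
    `|u y - u x - (y - x) * l| <= e * `|y - x|.
Proof.
split=> [[/cvg_ex[l' /= Hl] dl]|H].
  have {dl} l'l : l' = l by rewrite -dl; apply/esym/cvg_lim.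
  subst l' => e e0.
  have : \forall h \near 0^', `|l - h^-1 *: (u (h *: 1 + x) - u x)| < e.
    by move: Hl => /cvgrPdist_lt/(_ e e0).
  rewrite near_withinE => /nbhs_ballP[d /= d0 Hd]; exists d => // y yd.
  have [->|yx] := eqVneq y x; first by rewrite !subrr mul0r subr0 normr0 mulr0.
  have yx0 : y - x != 0 by rewrite subr_eq0.
  move: (Hd (y - x)); rewrite /ball /= sub0r normrN => /(_ yd yx0) /ltW.
  rewrite /GRing.scale /= mulr1 subrK -(ler_pM2r (_ : 0 < `|y - x|)) ?normr_gt0//.
  by rewrite distrC -normrM mulrBl mulrAC mulVf// mul1r [l * _]mulrC.
have Hl : (fun h => h^-1 *: (u (h *: 1 + x) - u x)) @ 0^' --> l.
  apply/cvgrPdist_lt => e e0; have e2 : 0 < e / 2 by rewrite divr_gt0.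
  have [d d0 Hd] := H _ e2; rewrite near_withinE; apply/nbhs_ballP; exists d => //.
  move=> h; rewrite /ball /= sub0r normrN => hd h0.
  have := Hd (x + h); rewrite addrC addKr [x + h]addrC => /(_ hd) A.
  rewrite /GRing.scale /= mulr1 -(ltr_pM2r (_ : 0 < `|h|)) ?normr_gt0//.
  rewrite distrC -normrM mulrBl mulrAC mulVf// mul1r [l * h]mulrC.
  by rewrite (le_lt_trans A)// ltr_pM2r ?normr_gt0// gtr_pMr// invf_lt1 ?ltr1n.
split; first by apply/cvg_ex; exists l.
exact/cvg_lim.
Qed.

Lemma mvt u U a b : (forall x, Order.min a b <= x <= Order.max a b -> is_derive x 1 U (u x)) ->
  exists2 c, Order.min a b <= c <= Order.max a b & U b - U a = u c * (b - a).
Proof.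
wlog ab : a b / a < b => [H dU|].
  have [ab|ba|<-] := ltgtP a b.
  - have [c] := H a b ab dU.
    by rewrite (min_l (ltW ab)) (max_r (ltW ab)) => cab ->; exists c.
  - have [|c] := H b a ba; first by rewrite minC maxC.
    rewrite (min_l (ltW ba)) (max_r (ltW ba)) => cab Uab.
    by exists c; rewrite // -opprB Uab -mulrN opprB.
  - by exists a; rewrite ?lexx// !subrr mulr0.
rewrite min_l ?max_r ?ltW// => dU.
have [||c cab Uab] := @MVT R U u a b ab.
- by move=> x; rewrite in_itv /= => /andP[/ltW ax /ltW xb]; apply: dU; rewrite ax.
- apply: derivable_within_continuous => x; rewrite in_itv /= => xab.
  by have [] := dU x xab.
exists c => //.
by move: cab; rewrite in_itv /= => /andP[/ltW -> /ltW].
Qed.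

Lemma mvt_le u U a b m e :
  (forall x, Order.min a b <= x <= Order.max a b -> is_derive x 1 U (u x) /\ `|u x - m| <= e) ->
  `|U b - U a - m * (b - a)| <= e * `|b - a|.
Proof.
move=> H; have [|c cab ->] := @mvt u U a b; first by move=> x /H[].
by rewrite -mulrBl normrM ler_wpM2r// (H c cab).2.
Qed.

Lemma is_derive_eq_cst U a b :
  (forall x, Order.min a b <= x <= Order.max a b -> is_derive x 1 U 0) -> U a = U b.
Proof.
move=> H; have [c _] := @mvt (fun=> 0) U a b H.
by rewrite mul0r => /subr0_eq.
Qed.

Let ftc u A x : continuous u -> A < x ->
  is_derive x 1 (fun y => \int[lebesgue_measure]_(t in `[A, y]) u t) (u x).
Proof.
move=> cu Ax.
have iu : lebesgue_measure.-integrable `[A, x + 1] (EFin \o u).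
  apply: continuous_compact_integrable; first exact: segment_compact.
  by apply: continuous_subspaceT.
have xx1 : x < x + 1 by rewrite ltrDl ltr01.
have [] := continuous_FTC1 xx1 iu Ax (cu x).
move=> /= d e.
by split; [exact: d|rewrite -e derive1E].
Qed.

(** The integral from a base point [A] is differentiable only to the right of
    [A], so the base point moves with the argument; subtracting the value at 0
    makes the pieces agree. *)
Lemma primitive_ex u : continuous u -> exists U, forall x, is_derive x 1 U (u x).
Proof.
move=> cu; pose V A y := \int[lebesgue_measure]_(t in `[A, y]) u t.
pose W A y := V A y - V A 0.
have dW A x : A < x -> is_derive x 1 (W A) (u x).
  move=> Ax; have := is_deriveB (ftc cu Ax) (is_derive_cst (V A 0) x 1).
  by rewrite subr0.
have WW A B y : A < 0 -> A < y -> B < 0 -> B < y -> W A y = W B y.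
  move=> A0 Ay B0 By; apply/eqP; rewrite -subr_eq0; apply/eqP.
  have : (fun y => W A y - W B y) y = (fun y => W A y - W B y) 0.
    apply/esym; apply: (@is_derive_eq_cst (fun y => W A y - W B y)) => x /andP[x1 _].
    have Ax : A < x by rewrite (lt_le_trans _ x1)// lt_min A0 Ay.
    have Bx : B < x by rewrite (lt_le_trans _ x1)// lt_min B0 By.
    by have := is_deriveB (dW _ _ Ax) (dW _ _ Bx); rewrite subrr.
  by move=> /= ->; rewrite /W !subrr.
exists (fun y => W (- (`|y| + 1)) y) => x.
apply/is_deriveP => e e0; pose B := - (`|x| + 2).
have Bx : B < x by rewrite /B; have := ler_norm (- x); rewrite normrN; lra.
have /is_deriveP/(_ e e0)[d d0 Hd] := dW B x Bx.
have eqW y : `|y - x| < 1 -> W (- (`|y| + 1)) y = W B y.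
  move=> yx; have : `|y| <= `|x| + 1.
    by rewrite -[y](subrK x) (le_trans (ler_normD _ _))// addrC lerD2l ltW.
  have := normr_ge0 x; have := normr_ge0 y; have := ler_norm (- y); rewrite normrN /B => *.
  by apply: WW; lra.
exists (Order.min d 1); first by rewrite lt_min d0 ltr01.
move=> y; rewrite lt_min => /andP[yd y1]; rewrite !eqW ?subrr ?normr0//; exact: Hd.
Qed.

Definition prim u : R -> R := xget (fun=> 0) [set U | forall x, is_derive x 1 U (u x)].

Lemma primP u : continuous u -> forall x, is_derive x 1 (prim u) (u x).
Proof. move=> /primitive_ex[U HU].
exact: (@xgetPex (R -> R) (fun=> 0) [set U | forall x, is_derive x 1 U (u x)] (ex_intro _ U HU)). Qed.

End real_calculus.

Section complex_real_calculus.
Context {R : realType}.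
Local Notation C := (R[i]^o).
Implicit Types (z w l : R[i]).

Lemma cder_real (K : R[i] -> R[i]) (x : R) l : cder K x%:C l ->
  is_derive x 1 (fun t => Re (K t%:C)) (Re l) /\
  is_derive x 1 (fun t => Im (K t%:C)) (Im l).
Proof.
move=> /cderP H; split; apply/is_deriveP => e /H[d d0 Hd]; exists d => // y yd.
  have := Hd y%:C; rewrite -(rmorphB (real_complex R)) cabs_real => /(_ yd).
  apply: le_trans; apply: le_trans (Re_le_cabs _).
  by rewrite !cReB (cReM (_%:C)) /= mul0r subr0.
have := Hd y%:C; rewrite -(rmorphB (real_complex R)) cabs_real => /(_ yd).
apply: le_trans; apply: le_trans (Im_le_cabs _).
by rewrite !cImB (cImM (_%:C)) /= mul0r addr0.
Qed.

Lemma expC_near0 (e : R) : 0 < e -> exists2 d : R, 0 < d & forall h, cabs h < d ->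
  cabs (expC h - 1 - h) <= e * cabs h.
Proof.
(* 20 leaves room for the products of the first-order errors of exp, cos
   and sin. *)
move=> e0; pose k := Order.min 1 (e / 20).
have k0 : 0 < k by rewrite lt_min ltr01 divr_gt0.
have k1 : k <= 1 by rewrite ge_min lexx.
have ke : k <= e / 20 by rewrite ge_min lexx orbT.
have /is_deriveP/(_ k k0)[d1 d10 H1] := is_derive_expR (0 : R).
have /is_deriveP/(_ k k0)[d2 d20 H2] := is_derive_cos (0 : R).
have /is_deriveP/(_ k k0)[d3 d30 H3] := is_derive_sin (0 : R).
exists (Order.min (Order.min d1 d2) (Order.min d3 k)).
  by rewrite !lt_min d10 d20 d30 ltr01 divr_gt0.
move=> h; rewrite !lt_min => /andP[/andP[h1 h2] /andP[h3 /andP[r1 hk]]].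
have := Re_le_cabs h; have := Im_le_cabs h; set r := cabs h => Ir Rr.
rewrite -/r in r1 hk.
have r0 : 0 <= r := cabs_ge0 h.
move: (H1 (Re h)) (H2 (Im h)) (H3 (Im h)).
rewrite !subr0 expR0 cos0 sin0 mulr1 oppr0 mulr0 !subr0 mulr1 addr0.
move=> /(_ (le_lt_trans Rr h1)) A /(_ (le_lt_trans Ir h2)) B /(_ (le_lt_trans Ir h3)) D.
apply: le_trans (cabs_le_ReIm _) _.
have -> : Re (expC h - 1 - h) = (expR (Re h) - 1 - Re h) + expR (Re h) * (cos (Im h) - 1).
  by rewrite /expC !cReB cReM /=; ring.
have -> : Im (expC h - 1 - h) = (sin (Im h) - Im h) + (expR (Re h) - 1) * sin (Im h).
  by rewrite /expC !cImB cImM /=; ring.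
have Er : `|expR (Re h) - 1| <= 2 * r.
  have := ler_normD (expR (Re h) - 1 - Re h) (Re h); rewrite subrK => C.
  have : k * `|Re h| <= 1 * r by apply: ler_pM => //; exact: ltW.
  lra.
have E3 : `|expR (Re h)| <= 3.
  have := ler_normD (expR (Re h) - 1) 1; rewrite subrK normr1.
  lra.
have Sr : `|sin (Im h)| <= 2 * r.
  have := ler_normD (sin (Im h) - Im h) (Im h); rewrite subrK => C.
  have : k * `|Im h| <= 1 * r by apply: ler_pM => //; exact: ltW.
  lra.
have := ler_normD (expR (Re h) - 1 - Re h) (expR (Re h) * (cos (Im h) - 1)).
have := ler_normD (sin (Im h) - Im h) ((expR (Re h) - 1) * sin (Im h)).
rewrite !normrM.
have : k * `|Re h| <= k * r by rewrite ler_wpM2l// ltW.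
have kI : k * `|Im h| <= k * r by rewrite ler_wpM2l// ltW.
have : `|expR (Re h)| * `|cos (Im h) - 1| <= 3 * (k * r).
  by apply: ler_pM => //; exact: le_trans kI.
have : `|expR (Re h) - 1| * `|sin (Im h)| <= (2 * k) * (2 * r).
  apply: ler_pM => //; apply: le_trans Er _; by rewrite ler_pM2l// ltW// /k lt_min r1 hk.
have : k * r <= (e / 20) * r by rewrite ler_wpM2r.
have : 0 <= e * r by rewrite mulr_ge0 // ltW.
lra.
Qed.

Lemma cder_expC z : cder expC z (expC z).
Proof.
apply/cderP => e e0; have ez : 0 < e / cabs (expC z).
  by rewrite divr_gt0// cabs_gt0 expC_neq0.
have [d d0 Hd] := expC_near0 ez; exists d => // w /Hd A.
have -> : expC w - expC z - (w - z) * expC z = expC z * (expC (w - z) - 1 - (w - z)).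
  have -> : expC w = expC (w - z) * expC z by rewrite -expCD subrK.
  by ring.
rewrite cabsM mulrC; move: A; rewrite mulrAC ler_pdivlMr//.
by rewrite cabs_gt0 expC_neq0.
Qed.

Lemma cder_expC_comp f z l : cder f z l -> cder (fun w => expC (f w)) z (expC (f z) * l).
Proof. by move=> H; exact: cder_comp H (cder_expC _). Qed.

End complex_real_calculus.

(** * Goursat's theorem and primitives *)

Section goursat.
Context {R : realType}.
Variables (p q P Q : R -> R -> R).
Hypothesis dP : forall x y : R, is_derive x 1 (P ^~ y) (p x y).
Hypothesis dQ : forall x y : R, is_derive y 1 (Q x) (q x y).

(** The integral of the form [p dx + q dy] along the boundary of
    [x1, x2] x [y1, y2], written with the partial primitives [P] and [Q]. *)
Let J x1 x2 y1 y2 := (P x2 y1 - P x1 y1) + (Q x2 y2 - Q x2 y1)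
  - (P x2 y2 - P x1 y2) - (Q x1 y2 - Q x1 y1).

(** [p] and [q] are differentiable at (x, y) and the form is closed there: the
    cross derivatives agree. *)
Definition closed_at x y := exists A B D, forall e : R, 0 < e ->
  exists2 d : R, 0 < d & forall s t, `|s - x| < d -> `|t - y| < d ->
    `|p s t - (p x y + A * (s - x) + B * (t - y))| <= e * (`|s - x| + `|t - y|) /\
    `|q s t - (q x y + B * (s - x) + D * (t - y))| <= e * (`|s - x| + `|t - y|).

Let near_int (a b s x : R) : a <= s <= b -> a <= x <= b -> `|s - x| <= b - a.
Proof. by move=> /andP[? ?] /andP[? ?]; rewrite ler_norml; apply/andP; split; lra. Qed.

(** On a small rectangle around a point of closedness the form is affine up to
    an error, and a closed affine form has no circulation. *)
Let J_small (x y e x1 x2 y1 y2 A B D : R) :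
    x1 <= x <= x2 -> y1 <= y <= y2 -> 0 <= e ->
    (forall s t, x1 <= s <= x2 -> y1 <= t <= y2 ->
      `|p s t - (p x y + A * (s - x) + B * (t - y))| <= e * (`|s - x| + `|t - y|) /\
      `|q s t - (q x y + B * (s - x) + D * (t - y))| <= e * (`|s - x| + `|t - y|)) ->
  `|J x1 x2 y1 y2| <= 2 * e * (x2 - x1 + (y2 - y1)) ^+ 2.
Proof.
move=> xI yI e0 H; set L := x2 - x1 + (y2 - y1).
have x12 : x1 <= x2 by case/andP: xI; apply: le_trans.
have y12 : y1 <= y2 by case/andP: yI; apply: le_trans.
have x1I : x1 <= x1 <= x2 by rewrite lexx.
have x2I : x1 <= x2 <= x2 by rewrite lexx andbT.
have y1I : y1 <= y1 <= y2 by rewrite lexx.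
have y2I : y1 <= y2 <= y2 by rewrite lexx andbT.
have bnd s t : x1 <= s <= x2 -> y1 <= t <= y2 -> e * (`|s - x| + `|t - y|) <= e * L.
  by move=> sI tI; rewrite ler_wpM2l// lerD ?near_int.
pose a s := p x y * s + A / 2 * (s - x) ^+ 2.
pose b t := q x y * t + D / 2 * (t - y) ^+ 2.
have dsq (c s : R) : is_derive s 1 (fun s => (s - c) ^+ 2) (2 * (s - c)).
  apply: is_derive_eq; rewrite /GRing.scale /= ?mulr1 ?subr0; ring.
have horiz t : y1 <= t <= y2 ->
    `|P x2 t - P x1 t - (a x2 - a x1 + B * (t - y) * (x2 - x1))| <= e * L * (x2 - x1).
  move=> tI; pose U s := P s t - (a s + B * (t - y) * s).
  have -> : P x2 t - P x1 t - (a x2 - a x1 + B * (t - y) * (x2 - x1))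
    = U x2 - U x1 - 0 * (x2 - x1) by rewrite /U; ring.
  rewrite -[X in _ <= _ * X](ger0_norm (_ : 0 <= x2 - x1)) ?subr_ge0//.
  apply: (@mvt_le _ (fun s => p s t - (p x y + A * (s - x) + B * (t - y)))) => s.
  rewrite min_l// max_r// => sI; split; last first.
    by rewrite subr0 (le_trans (H _ _ sI tI).1)// bnd.
  have da : is_derive s 1 a (p x y + A * (s - x)).
    have ? := dsq x s.
    by apply: is_derive_eq; rewrite /GRing.scale /= ?mulr1; field.
  have ? := dP s t.
  apply: is_derive_eq; rewrite /GRing.scale /= ?mulr1; ring.
have vert s : x1 <= s <= x2 ->
    `|Q s y2 - Q s y1 - (b y2 - b y1 + B * (s - x) * (y2 - y1))| <= e * L * (y2 - y1).
  move=> sI; pose U t := Q s t - (b t + B * (s - x) * t).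
  have -> : Q s y2 - Q s y1 - (b y2 - b y1 + B * (s - x) * (y2 - y1))
    = U y2 - U y1 - 0 * (y2 - y1) by rewrite /U; ring.
  rewrite -[X in _ <= _ * X](ger0_norm (_ : 0 <= y2 - y1)) ?subr_ge0//.
  apply: (@mvt_le _ (fun t => q s t - (q x y + B * (s - x) + D * (t - y)))) => t.
  rewrite min_l// max_r// => tI; split; last first.
    by rewrite subr0 (le_trans (H _ _ sI tI).2)// bnd.
  have db : is_derive t 1 b (q x y + D * (t - y)).
    have ? := dsq y t.
    by apply: is_derive_eq; rewrite /GRing.scale /= ?mulr1; field.
  have ? := dQ s t.
  apply: is_derive_eq; rewrite /GRing.scale /= ?mulr1; ring.
have := horiz _ y1I; have := horiz _ y2I; have := vert _ x1I; have := vert _ x2I.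
set v2 := (X in `|X|); set v1 := (X in _ -> `|X| <= _ -> _ -> _ -> _).
set h2 := (X in _ -> _ -> `|X| <= _ -> _ -> _); set h1 := (X in _ -> _ -> _ -> `|X| <= _ -> _).
move=> V2 V1 H2 H1.
have -> : J x1 x2 y1 y2 = h1 + v2 - h2 - v1 by rewrite /J /h1 /h2 /v1 /v2; ring.
have -> : 2 * e * L ^+ 2 = e * L * (x2 - x1) + e * L * (y2 - y1) + e * L * (x2 - x1)
  + e * L * (y2 - y1) by rewrite /L; ring.
by rewrite (le_trans (ler_normB _ _))// lerD// (le_trans (ler_normB _ _))// lerD//
  (le_trans (ler_normD _ _))// lerD.
Qed.

Let quarter (x y w h : R) : exists2 xy : R * R,
  (xy.1 = x \/ xy.1 = x + w) /\ (xy.2 = y \/ xy.2 = y + h) &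
  `|J x (x + 2 * w) y (y + 2 * h)| <= 4 * `|J xy.1 (xy.1 + w) xy.2 (xy.2 + h)|.
Proof.
set K := `|J x (x + 2 * w) y (y + 2 * h)|.
pose Jq s t := J s (s + w) t (t + h).
have K4 : K <= `|Jq x y| + `|Jq (x + w) y| + `|Jq x (y + h)| + `|Jq (x + w) (y + h)|.
  have xw : x + w + w = x + 2 * w by ring.
  have yh : y + h + h = y + 2 * h by ring.
  have -> : K = `|Jq x y + Jq (x + w) y + Jq x (y + h) + Jq (x + w) (y + h)|.
    by rewrite /K /Jq xw yh; congr `|_|; rewrite /J; ring.
  by rewrite !(le_trans (ler_normD _ _))// lerD// !(le_trans (ler_normD _ _))// lerD// (le_trans (ler_normD _ _)).
have [A|A] := leP K (4 * `|Jq x y|); first by exists (x, y) => //=; split; left.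
have [B|B] := leP K (4 * `|Jq (x + w) y|); first by exists (x + w, y) => //=; split; [right|left].
have [D|D] := leP K (4 * `|Jq x (y + h)|); first by exists (x, y + h) => //=; split; [left|right].
by exists (x + w, y + h) => /=; [split; right|]; rewrite -/(Jq _ _); lra.
Qed.

(** Goursat's bisection: keeping a quarter with the largest circulation, the
    circulations decrease at most like [4 ^ -n], whereas around the common
    point of the nested rectangles [J_small] makes them [o(4 ^ -n)]. *)
Let goursat_closed (x y w h : R) : 0 <= w -> 0 <= h ->
  (forall s t, x <= s <= x + w -> y <= t <= y + h -> closed_at s t) ->
  J x (x + w) y (y + h) = 0.
Proof.
move=> w0 h0 cl; apply/eqP/negPn/negP; rewrite -normr_gt0; set K := `|_| => K0.
pose W n := w / 2 ^+ n; pose H n := h / 2 ^+ n.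
have W0 n : 0 <= W n by rewrite divr_ge0// exprn_ge0.
have H0 n : 0 <= H n by rewrite divr_ge0// exprn_ge0.
have WS n : W n = 2 * W n.+1 by rewrite /W exprS invfM; field; rewrite expf_neq0.
have HS n : H n = 2 * H n.+1 by rewrite /H exprS invfM; field; rewrite expf_neq0.
pose good n (z xy : R * R) := [/\ (xy.1 = z.1 \/ xy.1 = z.1 + W n.+1),
  (xy.2 = z.2 \/ xy.2 = z.2 + H n.+1) &
  `|J z.1 (z.1 + W n) z.2 (z.2 + H n)| <=
  4 * `|J xy.1 (xy.1 + W n.+1) xy.2 (xy.2 + H n.+1)|].
have good_ex n z : exists xy, good n z xy.
  have [xy [a b] c] := quarter z.1 z.2 (W n.+1) (H n.+1).
  by exists xy; split => //; rewrite WS HS.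
pose u := fix u n : R * R := if n is m.+1 then xget (x, y) (good m (u m)) else (x, y).
have uS n : good n (u n) (u n.+1) by apply: (@xgetPex _ (x, y) (good n (u n))).
have Ju n : K / 4 ^+ n <= `|J (u n).1 ((u n).1 + W n) (u n).2 ((u n).2 + H n)|.
  elim: n => [|n IH]; first by rewrite /W /H !expr0 !divr1.
  have [_ _ G] := uS n; rewrite exprS invfM mulrCA ler_pdivrMl//.
  exact: le_trans G.
have x_inc n m : (n <= m)%N -> (u n).1 <= (u m).1.
  apply: (@homo_leq _ (fun n => (u n).1) (fun a b => a <= b)) => // [a b c|i]; first exact: le_trans.
  by have [[->|->] _ _] := uS i; rewrite ?lerDl.
have y_inc n m : (n <= m)%N -> (u n).2 <= (u m).2.
  apply: (@homo_leq _ (fun n => (u n).2) (fun a b => a <= b)) => // [a b c|i]; first exact: le_trans.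
  by have [_ [->|->] _] := uS i; rewrite ?lerDl.
have x_dec n m : (n <= m)%N -> (u m).1 + W m <= (u n).1 + W n.
  apply: (@homo_leq _ (fun n => (u n).1 + W n) (fun a b => b <= a)) => // [a b c|i].
    by move=> /[swap]; apply: le_trans.
  by have [[->|->] _ _] := uS i; rewrite (WS i); have := W0 i.+1; lra.
have y_dec n m : (n <= m)%N -> (u m).2 + H m <= (u n).2 + H n.
  apply: (@homo_leq _ (fun n => (u n).2 + H n) (fun a b => b <= a)) => // [a b c|i].
    by move=> /[swap]; apply: le_trans.
  by have [_ [->|->] _] := uS i; rewrite (HS i); have := H0 i.+1; lra.
have x_ub n m : (u n).1 <= (u m).1 + W m.
  have [nm|/ltnW mn] := leqP n m.
    by rewrite (le_trans (x_inc _ _ nm))// lerDl.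
  by rewrite (le_trans _ (x_dec _ _ mn))// lerDl.
have y_ub n m : (u n).2 <= (u m).2 + H m.
  have [nm|/ltnW mn] := leqP n m.
    by rewrite (le_trans (y_inc _ _ nm))// lerDl.
  by rewrite (le_trans _ (y_dec _ _ mn))// lerDl.
pose X := sup (range (fun n => (u n).1)); pose Y := sup (range (fun n => (u n).2)).
have XI n : (u n).1 <= X <= (u n).1 + W n.
  apply/andP; split.
    apply: sup_ubound; last by exists n.
    by exists ((u 0%N).1 + W 0%N) => _ [m _ <-].
  by apply: ge_sup; [exists (u 0%N).1; exists 0%N|move=> _ [m _ <-]].
have YI n : (u n).2 <= Y <= (u n).2 + H n.
  apply/andP; split.
    apply: sup_ubound; last by exists n.
    by exists ((u 0%N).2 + H 0%N) => _ [m _ <-].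
  by apply: ge_sup; [exists (u 0%N).2; exists 0%N|move=> _ [m _ <-]].
have [||A [B [D cl']]] := cl X Y; first by have := XI 0%N; rewrite /W expr0 divr1.
  by have := YI 0%N; rewrite /H expr0 divr1.
pose L := w + h + 1; have L0 : 0 < L by rewrite ltr_wpDl ?addr_ge0.
pose e := K / (4 * L ^+ 2).
have e0 : 0 < e by rewrite divr_gt0// mulr_gt0// exprn_gt0.
have [d d0 Hd] := cl' e e0.
have [n nd] : exists n, L / 2 ^+ n < d.
  exists (Num.bound (L / d)); rewrite ltr_pdivrMr ?exprn_gt0// mulrC -ltr_pdivrMr//.
  rewrite (lt_le_trans (archi_boundP _)) ?divr_ge0 ?(ltW L0) ?(ltW d0)//.
  by rewrite -natrX ler_nat ltnW// ltn_expl.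
have WL : W n < d.
  by rewrite (le_lt_trans _ nd)// ler_pM2r ?invr_gt0 ?exprn_gt0// /L; lra.
have HL : H n < d.
  by rewrite (le_lt_trans _ nd)// ler_pM2r ?invr_gt0 ?exprn_gt0// /L; lra.
suff : `|J (u n).1 ((u n).1 + W n) (u n).2 ((u n).2 + H n)| < K / 4 ^+ n.
  by rewrite ltNge Ju.
apply: le_lt_trans (J_small (A := A) (B := B) (D := D) (XI n) (YI n) (ltW e0) _) _.
  move=> s t sI tI; apply: Hd.
    by rewrite (le_lt_trans (near_int sI (XI n)))// addrC addKr.
  by rewrite (le_lt_trans (near_int tI (YI n)))// addrC addKr.
have -> : (u n).1 + W n - (u n).1 + ((u n).2 + H n - (u n).2) = (w + h) / 2 ^+ n.
  by rewrite /W /H; field; rewrite expf_neq0.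
rewrite expr_div_n -exprM mulnC exprM (_ : 2 ^+ 2 = 4); last by ring.
rewrite mulrA ltr_pM2r ?invr_gt0 ?exprn_gt0// /e.
rewrite (_ : 2 * _ * _ = K * ((w + h) ^+ 2 / (2 * L ^+ 2))); last first.
  by field; rewrite gt_eqF.
rewrite gtr_pMr// ltr_pdivrMr ?mulr_gt0 ?exprn_gt0// mul1r.
rewrite (@le_lt_trans _ _ (L ^+ 2))//.
  by rewrite ler_pXn2r ?nnegrE ?addr_ge0// ?ltW// /L; lra.
by rewrite ltr_pMl ?ltr1n// exprn_gt0.
Qed.

Let goursat_closed_rect x1 x2 y1 y2 : x1 <= x2 -> y1 <= y2 ->
  (forall s t, x1 <= s <= x2 -> y1 <= t <= y2 -> closed_at s t) -> J x1 x2 y1 y2 = 0.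
Proof.
move=> x12 y12 cl; rewrite -[x2](subrKC x1) -[y2](subrKC y1).
by apply: goursat_closed; rewrite ?subr_ge0// !subrKC.
Qed.

Let J_bound M x1 x2 y1 y2 : x1 <= x2 -> y1 <= y2 ->
  (forall s t, x1 <= s <= x2 -> y1 <= t <= y2 -> `|p s t| <= M /\ `|q s t| <= M) ->
  `|J x1 x2 y1 y2| <= 2 * M * (x2 - x1 + (y2 - y1)).
Proof.
move=> x12 y12 H.
have horiz t : y1 <= t <= y2 -> `|P x2 t - P x1 t| <= M * (x2 - x1).
  move=> tI; rewrite -[X in _ <= _ * X](ger0_norm (_ : 0 <= x2 - x1)) ?subr_ge0//.
  rewrite -[X in `|X|]subr0 -[X in `|_ - X|](mul0r (x2 - x1)).
  apply: (@mvt_le _ (p ^~ t) (P ^~ t)) => s; rewrite min_l// max_r// => sI.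
  by split; [exact: dP|rewrite subr0; exact: (H _ _ sI tI).1].
have vert s : x1 <= s <= x2 -> `|Q s y2 - Q s y1| <= M * (y2 - y1).
  move=> sI; rewrite -[X in _ <= _ * X](ger0_norm (_ : 0 <= y2 - y1)) ?subr_ge0//.
  rewrite -[X in `|X|]subr0 -[X in `|_ - X|](mul0r (y2 - y1)).
  apply: (@mvt_le _ (q s) (Q s)) => t; rewrite min_l// max_r// => tI.
  by split; [exact: dQ|rewrite subr0; exact: (H _ _ sI tI).2].
have h1 : `|P x2 y1 - P x1 y1| <= M * (x2 - x1) by apply: horiz; rewrite lexx.
have h2 : `|P x2 y2 - P x1 y2| <= M * (x2 - x1) by apply: horiz; rewrite lexx andbT.
have v1 : `|Q x1 y2 - Q x1 y1| <= M * (y2 - y1) by apply: vert; rewrite lexx.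
have v2 : `|Q x2 y2 - Q x2 y1| <= M * (y2 - y1) by apply: vert; rewrite lexx andbT.
have -> : 2 * M * (x2 - x1 + (y2 - y1)) =
  M * (x2 - x1) + M * (y2 - y1) + M * (x2 - x1) + M * (y2 - y1) by ring.
by rewrite /J (le_trans (ler_normB _ _))// lerD// (le_trans (ler_normB _ _))// lerD//
  (le_trans (ler_normD _ _))// lerD.
Qed.

Definition jcont (u : R -> R -> R) (x y : R) := forall e : R, 0 < e ->
  exists2 d : R, 0 < d & forall s t, `|s - x| < d -> `|t - y| < d -> `|u s t - u x y| < e.

Hypothesis pc : forall x y, jcont p x y.
Hypothesis qc : forall x y, jcont q x y.

(** An exceptional point is enclosed in a small square; the circulation around
    the square is at most its perimeter times a bound of the form. *)
Let goursat_rect x0 y0 x1 x2 y1 y2 : x1 <= x2 -> y1 <= y2 ->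
  (forall s t, x1 <= s <= x2 -> y1 <= t <= y2 -> (s != x0) || (t != y0) -> closed_at s t) ->
  J x1 x2 y1 y2 = 0.
Proof.
move=> x12 y12 cl.
have [/andP[x0I y0I]|x0N] := boolP ((x1 <= x0 <= x2) && (y1 <= y0 <= y2)); last first.
  apply: goursat_closed_rect => // s t sI tI; apply: cl => //; apply: contraNT x0N.
  by rewrite negb_or !negbK => /andP[/eqP <- /eqP <-]; rewrite sI.
have [d1 d10 pM] := pc x0 y0 ltr01; have [d2 d20 qM] := qc x0 y0 ltr01.
pose M := `|p x0 y0| + `|q x0 y0| + 1; have M0 : 0 < M by rewrite ltr_wpDl ?addr_ge0.
apply/eqP; rewrite -normr_eq0; apply/eqP/le_anti; rewrite normr_ge0 andbT.
apply/ler_addgt0Pl => e e0; rewrite addr0.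
pose D := Order.min (Order.min d1 d2 / 2) (e / (8 * M)).
have D0 : 0 < D by rewrite lt_min !divr_gt0// ?mulr_gt0// lt_min d10.
have D1 : D < d1.
  have : D <= Order.min d1 d2 / 2 by rewrite ge_min lexx.
  have : Order.min d1 d2 <= d1 by rewrite ge_min lexx.
  by lra.
have D2 : D < d2.
  have : D <= Order.min d1 d2 / 2 by rewrite ge_min lexx.
  have : Order.min d1 d2 <= d2 by rewrite ge_min lexx orbT.
  by lra.
have De : D <= e / (8 * M) by rewrite ge_min lexx orbT.
pose a := Order.max x1 (x0 - D); pose b := Order.min x2 (x0 + D).
pose c := Order.max y1 (y0 - D); pose d := Order.min y2 (y0 + D).
have a1 : x1 <= a by rewrite le_max lexx.
have a2 : x0 - D <= a by rewrite le_max lexx orbT.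
have a3 : a <= x0 by rewrite ge_max (andP x0I).1/= gerBl ltW.
have b1 : b <= x2 by rewrite ge_min lexx.
have b2 : b <= x0 + D by rewrite ge_min lexx orbT.
have b3 : x0 <= b by rewrite le_min (andP x0I).2/= lerDl ltW.
have c1 : y1 <= c by rewrite le_max lexx.
have c2 : y0 - D <= c by rewrite le_max lexx orbT.
have c3 : c <= y0 by rewrite ge_max (andP y0I).1/= gerBl ltW.
have e1 : d <= y2 by rewrite ge_min lexx.
have e2 : d <= y0 + D by rewrite ge_min lexx orbT.
have e3 : y0 <= d by rewrite le_min (andP y0I).2/= lerDl ltW.
have JL : J x1 a y1 y2 = 0.
  have [<-|ax] := eqVneq x1 a; first by rewrite /J; ring.
  have ae : a = x0 - D by move: ax; rewrite /a; case: leP => //; rewrite eqxx.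
  apply: goursat_closed_rect => // s t /andP[s1 s2] tI; apply: cl => //.
    by rewrite s1 (le_trans s2)// (le_trans a3)// (andP x0I).2.
  by rewrite lt_eqF//; lra.
have JR : J b x2 y1 y2 = 0.
  have [<-|bx] := eqVneq x2 b; first by rewrite /J; ring.
  have be : b = x0 + D by move: bx; rewrite /b; case: leP => //; rewrite eqxx.
  apply: goursat_closed_rect => // s t /andP[s1 s2] tI; apply: cl => //.
    by rewrite s2 andbT (le_trans _ s1)// (le_trans _ b3)// (andP x0I).1.
  by rewrite gt_eqF//; lra.
have ab s : a <= s <= b -> x1 <= s <= x2.
  by move=> /andP[/(le_trans a1) -> /le_trans]; apply.
have JB : J a b y1 c = 0.
  have [<-|cy] := eqVneq y1 c; first by rewrite /J; ring.
  have ce : c = y0 - D by move: cy; rewrite /c; case: leP => //; rewrite eqxx.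
  apply: goursat_closed_rect => //; first exact: le_trans b3.
  move=> s t sI /andP[t1 t2]; apply: cl => //; first exact: ab.
    by rewrite t1 (le_trans t2)// (le_trans c3)// (andP y0I).2.
  by apply/orP; right; rewrite lt_eqF//; lra.
have JT : J a b d y2 = 0.
  have [<-|dy] := eqVneq y2 d; first by rewrite /J; ring.
  have de : d = y0 + D by move: dy; rewrite /d; case: leP => //; rewrite eqxx.
  apply: goursat_closed_rect => //; first exact: le_trans b3.
  move=> s t sI /andP[t1 t2]; apply: cl => //; first exact: ab.
    by rewrite t2 andbT (le_trans _ t1)// (le_trans _ e3)// (andP y0I).1.
  by apply/orP; right; rewrite gt_eqF//; lra.
have -> : J x1 x2 y1 y2 = J a b c d.
  transitivity (J x1 a y1 y2 + J b x2 y1 y2 + J a b y1 c + J a b d y2 + J a b c d).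
    by rewrite /J; ring.
  by rewrite JL JR JB JT; ring.
have := @J_bound M a b c d (le_trans a3 b3) (le_trans c3 e3).
set K := `|J a b c d| => HK; have {HK} : K <= 2 * M * (b - a + (d - c)).
  apply: HK => s t /andP[sa sb] /andP[tc td].
  have sx : `|s - x0| < d1 /\ `|s - x0| < d2 by rewrite !ltr_norml; split; apply/andP; split; lra.
  have ty : `|t - y0| < d1 /\ `|t - y0| < d2 by rewrite !ltr_norml; split; apply/andP; split; lra.
  have := pM s t sx.1 ty.1; have := qM s t sx.2 ty.2.
  have := ler_normD (p s t - p x0 y0) (p x0 y0); have := ler_normD (q s t - q x0 y0) (q x0 y0).
  rewrite !subrK /M; have := normr_ge0 (p x0 y0); have := normr_ge0 (q x0 y0).
  by move=> *; split; lra.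
move=> KM; apply: le_trans KM _; rewrite (@le_trans _ _ (2 * M * (4 * D)))//.
  by rewrite ler_pM2l ?mulr_gt0//; lra.
have -> : 2 * M * (4 * D) = D * (8 * M) by ring.
by rewrite -ler_pdivlMr// mulr_gt0.
Qed.

Let goursat_any x0 y0 x1 x2 y1 y2 :
  (forall s t, Order.min x1 x2 <= s <= Order.max x1 x2 ->
     Order.min y1 y2 <= t <= Order.max y1 y2 -> (s != x0) || (t != y0) -> closed_at s t) ->
  J x1 x2 y1 y2 = 0.
Proof.
case: (leP x1 x2) => [x12|/ltW x12]; case: (leP y1 y2) => [y12|/ltW y12] cl.
- exact: (@goursat_rect x0 y0).
- transitivity (- J x1 x2 y2 y1); first by rewrite /J; ring.
  by rewrite (@goursat_rect x0 y0) ?oppr0.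
- transitivity (- J x2 x1 y1 y2); first by rewrite /J; ring.
  by rewrite (@goursat_rect x0 y0) ?oppr0.
- transitivity (J x2 x1 y2 y1); first by rewrite /J; ring.
  by rewrite (@goursat_rect x0 y0).
Qed.

Let sqr_between (a b c : R) : Order.min a b <= c <= Order.max a b ->
  c ^+ 2 <= a ^+ 2 \/ c ^+ 2 <= b ^+ 2.
Proof.
wlog ab : a b / a <= b => [H|].
  have [ab|/ltW ba] := leP a b; first by move=> ?; apply: H; rewrite ?min_l ?max_r.
  by move=> ?; rewrite or_comm; apply: H; rewrite ?min_l ?max_r.
rewrite min_l// max_r// => /andP[ac cb].
have [c0|/ltW c0] := leP 0 c; [right|left]; nra.
Qed.

(** A form that is closed on the disc of radius [Num.sqrt rho], except at one
    point where it is merely continuous, has a potential there: integrate along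
    the horizontal axis and then vertically; Goursat's theorem lets the last
    step be replaced by a short path from the point where one differentiates. *)
Lemma potential (rho x0 y0 : R) :
  (forall x y, x ^+ 2 + y ^+ 2 < rho -> (x != x0) || (y != y0) -> closed_at x y) ->
  exists E : R -> R -> R, forall x y, x ^+ 2 + y ^+ 2 < rho ->
    forall e : R, 0 < e -> exists2 d : R, 0 < d &
    forall s t, `|s - x| < d -> `|t - y| < d ->
    `|E s t - E x y - (p x y * (s - x) + q x y * (t - y))| <= e * (`|s - x| + `|t - y|).
Proof.
move=> cl; exists (fun x y => P x 0 - P 0 0 + Q x y - Q x 0) => x y xy e e0.
have [d1 d10 H1] := pc x y e0; have [d2 d20 H2] := qc x y e0.
pose n := rho - (x ^+ 2 + y ^+ 2); have n0 : 0 < n by rewrite subr_gt0.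
pose d3 := Order.min 1 (n / (2 * `|x| + 1)).
have x0' : 0 < 2 * `|x| + 1 by rewrite ltr_wpDl ?mulr_ge0.
have d30 : 0 < d3 by rewrite lt_min ltr01 divr_gt0.
exists (Order.min (Order.min d1 d2) d3).
  by rewrite lt_min d30 lt_min d10 d20.
move=> s t; rewrite lt_min [X in X && _]lt_min => /andP[/andP[s1 s2] s3].
rewrite lt_min [X in X && _]lt_min => /andP[/andP[t1 t2] t3].
have sy : s ^+ 2 + y ^+ 2 < rho.
  have : s ^+ 2 - x ^+ 2 < n; last by rewrite /n; lra.
  rewrite subr_sqr mulrC (le_lt_trans (ler_norm _))// normrM.
  have : `|s - x| < n / (2 * `|x| + 1) by rewrite (lt_le_trans s3)// ge_min lexx orbT.
  rewrite ltr_pdivlMr//; apply: le_lt_trans; rewrite mulrC ler_wpM2l//.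
  have : `|s - x| < 1 by rewrite (lt_le_trans s3)// ge_min lexx.
  have := ler_normD (s - x) (2 * x); rewrite normrM (ger0_norm (_ : 0 <= 2))//.
  have -> : s - x + 2 * x = s + x by ring.
  by lra.
have J0 : J x s 0 y = 0.
  apply: (@goursat_any x0 y0) => s' t' sI tI; apply: cl.
  have tt : t' ^+ 2 <= y ^+ 2.
    by have [|//] := sqr_between tI; rewrite expr0n => /le_trans; apply; exact: sqr_ge0.
  by have [|] := sqr_between sI; lra.
have -> : P s 0 - P 0 0 + Q s t - Q s 0 - (P x 0 - P 0 0 + Q x y - Q x 0) -
  (p x y * (s - x) + q x y * (t - y)) =
  (P s y - P x y - p x y * (s - x)) + (Q s t - Q s y - q x y * (t - y)).
  by move: J0; rewrite /J => /eqP; rewrite -subr_eq0 => /eqP J0; rewrite -[RHS]addr0 -[X in _ = _ + X]J0; ring.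
have btw (a b c : R) : Order.min a b <= c <= Order.max a b -> `|c - a| <= `|b - a|.
  case: (leP a b) => [ab|/ltW ab] /andP[? ?].
    by rewrite !ger0_norm; lra.
  by rewrite !ler0_norm; lra.
rewrite (le_trans (ler_normD _ _))// [X in _ <= X]mulrDr lerD//.
  apply: (@mvt_le _ (p ^~ y) (P ^~ y)) => s' /btw sI; split; first exact: dP.
  by rewrite ltW// H1 ?subrr ?normr0// (le_lt_trans sI).
apply: (@mvt_le _ (q s) (Q s)) => t' /btw tI; split; first exact: dQ.
by rewrite ltW// H2// (le_lt_trans tI).
Qed.

End goursat.

Section primitive.
Context {R : realType}.
Implicit Types (f : R[i] -> R[i]) (z w : R[i]) (rho : R).

Let jcont_cont (u : R -> R -> R) x y : jcont u x y ->
  {for x, continuous (u ^~ y)} /\ {for y, continuous (u x)}.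
Proof.
move=> H; split; apply/cvgrPdist_lt => e /H[d d0 Hd]; apply/nbhs_ballP; exists d => //.
  move=> s; rewrite /ball /= distrC => sd.
  by rewrite distrC; apply: Hd; rewrite ?subrr ?normr0.
move=> s; rewrite /ball /= distrC => sd.
by rewrite distrC; apply: Hd; rewrite ?subrr ?normr0.
Qed.

Let cabs_xy (s t x y : R) : cabs ((s +i* t) - (x +i* y)) <= `|s - x| + `|t - y|.
Proof. by rewrite (le_trans (cabs_le_ReIm _)). Qed.

Let ccont_jcont f x y : ccont f (x +i* y) ->
  [/\ jcont (fun x y => Re (f (x +i* y))) x y,
      jcont (fun x y => Im (f (x +i* y))) x y &
      jcont (fun x y => - Im (f (x +i* y))) x y].
Proof.
move=> fc.
have H e : 0 < e -> exists2 d : R, 0 < d & forall s t, `|s - x| < d -> `|t - y| < d ->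
    cabs (f (s +i* t) - f (x +i* y)) < e.
  move=> /fc[d d0 Hd]; exists (d / 2); first by rewrite divr_gt0.
  move=> s t sd td; apply: Hd; rewrite (le_lt_trans (cabs_xy _ _ _ _))//.
  by rewrite [d]splitr ltrD.
split=> e /H[d d0 Hd]; exists d => // s t sd td; apply: le_lt_trans (Hd s t sd td).
- by rewrite -cReB Re_le_cabs.
- by rewrite -cImB Im_le_cabs.
- by rewrite -opprD normrN -cImB Im_le_cabs.
Qed.

(** The Cauchy-Riemann equations, as closedness of the real and imaginary
    parts of [f dz]. *)
Let cder_closed f x y l : cder f (x +i* y) l ->
  closed_at (fun x y => Re (f (x +i* y))) (fun x y => - Im (f (x +i* y))) x y /\
  closed_at (fun x y => Im (f (x +i* y))) (fun x y => Re (f (x +i* y))) x y.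
Proof.
move=> /cderP fd; case: l fd => a b fd.
have H e : 0 < e -> exists2 d : R, 0 < d & forall s t, `|s - x| < d -> `|t - y| < d ->
    `|Re (f (s +i* t)) - (Re (f (x +i* y)) + a * (s - x) - b * (t - y))| <= e * (`|s - x| + `|t - y|) /\
    `|Im (f (s +i* t)) - (Im (f (x +i* y)) + b * (s - x) + a * (t - y))| <= e * (`|s - x| + `|t - y|).
  move=> e0; have [d d0 Hd] := fd e e0; exists (d / 2); first by rewrite divr_gt0.
  move=> s t sd td; have wd : cabs ((s +i* t) - (x +i* y)) < d.
    by rewrite (le_lt_trans (cabs_xy _ _ _ _))// [d]splitr ltrD.
  have := Hd _ wd; set D := (X in cabs X <= _) => DH.
  have {}DH : cabs D <= e * (`|s - x| + `|t - y|).
    by rewrite (le_trans DH)// ler_wpM2l ?cabs_xy// ltW.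
  split; apply: le_trans DH.
    apply: le_trans (Re_le_cabs _); rewrite /D !cReB cReM /= le_eqVlt; apply/orP; left; apply/eqP.
    by congr `|_|; ring.
  apply: le_trans (Im_le_cabs _); rewrite /D !cImB cImM /= le_eqVlt; apply/orP; left; apply/eqP.
  by congr `|_|; ring.
split.
  exists a, (- b), (- a) => e /H[d d0 Hd]; exists d => // s t sd td.
  have [A B] := Hd s t sd td; split; first by rewrite mulNr.
  have -> : - Im (f (s +i* t)) - (- Im (f (x +i* y)) + - b * (s - x) + - a * (t - y)) =
    - (Im (f (s +i* t)) - (Im (f (x +i* y)) + b * (s - x) + a * (t - y))) by ring.
  by rewrite normrN.
exists b, a, (- b) => e /H[d d0 Hd]; exists d => // s t sd td.
by have [A B] := Hd s t sd td; split => //; rewrite mulNr.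
Qed.

Let primitive_global f rho z0 : (forall z, ccont f z) ->
  (forall z, cabs z < rho -> z != z0 -> exists l, cder f z l) ->
  exists H, forall z, cabs z < rho -> cder H z (f z).
Proof.
move=> fc fd; have [rho0|rho0] := leP rho 0.
  by exists id => z zr; have := cabs_ge0 z; lra.
pose U x y := Re (f (x +i* y)); pose V x y := Im (f (x +i* y)); pose NV x y := - V x y.
have Uc x y : jcont U x y by have [] := ccont_jcont (fc (x +i* y)).
have Vc x y : jcont V x y by have [] := ccont_jcont (fc (x +i* y)).
have NVc x y : jcont NV x y by have [] := ccont_jcont (fc (x +i* y)).
have px (u : R -> R -> R) : (forall x y, jcont u x y) -> forall x y : R,
    is_derive x 1 (fun s => prim (fun s => u s y) s) (u x y).
  by move=> uc x y; apply: (@primP _ (fun s => u s y)) => s; have [] := jcont_cont (uc s y).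
have py (u : R -> R -> R) : (forall x y, jcont u x y) -> forall x y : R,
    is_derive y 1 (prim (u x)) (u x y).
  by move=> uc x y; apply: primP => s; have [] := jcont_cont (uc x s).
have disc x y : x ^+ 2 + y ^+ 2 < rho ^+ 2 -> cabs (x +i* y) < rho.
  by move=> xy; rewrite -(ltr_pXn2r (_ : 0 < 2)%N) ?nnegrE ?cabs_ge0 ?(ltW rho0)// cabs_sqr.
have ne (x y : R) : (x != Re z0) || (y != Im z0) -> x +i* y != z0.
  by case: z0 {fd} => a b /=; rewrite eq_complex negb_and.
have [|E1 HE1] := @potential _ U NV _ _ (px U Uc) (py NV NVc) Uc NVc (rho ^+ 2) (Re z0) (Im z0).
  move=> x y /disc xy /ne xy0; have [l /cder_closed[+ _]] := fd _ xy xy0; exact.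
have [|E2 HE2] := @potential _ V U _ _ (px V Vc) (py U Uc) Vc Uc (rho ^+ 2) (Re z0) (Im z0).
  move=> x y /disc xy /ne xy0; have [l /cder_closed[_ +]] := fd _ xy xy0; exact.
exists (fun z => E1 (Re z) (Im z) +i* E2 (Re z) (Im z)) => z zr.
have zr2 : Re z ^+ 2 + Im z ^+ 2 < rho ^+ 2.
  by rewrite -cabs_sqr ltr_pXn2r ?nnegrE ?cabs_ge0// ltW.
apply/cderP => e e0; have e4 : 0 < e / 4 by rewrite divr_gt0.
have [d1 d10 H1] := HE1 _ _ zr2 _ e4; have [d2 d20 H2] := HE2 _ _ zr2 _ e4.
exists (Order.min d1 d2); first by rewrite lt_min d10.
move=> w; rewrite lt_min => /andP[w1 w2].
have rw : `|Re w - Re z| <= cabs (w - z) by rewrite -cReB Re_le_cabs.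
have iw : `|Im w - Im z| <= cabs (w - z) by rewrite -cImB Im_le_cabs.
have A := H1 _ _ (le_lt_trans rw w1) (le_lt_trans iw w1).
have B := H2 _ _ (le_lt_trans rw w2) (le_lt_trans iw w2).
have K : e / 4 * (`|Re w - Re z| + `|Im w - Im z|) <= e / 2 * cabs (w - z).
  have -> : e / 2 * cabs (w - z) = e / 4 * (cabs (w - z) + cabs (w - z)) by field.
  by rewrite ler_pM2l// lerD.
rewrite (le_trans (cabs_le_ReIm _))// (splitr e) [X in _ <= X]mulrDl lerD//; apply: le_trans K.
  apply: le_trans A; rewrite !cReB cReM cReB cImB /U /NV /V /=.
  by rewrite le_eqVlt; apply/orP; left; apply/eqP; case: (z) => a b /=; congr `|_|; ring.
apply: le_trans B; rewrite !cImB cImM cReB cImB /U /V /=.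
by rewrite le_eqVlt; apply/orP; left; apply/eqP; case: (z) => a b /=; congr `|_|; ring.
Qed.

(** On a smaller disc [f] agrees with its composition with a radial retraction
    onto that disc, which is continuous on the whole plane. *)
Lemma primitive f rho r z0 : r < rho -> (forall z, cabs z < rho -> ccont f z) ->
  (forall z, cabs z < rho -> z != z0 -> exists l, cder f z l) ->
  exists H, forall z, cabs z < r -> cder H z (f z).
Proof.
move=> rr fc fd; have [r0|r0] := leP r 0.
  by exists id => z zr; have := cabs_ge0 z; lra.
pose m z := Order.max r (cabs z); pose k z := z * (r%:C / (m z)%:C).
have m0 z : 0 < m z by rewrite lt_max r0.
have kz z : cabs z <= r -> k z = z.
  by move=> zr; rewrite /k /m max_l// divff ?mulr1// -cabs_gt0 cabs_real normr_gt0 gt_eqF.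
have kr z : cabs (k z) <= r.
  rewrite /k cabsM cabsf !cabs_real (gtr0_norm r0) (gtr0_norm (m0 z)).
  by rewrite mulrCA ler_piMr ?(ltW r0)// ler_pdivrMr// mul1r /m le_max lexx orbT.
have kc z : ccont k z.
  apply: ccontM; first exact: ccont_id.
  apply: ccontM; first exact: ccont_cst.
  apply: (@ccont_comp _ (fun v => v^-1) (fun z => (m z)%:C)); last first.
    by apply: ccontV; rewrite -cabs_gt0 cabs_real normr_gt0 gt_eqF.
  move=> e e0; exists e => // w we; rewrite -(rmorphB (real_complex R)) cabs_real.
  apply: le_lt_trans we; rewrite /m.
  have := cabs_lerB w z; have := cabs_lerB z w; rewrite [cabs (z - w)]cabsBC.
  by have := cabs_ge0 (w - z); case: (leP r (cabs w)); case: (leP r (cabs z)) => *;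
    rewrite ler_norml; apply/andP; split; lra.
have [||H HH] := @primitive_global (fun z => f (k z)) r z0.
- move=> z; apply: ccont_comp; first exact: kc.
  exact: fc (le_lt_trans (kr z) rr).
- move=> z zr zz0; have [l fl] := fd z (lt_trans zr rr) zz0; exists l.
  apply: cder_near fl; exists (r - cabs z); first by rewrite subr_gt0.
  move=> w wz; rewrite kz//.
  by have := cabsD (w - z) z; rewrite subrK; lra.
by exists H => z zr; rewrite -{2}[z]kz ?ltW//; exact: HH.
Qed.

End primitive.

(** * Means over circles and Cauchy's formula *)

Section circle_mean.
Context {R : realType}.
Implicit Types (f g h : R[i] -> R[i]) (z w : R[i]) (r : R).

Definition cpt r (t : R) : R[i] := r%:C * expC ('i * t%:C).

Lemma cabs_cpt r t : 0 <= r -> cabs (cpt r t) = r.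
Proof.
move=> r0; rewrite /cpt cabsM cabs_real cabs_expC ger0_norm//.
by rewrite (_ : Re _ = 0) ?expR0 ?mulr1//=; simpc.
Qed.

Let period : R := 2 * pi.

Let period_gt0 : 0 < period. Proof. by rewrite mulr_gt0// pi_gt0. Qed.

(** The integral over a period, as the increment of an antiderivative. *)
Definition rint (u : R -> R) : R := prim u (2 * pi) - prim u 0.

Let rintE (u U : R -> R) : (forall x : R, is_derive x 1 U (u x)) -> rint u = U (2 * pi) - U 0.
Proof.
move=> dU; have pu : forall x : R, is_derive x 1 (prim u) (u x).
  exact: (@xgetPex (R -> R) (fun=> 0) [set U | forall x : R, is_derive x 1 U (u x)] (ex_intro _ U dU)).
have : (fun x => prim u x - U x) 0 = (fun x => prim u x - U x) (2 * pi).
  apply: (@is_derive_eq_cst _ (fun x => prim u x - U x)) => x _.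
  by have := is_deriveB (pu x) (dU x); rewrite subrr.
by move=> /= E; rewrite /rint; lra.
Qed.

Let rintD (u v : R -> R) : continuous u -> continuous v ->
  rint (fun t => u t + v t) = rint u + rint v.
Proof.
move=> cu cv.
have -> := rintE (U := fun t => prim u t + prim v t)
  (fun x => is_deriveD (primP cu x) (primP cv x)).
by rewrite /rint; ring.
Qed.

Let rintZ (c : R) (u : R -> R) : continuous u -> rint (fun t => c * u t) = c * rint u.
Proof.
move=> cu; have dZ (x : R) : is_derive x 1 (fun t => c * prim u t) (c * u x).
  by have ? := primP cu x; apply: is_derive_eq.
by have -> := rintE dZ; rewrite /rint; ring.
Qed.

Let rint_abs (u v : R -> R) : continuous u -> continuous v -> (forall t, 0 <= t <= 2 * pi -> `|u t| <= v t) ->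
  `|rint u| <= rint v.
Proof.
move=> cu cv uv.
have [|c cI E] := @mvt _ (fun t => v t - u t) (fun t => prim v t - prim u t) 0 (2 * pi).
  by move=> x _; exact: is_deriveB (primP cv x) (primP cu x).
have [|d dI F] := @mvt _ (fun t => v t + u t) (fun t => prim v t + prim u t) 0 (2 * pi).
  by move=> x _; exact: is_deriveD (primP cv x) (primP cu x).
rewrite min_l ?max_r in cI dI; try exact: ltW.
have := uv _ cI; have := uv _ dI; rewrite !ler_norml => /andP[a1 a2] /andP[b1 b2].
have : 0 <= (v c - u c) * (2 * pi - 0) by rewrite mulr_ge0 ?subr0 ?(ltW period_gt0)//; lra.
have : 0 <= (v d + u d) * (2 * pi - 0) by rewrite mulr_ge0 ?subr0 ?(ltW period_gt0)//; lra.
by rewrite -E -F /rint => ? ?; apply/andP; split; lra.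
Qed.

(** The mean of [g] over the circle of radius [r] around the origin. *)
Definition cmean r g : R[i] :=
  (rint (fun t => Re (g (cpt r t))) / (2 * pi)) +i*
  (rint (fun t => Im (g (cpt r t))) / (2 * pi)).

Definition ccirc r g := forall t, ccont g (cpt r t).

Lemma ccont_cpt r w : ccont (fun w => r%:C * expC ('i * w)) w.
Proof.
apply: ccontM; first exact: ccont_cst.
apply: (@ccont_comp _ expC); last exact: cder_cont (cder_expC _).
by apply: ccontM; [exact: ccont_cst|exact: ccont_id].
Qed.

Lemma ccirc_cont r g : ccirc r g -> [/\ continuous (fun t => Re (g (cpt r t))),
  continuous (fun t => Im (g (cpt r t))) & continuous (fun t => cabs (g (cpt r t)))].
Proof.
move=> gc.
have H t e : 0 < e -> exists2 d : R, 0 < d & forall s, `|s - t| < d ->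
    cabs (g (cpt r s) - g (cpt r t)) < e.
  have := ccont_comp (ccont_cpt r t%:C) (gc t) => /[apply] -[d d0 Hd].
  exists d => // s st; apply: Hd.
  by rewrite -(rmorphB (real_complex R)) cabs_real.
split=> t; apply/cvgrPdist_lt => e /(H t)[d d0 Hd]; apply/nbhs_ballP; exists d => // s;
    rewrite /ball /= distrC => /Hd; apply: le_lt_trans.
- by rewrite distrC -cReB Re_le_cabs.
- by rewrite distrC -cImB Im_le_cabs.
- rewrite distrC ler_norml cabs_lerB andbT.
  by have := cabs_lerB (g (cpt r t)) (g (cpt r s)); rewrite cabsBC; lra.
Qed.

Lemma ccirc_bounded r g : ccirc r g ->
  exists M, forall t, 0 <= t <= 2 * pi -> cabs (g (cpt r t)) <= M.
Proof.
move=> /ccirc_cont[_ _ gc].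
have [|c _ Hc] := @EVT_max R (fun t => cabs (g (cpt r t))) 0 (2 * pi) (ltW period_gt0).
  exact: continuous_subspaceT.
by exists (cabs (g (cpt r c))) => t tI; apply: Hc; rewrite in_itv.
Qed.

Lemma eq_cmean r g h : 0 <= r -> (forall w, cabs w = r -> g w = h w) -> cmean r g = cmean r h.
Proof.
move=> r0 gh; have E t : g (cpt r t) = h (cpt r t) by rewrite gh// cabs_cpt.
by rewrite /cmean; congr ((rint _ / _) +i* (rint _ / _)); apply/funext => t; rewrite E.
Qed.

Lemma cmeanD r g h : ccirc r g -> ccirc r h ->
  cmean r (fun w => g w + h w) = cmean r g + cmean r h.
Proof.
move=> /ccirc_cont[g1 g2 _] /ccirc_cont[h1 h2 _].
rewrite /cmean; under eq_fun do rewrite cReD; under [X in _ +i* (rint X / _)]eq_fun do rewrite cImD.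
by rewrite !rintD// !mulrDl.
Qed.

Lemma cmeanZ r c g : ccirc r g -> cmean r (fun w => c * g w) = c * cmean r g.
Proof.
move=> /ccirc_cont[g1 g2 _]; case: c => a b.
have z1 k : continuous (fun t => k * Re (g (cpt r t))).
  by move=> t; apply: (@cvgM R) ; [exact: cvg_cst|exact: g1].
have z2 k : continuous (fun t => k * Im (g (cpt r t))).
  by move=> t; apply: (@cvgM R) ; [exact: cvg_cst|exact: g2].
have E1 : (fun t => Re ((a +i* b) * g (cpt r t))) =
  (fun t => a * Re (g (cpt r t)) + (- b) * Im (g (cpt r t))).
  by apply/funext => t; rewrite cReM /= mulNr.
have E2 : (fun t => Im ((a +i* b) * g (cpt r t))) =
  (fun t => a * Im (g (cpt r t)) + b * Re (g (cpt r t))).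
  by apply/funext => t; rewrite cImM.
rewrite /cmean E1 E2 !rintD// !rintZ//; apply: eq_ReIm; rewrite ?cReM ?cImM /=; ring.
Qed.

Lemma cmean_cst r c : cmean r (fun=> c) = c.
Proof.
have E (k : R) : rint (fun=> k) / (2 * pi) = k.
  have dk (x : R) : is_derive x 1 (fun t => k * t) k.
    by apply: is_derive_eq; rewrite /GRing.scale /= mulr1.
  by have -> := rintE dk; rewrite mulr0 subr0 mulfK// gt_eqF.
by rewrite /cmean !E; case: c.
Qed.

Lemma cmean_sum r N (F : nat -> R[i] -> R[i]) : (forall k, ccirc r (F k)) ->
  cmean r (fun w => \sum_(k < N) F k w) = \sum_(k < N) cmean r (F k).
Proof.
move=> Fc; elim: N => [|N IH].
  by under eq_fun do rewrite big_ord0; rewrite big_ord0 cmean_cst.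
under eq_fun do rewrite big_ord_recr; rewrite /= big_ord_recr cmeanD ?IH//.
move=> t; elim: N {IH} => [|N IH].
  under eq_fun do rewrite big_ord0; exact: ccont_cst.
by under eq_fun do rewrite big_ord_recr; apply: ccontD => //; exact: Fc.
Qed.

Lemma cmean_conj r g : ccirc r g -> cmean r (fun w => (g w)^*) = (cmean r g)^*.
Proof.
move=> /ccirc_cont[g1 g2 _].
have E : (fun t => Im (g (cpt r t))^*) = (fun t => -1 * Im (g (cpt r t))).
  by apply/funext => t; case: (g _) => a b /=; rewrite mulN1r.
rewrite /cmean E rintZ//=; congr (_ +i* _); last by ring.
by congr (rint _ / _); apply/funext => t; case: (g _).
Qed.

(** The factor 2 comes from bounding real and imaginary parts separately. *)
Lemma cmean_weight r g (u : R[i] -> R) (B : R) : 0 <= B -> ccirc r g -> ccirc r (fun w => (u w)%:C) ->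
  (forall t, 0 <= t <= 2 * pi -> cabs (g (cpt r t)) <= B * u (cpt r t)) ->
  cabs (cmean r g) <= 2 * B * Re (cmean r (fun w => (u w)%:C)).
Proof.
move=> B0 /ccirc_cont[g1 g2 _] /ccirc_cont[u1 _ _] gB.
have {}u1 : continuous (fun t => u (cpt r t)) by [].
have Bu : continuous (fun t => B * u (cpt r t)).
  by move=> t; apply: (@cvgM R) ; [exact: cvg_cst|exact: u1].
rewrite (le_trans (cabs_le_ReIm _))//.
rewrite [Re (_ _)]/= [Im (_ _)]/= [Re (_ _)]/= !normrM !(ger0_norm (_ : 0 <= (2 * pi)^-1)) ?invr_ge0 ?(ltW period_gt0)//.
have -> : 2 * B * (rint (fun t => u (cpt r t)) / (2 * pi)) =
    rint (fun t => B * u (cpt r t)) / (2 * pi) + rint (fun t => B * u (cpt r t)) / (2 * pi).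
  by rewrite rintZ//; ring.
rewrite lerD// ler_wpM2r ?invr_ge0 ?(ltW period_gt0)//; apply: rint_abs => // t tI;
  apply: le_trans (gB t tI).
  exact: Re_le_cabs.
exact: Im_le_cabs.
Qed.

Lemma cmean_bound r g (M : R) : 0 <= M -> ccirc r g ->
  (forall t, 0 <= t <= 2 * pi -> cabs (g (cpt r t)) <= M) -> cabs (cmean r g) <= 2 * M.
Proof.
move=> M0 gc gM; apply: le_trans (@cmean_weight r g (fun=> 1) M M0 gc _ _) _.
- by move=> t; exact: ccont_cst.
- by move=> t tI; rewrite mulr1 gM.
- by rewrite cmean_cst mulr1.
Qed.

(** The mean of [g(w) w] is the integral of [g dw], which a primitive turns into
    the difference of its values at the two equal end points. *)
Lemma cmean_primitive r g H : 0 <= r -> ccirc r g ->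
  (forall w, cabs w = r -> cder H w (g w)) -> cmean r (fun w => g w * w) = 0.
Proof.
move=> r0 gc dH; apply: (@mulfI _ 'i); first by rewrite -cabs_gt0 cabsi.
rewrite mulr0.
have gwc : ccirc r (fun w => g w * w).
  by move=> t; apply: ccontM => //; exact: ccont_id.
rewrite -cmeanZ//.
pose K w := H (r%:C * expC ('i * w)).
have dK t : cder K t%:C ('i * (g (cpt r t) * cpt r t)).
  have : cder (fun w => r%:C * expC ('i * w)) t%:C (r%:C * (expC ('i * t%:C) * ('i * 1))).
    by apply: cderZ; apply: cder_expC_comp; apply: cderZ; exact: cder_id.
  move=> /cder_comp/(_ (dH _ (cabs_cpt t r0))); congr (cder _ _ _).
  by rewrite /cpt; ring.
have per : cpt r (2 * pi) = cpt r 0.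
  rewrite /cpt; congr (_ * _); rewrite /expC /=; simpc.
  by rewrite [2 * pi]mulr_natl cos2pi sin2pi cos0 sin0.
have kper : K (2 * pi)%:C = K 0%:C by rewrite /K -/(cpt r (2 * pi)) -/(cpt r 0) per.
rewrite /cmean; have -> := rintE (fun x => (cder_real (dK x)).1).
by have -> := rintE (fun x => (cder_real (dK x)).2); rewrite kper !subrr !mul0r.
Qed.

End circle_mean.

Section cauchy.
Context {R : realType}.
Implicit Types (f g h : R[i] -> R[i]) (z w : R[i]) (r rho : R).

(** Holomorphy on the open disc of radius [rho] around the origin. *)
Definition hold rho f := forall z, cabs z < rho -> exists l, cder f z l.

Lemma hold_cont rho f z : hold rho f -> cabs z < rho -> ccont f z.
Proof. by move=> H /H[l /cder_cont]. Qed.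

Lemma hold_ccirc rho f r : hold rho f -> 0 <= r -> r < rho -> ccirc r f.
Proof. by move=> H r0 rr t; apply: hold_cont H _; rewrite cabs_cpt. Qed.

Lemma small_exp (q e : R) : 0 <= q < 1 -> 0 < e -> exists N, forall n, (N <= n)%N -> q ^+ n < e.
Proof.
move=> /andP[q0 q1] e0.
have nq : `|q| < 1 by rewrite ger0_norm.
have /cvgrPdist_lt/(_ e e0)[N _ HN] := cvg_expr nq.
by exists N => n /HN /=; rewrite sub0r normrN ger0_norm// exprn_ge0.
Qed.

Lemma cpt_neq0 r t : 0 < r -> cpt r t != 0.
Proof. by move=> r0; rewrite -cabs_gt0 cabs_cpt// ltW. Qed.

Lemma ccont_inv f z : ccont f z -> f z != 0 -> ccont (fun w => (f w)^-1) z.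
Proof. by move=> fc f0; apply: (@ccont_comp _ (fun v => v^-1)) => //; exact: ccontV. Qed.

Lemma ccontX n z : ccont (fun w => w ^+ n) z.
Proof. exact: cder_cont (cderX z n). Qed.

Lemma ccirc_expN r n : 0 < r -> ccirc r (fun w => w ^- n).
Proof.
by move=> r0 t; apply: ccont_inv; [exact: ccontX|rewrite expf_neq0 ?cpt_neq0].
Qed.

Lemma cmean_expN r n : 0 < r -> cmean r (fun w => w ^- n.+1) = 0.
Proof.
move=> r0; have w0 w : cabs w = r -> w != 0 by move=> wr; rewrite -cabs_gt0 wr.
rewrite (@eq_cmean _ r _ (fun w => w ^- n.+2 * w)) ?ltW//; last first.
  by move=> w /w0 wn; rewrite [w ^+ n.+2]exprS invfM mulrAC mulVf// mul1r.
apply: (@cmean_primitive _ _ _ (fun w => - (n.+1%:R)^-1 * w ^- n.+1)) => //; first exact: ltW.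
  exact: ccirc_expN.
move=> w /w0 wn; have := cder_inv (cderX w n.+1) (expf_neq0 _ wn).
move=> /(cderZ (- (n.+1%:R)^-1)); congr (cder _ _ _) => /=.
have n0 : (n.+1%:R : R[i]) != 0 by rewrite pnatr_eq0.
have v0 : w ^+ n != 0 by rewrite expf_neq0.
by rewrite !exprS; field; rewrite wn v0 ?nat1r ?natr1 pnatr_eq0.
Qed.

Lemma kernel_split z w N : w != 0 -> w != z ->
  w / (w - z) = \sum_(k < N) z ^+ k * w ^- k + z ^+ N * (w ^- N * (w / (w - z))).
Proof.
move=> w0 wz; have wz0 : w - z != 0 by rewrite subr_eq0.
elim: N => [|N IH]; first by rewrite big_ord0 add0r !expr0 invr1 !mul1r.
rewrite big_ord_recr /= {1}IH -addrA; congr (_ + _).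
have v0 : w ^+ N != 0 by rewrite expf_neq0.
by rewrite !exprS; field; rewrite w0 wz0 v0.
Qed.

Lemma circ_neq z w r : cabs w = r -> cabs z < r -> w != z.
Proof. by move=> wr zr; apply: contraTneq zr => <-; rewrite wr ltxx. Qed.

Lemma ccirc_kernel r z : cabs z < r -> ccirc r (fun w => w / (w - z)).
Proof.
move=> zr t; have r0 : 0 <= r := le_trans (cabs_ge0 z) (ltW zr).
apply: ccontM; first exact: ccont_id.
apply: ccont_inv; first by apply: ccontB; [exact: ccont_id|exact: ccont_cst].
by rewrite subr_eq0 (@circ_neq _ _ r)// cabs_cpt.
Qed.

Lemma cabs_kernel r z w N : cabs w = r -> cabs z < r ->
  cabs (w ^- N * (w / (w - z))) <= r ^- N * (r / (r - cabs z)).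
Proof.
move=> wr zr; have r0 : 0 < r := le_lt_trans (cabs_ge0 z) zr.
rewrite cabsM cabsV cabsX cabsf wr ler_wpM2l ?invr_ge0 ?exprn_ge0 ?(ltW r0)//.
rewrite ler_wpM2l ?(ltW r0)// lef_pV2 ?posrE ?subr_gt0//.
  by rewrite -wr cabs_lerB.
by rewrite (lt_le_trans _ (cabs_lerB _ _))// subr_gt0 wr.
Qed.

Lemma ccirc_taylor r f z N : ccirc r f -> cabs z < r ->
  ccirc r (fun w => f w * (w ^- N * (w / (w - z)))).
Proof.
move=> fc zr t; apply: ccontM; first exact: fc.
by apply: ccontM; [apply: ccirc_expN; exact: le_lt_trans (cabs_ge0 z) zr|exact: ccirc_kernel].
Qed.

Lemma ccirc_sum r N (F : nat -> R[i] -> R[i]) : (forall k, ccirc r (F k)) ->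
  ccirc r (fun w => \sum_(k < N) F k w).
Proof.
move=> Fc t; elim: N => [|N IH].
  under eq_fun do rewrite big_ord0; exact: ccont_cst.
by under eq_fun do rewrite big_ord_recr; apply: ccontD => //; exact: Fc.
Qed.

(** Integrate the expansion of the kernel in powers of z / w. *)
Let cmean_split r f z N : ccirc r f -> cabs z < r ->
  cmean r (fun w => f w * (w / (w - z))) =
  \sum_(k < N) cmean r (fun w => f w * w ^- k) * z ^+ k +
  z ^+ N * cmean r (fun w => f w * (w ^- N * (w / (w - z)))).
Proof.
move=> fc zr; have r0 : 0 < r := le_lt_trans (cabs_ge0 z) zr.
have cF k : ccirc r (fun w => f w * w ^- k).
  by move=> t; apply: ccontM; [exact: fc|exact: ccirc_expN].
have cT := ccirc_taylor N fc zr.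
rewrite -cmeanZ//.
under eq_bigr do rewrite mulrC -cmeanZ//.
rewrite -(@cmean_sum _ r N (fun k w => z ^+ k * (f w * w ^- k))); last first.
  by move=> k t; apply: ccontM; [exact: ccont_cst|exact: cF].
rewrite -cmeanD; last 2 first.
- apply: (@ccirc_sum r N (fun k w => z ^+ k * (f w * w ^- k))) => k t.
  by apply: ccontM; [exact: ccont_cst|exact: cF].
- by move=> t; apply: ccontM; [exact: ccont_cst|exact: cT].
apply: eq_cmean; first exact: ltW.
move=> w wr; rewrite {1}(@kernel_split z w N) -?cabs_gt0 ?wr//; last exact: circ_neq zr.
rewrite mulrDr mulr_sumr; congr (_ + _); last by rewrite mulrCA.
by apply: eq_bigr => k _; rewrite mulrCA.
Qed.

(** In the expansion of the kernel only the constant term has a nonzero mean,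
    and the remainder tends to 0. *)
Lemma cmean_kernel r z : cabs z < r -> cmean r (fun w => w / (w - z)) = 1.
Proof.
move=> zr; have r0 : 0 < r := le_lt_trans (cabs_ge0 z) zr.
apply/eqP; rewrite -subr_eq0 -cabs_eq0; apply/eqP/le_anti; rewrite cabs_ge0 andbT.
apply/ler_addgt0Pl => e e0; rewrite addr0.
pose B := r / (r - cabs z); have B0 : 0 < B by rewrite divr_gt0// subr_gt0.
have [||N HN] := @small_exp (cabs z / r) (e / (2 * B)).
- by rewrite divr_ge0 ?cabs_ge0 ?(ltW r0)//= ltr_pdivrMr// mul1r.
- by rewrite divr_gt0// mulr_gt0.
have := HN N.+1 (leqnSn N) => {}HN.
have c1 : ccirc r (fun=> 1 : R[i]) by move=> t; exact: ccont_cst.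
have := @cmean_split r (fun=> 1) z N.+1 c1 zr.
under eq_fun do rewrite mul1r; move=> ->.
rewrite big_ord_recl /= expr0 mulr1 big1 ?addr0; last first.
  move=> k _; rewrite (@eq_cmean _ r _ (fun w => w ^- k.+1)) ?(ltW r0)//.
    by rewrite cmean_expN// mul0r.
  by move=> w _; rewrite mul1r.
under eq_fun do rewrite expr0 invr1 mulr1.
rewrite cmean_cst addrC addKr cabsM.
have := @cmean_bound _ r _ (r ^- N.+1 * B) _ (ccirc_taylor N.+1 c1 zr).
have rB : 0 <= r ^- N.+1 * B by rewrite mulr_ge0 ?invr_ge0 ?exprn_ge0 ?(ltW r0) ?(ltW B0).
move=> /(_ rB) bnd; apply: (@le_trans _ _ (cabs z ^+ N.+1 * (2 * (r ^- N.+1 * B)))).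
  rewrite cabsX ler_wpM2l ?exprn_ge0 ?cabs_ge0//; apply: bnd => t _.
  by rewrite mul1r cabs_kernel// cabs_cpt// ltW.
have -> : cabs z ^+ N.+1 * (2 * (r ^- N.+1 * B)) = (cabs z / r) ^+ N.+1 * (2 * B).
  by rewrite expr_div_n; ring.
have B2 : 0 < 2 * B by exact: mulr_gt0.
by move: HN; rewrite ltr_pdivlMr// => /ltW.
Qed.

(** Cauchy's formula: the difference quotient of [f] at [z] is holomorphic except
    at [z], where it is continuous, so it has a primitive. *)
Lemma cauchy_formula rho f r z : hold rho f -> cabs z < r -> r < rho ->
  f z = cmean r (fun w => f w * (w / (w - z))).
Proof.
move=> fh zr rr; have r0 : 0 < r := le_lt_trans (cabs_ge0 z) zr.
have fc : ccirc r f := hold_ccirc fh (ltW r0) rr.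
have [l [phi [phic phiz fE]]] := fh _ (lt_trans zr rr).
have phiE w : w != z -> phi w = (f w - f z) / (w - z).
  by move=> wz; rewrite fE addrC addKr mulrC mulKf// subr_eq0.
have dphi w : cabs w < rho -> w != z -> exists l, cder phi w l.
  move=> wr wz; have [m fm] := fh w wr.
  have wz0 : w - z != 0 by rewrite subr_eq0.
  have := cderM (cderB fm (cder_cst (f z) w)) (cder_inv (cderB (cder_id w) (cder_cst z w)) wz0).
  set L := (X in cder _ _ X) => HL; exists L; apply: cder_near HL.
  exists (cabs (w - z)); first by rewrite cabs_gt0.
  move=> v vw; rewrite phiE//; apply: contraTneq vw => ->.
  by rewrite cabsBC ltxx.
have cphi w : cabs w < rho -> ccont phi w.
  have [->|wz] := eqVneq w z; first by [].
  by move=> wr; have [m /cder_cont] := dphi w wr wz.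
pose r' := (r + rho) / 2; have rr' : r < r' by rewrite /r'; lra.
have r'r : r' < rho by rewrite /r'; lra.
have [H HH] := primitive r'r cphi dphi.
have phcirc : ccirc r phi by move=> t; apply: cphi; rewrite cabs_cpt ?(ltW r0).
have M0 : cmean r (fun w => phi w * w) = 0.
  by apply: (@cmean_primitive _ _ _ H) => // [|w wr]; [exact: ltW|apply: HH; rewrite wr].
have kc := ccirc_kernel zr.
have -> : cmean r (fun w => f w * (w / (w - z))) =
    cmean r (fun w => f z * (w / (w - z)) + phi w * w).
  apply: eq_cmean => [|w wr]; first exact: ltW.
  have wz : w - z != 0 by rewrite subr_eq0 (circ_neq wr).
  by rewrite {1}fE; field.
rewrite cmeanD ?cmeanZ// ?cmean_kernel// ?M0 ?addr0 ?mulr1//.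
  by move=> t; apply: ccontM; [exact: ccont_cst|exact: kc].
by move=> t; apply: ccontM; [exact: phcirc|exact: ccont_id].
Qed.

Lemma taylor rho f r z N : hold rho f -> cabs z < r -> r < rho ->
  f z = \sum_(k < N) cmean r (fun w => f w * w ^- k) * z ^+ k +
  z ^+ N * cmean r (fun w => f w * (w ^- N * (w / (w - z)))).
Proof.
move=> fh zr rr; rewrite {1}(cauchy_formula fh zr rr); apply: cmean_split => //.
exact: hold_ccirc fh (le_trans (cabs_ge0 z) (ltW zr)) rr.
Qed.

Lemma taylor_rem r f z N (M : R) : ccirc r f -> cabs z < r ->
  (forall t, 0 <= t <= 2 * pi -> cabs (f (cpt r t)) <= M) ->
  cabs (cmean r (fun w => f w * (w ^- N * (w / (w - z))))) <=
  2 * (M * (r ^- N * (r / (r - cabs z)))).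
Proof.
move=> fc zr fM; have r0 : 0 < r := le_lt_trans (cabs_ge0 z) zr.
have K0 : 0 <= r ^- N * (r / (r - cabs z)).
  by rewrite mulr_ge0 ?invr_ge0 ?exprn_ge0 ?divr_ge0 ?subr_ge0 ?(ltW r0) ?(ltW zr).
have M0 : 0 <= M.
  by rewrite (le_trans (cabs_ge0 _) (fM 0 _))// lexx mulr_ge0// pi_ge0.
apply: cmean_bound; [exact: mulr_ge0|exact: ccirc_taylor|].
by move=> t tI; rewrite cabsM ler_pM ?cabs_ge0 ?fM// cabs_kernel// cabs_cpt//; exact: ltW.
Qed.

(** Cauchy's formula with an estimate of the kernel; this loses a constant
    against the maximum principle, which is harmless in growth estimates. *)
Lemma max_principle rho f r z (M : R) : hold rho f -> cabs z < r -> r < rho ->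
  (forall w, cabs w = r -> cabs (f w) <= M) ->
  cabs (f z) <= 2 * M * (r / (r - cabs z)).
Proof.
move=> fh zr rr fM; have r0 : 0 < r := le_lt_trans (cabs_ge0 z) zr.
rewrite {1}(cauchy_formula fh zr rr).
have -> : cmean r (fun w => f w * (w / (w - z))) =
    cmean r (fun w => f w * (w ^- 0 * (w / (w - z)))).
  by apply: eq_cmean; [exact: ltW|move=> w _; rewrite expr0 invr1 mul1r].
have := @taylor_rem r f z 0 M (hold_ccirc fh (ltW r0) rr) zr.
move=> H.
have -> : 2 * M * (r / (r - cabs z)) = 2 * (M * (r ^- 0 * (r / (r - cabs z)))).
  by rewrite expr0 invr1 mul1r -mulrA.
by apply: H => t _; apply: fM; rewrite cabs_cpt// ltW.
Qed.

Lemma hold_bounded rho f r : hold rho f -> r < rho ->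
  exists2 M : R, 0 <= M & forall z, cabs z <= r -> cabs (f z) <= M.
Proof.
move=> fh rr; have [r0|r0] := ltP r 0.
  by exists 0 => // z zr; have := cabs_ge0 z; lra.
pose s := (r + rho) / 2; have rs : r < s by rewrite /s; lra.
have sr : s < rho by rewrite /s; lra.
have s0 : 0 < s by exact: le_lt_trans rs.
have fc := hold_ccirc fh (ltW s0) sr.
have [M fM] := ccirc_bounded fc.
have M0 : 0 <= M.
  by rewrite (le_trans (cabs_ge0 _) (fM 0 _))// lexx mulr_ge0// pi_ge0.
exists (2 * (M * (s ^- 0 * (s / (s - r))))).
  have sr0 : 0 <= (s - r)^-1 by rewrite invr_ge0 subr_ge0 ltW.
  rewrite expr0 invr1 mul1r; apply: mulr_ge0 => //; apply: mulr_ge0 => //.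
  by apply: mulr_ge0 => //; exact: ltW.
move=> z zr; have zs : cabs z < s by exact: le_lt_trans rs.
rewrite (taylor 0 fh zs sr) big_ord0 add0r expr0 mul1r.
apply: le_trans (@taylor_rem s f z 0 M fc zs fM) _.
rewrite ler_pM2l// ler_wpM2l// ler_wpM2l ?invr_ge0 ?exprn_ge0 ?(ltW s0)//.
rewrite ler_wpM2l ?(ltW s0)// lef_pV2 ?posrE ?subr_gt0//.
by rewrite lerD2l lerN2.
Qed.

End cauchy.

(** * Division, derivatives and logarithms of holomorphic functions *)

Section holomorphic.
Context {R : realType}.
Implicit Types (f g h : R[i] -> R[i]) (z w : R[i]) (r rho : R).

Lemma conj_mul w : w^* * w = (cabs w ^+ 2)%:C.
Proof. by rewrite cabs_sqr; case: w => a b; apply: eq_ReIm; simpc => /=; ring. Qed.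

Lemma cder_quad f z l (K d : R) : 0 < d ->
  (forall w, cabs (w - z) < d -> cabs (f w - f z - (w - z) * l) <= K * cabs (w - z) ^+ 2) ->
  cder f z l.
Proof.
move=> d0 H; apply/cderP => e e0; pose K1 := `|K| + 1.
have K10 : 0 < K1 by rewrite ltr_wpDl.
exists (Order.min d (e / K1)); first by rewrite lt_min d0 divr_gt0.
move=> w; rewrite lt_min => /andP[wd we]; apply: le_trans (H w wd) _.
rewrite expr2 mulrA ler_wpM2r ?cabs_ge0//.
move: we; rewrite ltr_pdivlMr// => /ltW; apply: le_trans.
rewrite mulrC ler_wpM2l ?cabs_ge0// (le_trans (ler_norm _))// lerDl//.
Qed.

Lemma cder_shift f a z l : cder f (a + z) l -> cder (fun w => f (a + w)) z l.
Proof.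
move=> H; rewrite -[l]mulr1; apply: (@cder_comp _ f (fun w => a + w)) => //.
by have := cderD (cder_cst a z) (cder_id z); rewrite add0r.
Qed.

Lemma cder_unshift f a z l : cder (fun w => f (a + w)) z l -> cder f (a + z) l.
Proof.
move=> H; have := @cder_shift (fun w => f (a + w)) (- a) (a + z) l.
rewrite addKr => /(_ H); by under eq_fun do rewrite addNKr.
Qed.

(** The Taylor expansion to order 3 shows that the difference quotient at 0 is
    differentiable at 0 as well. *)
Lemma hol_div0 rho f : 0 < rho -> hold rho f ->
  exists2 psi, hold rho psi & forall w, f w = f 0 + w * psi w.
Proof.
move=> rho0 fh; have [|l fl] := fh 0; first by rewrite cabs0.
have [phi [phic phi0 fE]] := fl; exists phi; last by move=> w; rewrite fE subr0.
pose r := rho / 2; have r0 : 0 < r by rewrite divr_gt0.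
have rr : r < rho by rewrite /r; lra.
have fc := hold_ccirc fh (ltW r0) rr.
have [M fM] := ccirc_bounded fc.
pose c k := cmean r (fun w => f w * w ^- k).
pose T z := cmean r (fun w => f w * (w ^- 3 * (w / (w - z)))).
have fT z : cabs z < r -> f z = c 0%N + c 1%N * z + c 2%N * z ^+ 2 + z ^+ 3 * T z.
  by move=> zr; rewrite {1}(taylor 3 fh zr rr) !big_ord_recr big_ord0 /= add0r expr0 mulr1 expr1.
have f0 : f 0 = c 0%N by rewrite fT ?cabs0// !expr0n /= !(mulr0, mul0r, addr0).
pose K := `|2 * (M * (r ^- 3 * 2))|.
have TK z : cabs z < r / 2 -> cabs (T z) <= K.
  move=> zr; have zr' : cabs z < r by rewrite (lt_trans zr)//; lra.
  apply: le_trans (@taylor_rem _ r f z 3 M fc zr' fM) _.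
  apply: le_trans (ler_norm _).
  have M0 : 0 <= M by rewrite (le_trans (cabs_ge0 _) (fM 0 _))// lexx mulr_ge0// pi_ge0.
  rewrite ler_pM2l// ler_wpM2l// ler_wpM2l ?invr_ge0 ?exprn_ge0 ?(ltW r0)//.
  by rewrite ler_pdivrMr ?subr_gt0//; lra.
have r2 : 0 < r / 2 by rewrite divr_gt0.
have lc : l = c 1%N.
  apply: cder_uniq fl _; apply: (@cder_quad _ _ _ (cabs (c 2%N) + r * K) (r / 2)) => // w.
  rewrite subr0 => wr; have wr' : cabs w < r by rewrite (lt_trans wr)//; lra.
  have -> : f w - f 0 - w * c 1%N = w ^+ 2 * (c 2%N + w * T w).
    by rewrite f0 fT//; ring.
  rewrite cabsM cabsX mulrC ler_wpM2r ?exprn_ge0 ?cabs_ge0//.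
  rewrite (le_trans (cabsD _ _))// lerD2l cabsM ler_pM ?cabs_ge0 ?TK//.
  by rewrite ltW.
have phiE w : w != 0 -> phi w = (f w - f 0) / w.
  by move=> w0; rewrite fE subr0 addrC addKr mulrC mulKf.
move=> z zr; have [->|z0] := eqVneq z 0.
  exists (c 2%N); apply: (@cder_quad _ _ _ K (r / 2)) => // w; rewrite subr0 phi0 => wr.
  have [->|w0] := eqVneq w 0.
    by rewrite phi0 subrr mul0r subr0 cabs0 mulr_ge0// ?normr_ge0// expr0n.
  have wr' : cabs w < r by rewrite (lt_trans wr)//; lra.
  have -> : phi w - l - w * c 2%N = w ^+ 2 * T w.
    by rewrite phiE// f0 fT// lc; field.
  by rewrite cabsM cabsX mulrC ler_wpM2r ?exprn_ge0 ?cabs_ge0// TK.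
have [m fm] := fh z zr.
have := cderM (cderB fm (cder_cst (f 0) z)) (cderV z0).
set L := (X in cder _ _ X) => HL; exists L; apply: cder_near HL.
exists (cabs z); first by rewrite cabs_gt0.
move=> v vz; rewrite phiE//; apply: contraTneq vz => ->.
by rewrite sub0r cabsN ltxx.
Qed.

Lemma hold0 rho f r : hold rho f -> 0 < r -> r < rho -> cmean r f = f 0.
Proof.
move=> fh r0 rr; rewrite (cauchy_formula fh (_ : cabs 0 < r)) ?cabs0//.
apply: eq_cmean; first exact: ltW.
by move=> w wr; rewrite subr0 divff ?mulr1// -cabs_gt0 wr.
Qed.

Lemma cauchy_ineq rho f r l (M : R) : hold rho f -> 0 < r -> r < rho ->
  (forall w, cabs w = r -> cabs (f w) <= M) -> cder f 0 l -> cabs l <= 6 * M / r.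
Proof.
move=> fh r0 rr fM fl; have rho0 := lt_trans r0 rr.
have [psi ph fE] := hol_div0 rho0 fh.
have zr : cabs (0 : R[i]) < r by rewrite cabs0.
have f0 : cabs (f 0) <= 2 * M.
  by have := max_principle fh zr rr fM; rewrite cabs0 subr0 divff ?mulr1// gt_eqF.
have lp : l = psi 0.
  apply: cder_uniq fl _; have [m pm] := ph 0 (lt_trans zr rr).
  have := cderD (cder_cst (f 0) 0) (cderM (cder_id 0) pm).
  rewrite mul0r addr0 mul1r add0r.
  by rewrite (_ : (fun w => f 0 + id w * psi w) = f)//; apply/funext => w; rewrite [RHS]fE.
have pM w : cabs w = r -> cabs (psi w) <= 3 * M / r.
  move=> wr; rewrite ler_pdivlMr// mulrC -wr -cabsM.
  have -> : w * psi w = f w - f 0 by rewrite fE addrC addKr.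
  by have := cabsB (f w) (f 0); have := fM w wr; lra.
have := max_principle ph zr rr pM; rewrite cabs0 subr0 divff ?gt_eqF// mulr1 -lp.
by move=> H; apply: le_trans H _; rewrite le_eqVlt; apply/orP; left; apply/eqP; ring.
Qed.

(** Three divisions by the variable expand [f] around [z0] to order 3. The
    derivative of the expansion differs from an affine function by [v ^ 2]
    times a function that Cauchy's inequality bounds. *)
Lemma hold_der rho f f' : hold rho f -> (forall z, cabs z < rho -> cder f z (f' z)) ->
  hold rho f'.
Proof.
move=> fh df z0 z0r; pose eta := rho - cabs z0; have eta0 : 0 < eta by rewrite subr_gt0.
have inr v : cabs v < eta -> cabs (z0 + v) < rho.
  by move=> ve; rewrite (le_lt_trans (cabsD _ _))// -ltrBrDl.
have Fh : hold eta (fun v => f (z0 + v)).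
  by move=> v /inr /df /cder_shift; exists (f' (z0 + v)).
have [p1 p1h FE] := hol_div0 eta0 Fh.
have [p2 p2h p1E] := hol_div0 eta0 p1h.
have [p3 p3h p2E] := hol_div0 eta0 p2h.
pose s := eta / 4; have s0 : 0 < s by rewrite divr_gt0.
have [|K2 K20 p2M] := @hold_bounded _ _ _ (2 * s) p2h; first by rewrite /s; lra.
have [|K3 K30 p3M] := @hold_bounded _ _ _ s p3h; first by rewrite /s; lra.
have f'E v m : cabs v < eta -> cder p2 v m ->
    f' (z0 + v) = p1 0 + 2 * v * p2 v + v ^+ 2 * m.
  move=> ve p2m; apply: cder_uniq (cder_shift (df _ (inr _ ve))) _.
  have := cderD (cder_cst (f z0) v)
   (cderM (cder_id v) (cderD (cder_cst (p1 0) v) (cderM (cder_id v) p2m))).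
  rewrite (_ : (fun w => f z0 + _) = (fun w => f (z0 + w))); last first.
    by apply/funext => w; rewrite [RHS]FE addr0 [p1 w]p1E.
  by congr (cder _ _ _); ring.
have f'0 : f' z0 = p1 0.
  have c0 : cabs (0 : R[i]) < eta by rewrite cabs0.
  have [m p2m] := p2h 0 c0.
  by have := f'E 0 m c0 p2m; rewrite addr0 mulr0 mul0r expr0n mul0r !addr0.
exists (2 * p2 0); rewrite -[z0]addr0; apply: cder_unshift.
apply: (@cder_quad _ _ _ (2 * K3 + 6 * K2 / s) s) => // v; rewrite subr0 addr0 => vs.
have ve : cabs v < eta by rewrite (lt_trans vs)// /s; lra.
have [m p2m] := p2h v ve.
have mM : cabs m <= 6 * K2 / s.
  have ph : hold (eta - s) (fun w => p2 (v + w)).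
    move=> w ws; have [|q pq] := p2h (v + w); last by exists q; exact: cder_shift.
    by have := cabsD v w; lra.
  apply: (@cauchy_ineq _ _ s _ K2 ph) => //; first by rewrite /s; lra.
    by move=> w ws; apply: p2M; have := cabsD v w; lra.
  by apply: cder_shift; rewrite addr0.
rewrite (f'E v m ve p2m) f'0.
have -> : p1 0 + 2 * v * p2 v + v ^+ 2 * m - p1 0 - v * (2 * p2 0) =
  v ^+ 2 * (2 * p3 v + m) by rewrite (p2E v); ring.
rewrite cabsM cabsX mulrC ler_wpM2r ?exprn_ge0 ?cabs_ge0//.
by rewrite (le_trans (cabsD _ _))// lerD// cabsM cabs_nat ler_pM2l// p3M//; exact: ltW.
Qed.

(** The mean value inequality along a ray from the origin; the factor 2 comes
    from the separate treatment of the real and imaginary parts. *)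
Lemma cmvt f f' z (M : R) :
  (forall t : R, 0 <= t <= 1 -> cder f (t%:C * z) (f' (t%:C * z)) /\ cabs (f' (t%:C * z)) <= M) ->
  cabs (f z - f 0) <= 2 * M * cabs z.
Proof.
move=> H; pose K w := f (w * z).
have dK (t : R) : 0 <= t <= 1 -> cder K t%:C (f' (t%:C * z) * z).
  move=> /H[A _]; have B : cder (fun w => w * z) t%:C z.
    by have := cderM (cder_id t%:C) (cder_cst z t%:C); rewrite mulr0 addr0 mul1r.
  exact: (@cder_comp _ f (fun w => w * z) _ _ _ B A).
have fzE : f z = K 1%:C by rewrite /K mul1r.
have f0E : f 0 = K 0%:C by rewrite /K mul0r.
have bM (t : R) : 0 <= t <= 1 -> cabs (f' (t%:C * z) * z) <= M * cabs z.
  by move=> /H[_ A]; rewrite cabsM ler_wpM2r ?cabs_ge0.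
rewrite (le_trans (cabs_le_ReIm _))// -mulrA mulr2n mulrDl mul1r lerD//.
  have := @mvt_le _ (fun t => Re (f' (t%:C * z) * z)) (fun t => Re (K t%:C)) 0 1 0 (M * cabs z).
  rewrite mul0r !subr0 normr1 mulr1 cReB fzE f0E; apply => t; rewrite min_l// max_r// => tI.
  by split; [exact: (cder_real (dK t tI)).1|rewrite subr0 (le_trans (Re_le_cabs _))// bM].
have := @mvt_le _ (fun t => Im (f' (t%:C * z) * z)) (fun t => Im (K t%:C)) 0 1 0 (M * cabs z).
rewrite mul0r !subr0 normr1 mulr1 cImB fzE f0E; apply => t; rewrite min_l// max_r// => tI.
by split; [exact: (cder_real (dK t tI)).2|rewrite subr0 (le_trans (Im_le_cabs _))// bM].
Qed.

(** [L] is a primitive of the logarithmic derivative, so that [f exp(- L)] has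
    derivative 0. *)
Lemma hold_log rho r f : r < rho -> hold rho f -> (forall z, cabs z < rho -> f z != 0) ->
  exists2 L, hold r L /\ L 0 = 0 & forall z, cabs z < r -> f z = f 0 * expC (L z).
Proof.
move=> rr fh fn0; pose f' z := xget 0 [set l | cder f z l].
have df z : cabs z < rho -> cder f z (f' z).
  by move=> /fh[l fl]; exact: (@xgetPex _ 0 [set l | cder f z l] (ex_intro _ l fl)).
have f'h := hold_der fh df.
have uh z : cabs z < rho -> exists l, cder (fun w => f' w / f w) z l.
  move=> zr; have [l f'l] := f'h z zr; have := cderM f'l (cder_inv (df z zr) (fn0 z zr)).
  by set m := (X in cder _ _ X); exists m.
have [||H HH] := @primitive _ (fun w => f' w / f w) rho r 0 rr.
- by move=> z /uh[l /cder_cont].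
- by move=> z /uh.
pose L z := H z - H 0.
have dL z : cabs z < r -> cder L z (f' z / f z).
  by move=> zr; have := cderB (HH z zr) (cder_cst (H 0) z); rewrite subr0.
exists L; first by split; [move=> z /dL; exists (f' z / f z)|rewrite /L subrr].
move=> z zr; pose G w := f w * expC (- L w).
have zr' (t : R) : 0 <= t <= 1 -> cabs (t%:C * z) < r.
  move=> /andP[t0 t1]; rewrite cabsM cabs_real ger0_norm// (le_lt_trans _ zr)//.
  by rewrite ler_piMl ?cabs_ge0.
have dG w : cabs w < r -> cder G w 0.
  move=> wr; have wrho := lt_trans wr rr.
  have := cderM (df w wrho) (cder_expC_comp (cderN (dL w wr))).
  by congr (cder _ _ _); field; exact: fn0.
have := @cmvt G (fun=> 0) z 0; rewrite mulr0 mul0r => GE.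
have {}GE : G z = G 0.
  apply/eqP; rewrite -subr_eq0 -cabs_eq0; apply/eqP/le_anti; rewrite cabs_ge0 andbT.
  by apply: GE => t /zr' tr; split; [exact: dG|rewrite cabs0].
have L0 : L 0 = 0 by rewrite /L subrr.
move: GE; rewrite /G L0 oppr0 expC0 mulr1 => <-.
by rewrite expCN mulfVK// expC_neq0.
Qed.

(** The Borel-Caratheodory inequality for the remainder of the Taylor expansion:
    on the circle, integration against the kernel of the remainder kills the
    conjugate of [L] and the constants, so [L] may be replaced by
    [2 (Re L - A)], which has a constant sign and mean [- 2 A]. *)
Lemma borel_caratheodory rho L r z N (A : R) : hold rho L -> cabs z < r -> r < rho ->
  L 0 = 0 -> (forall w, cabs w = r -> Re (L w) <= A) ->
  cabs (L z - \sum_(k < N.+1) cmean r (fun w => L w * w ^- k) * z ^+ k) <=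
  4 * A * (r / (r - cabs z)) * (cabs z / r) ^+ N.+1.
Proof.
move=> Lh zr rr L0 LA; have r0 : 0 < r := le_lt_trans (cabs_ge0 z) zr.
have Lc := hold_ccirc Lh (ltW r0) rr.
pose k w := w ^- N.+1 * (w / (w - z)).
have kc : ccirc r k.
  by move=> t; apply: ccontM; [exact: ccirc_expN|exact: ccirc_kernel].
rewrite {1}(taylor N.+1 Lh zr rr) addrC addKr.
have Lcc : ccirc r (fun w => (L w)^*).
  by move=> t; apply: ccont_comp (Lc t) _; exact: ccont_conj.
have c1 : ccirc r (fun=> 1 : R[i]) by move=> t; exact: ccont_cst.
have T1 : z ^+ N.+1 * cmean r k = 0.
  have h1 : hold rho (fun=> 1 : R[i]) by move=> w _; exists 0; exact: cder_cst.
  have := taylor N.+1 h1 zr rr; rewrite big_ord_recl /= expr0 mulr1 big1; last first.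
    move=> j _; rewrite (@eq_cmean _ r _ (fun w => w ^- j.+1)) ?(ltW r0)//.
      by rewrite cmean_expN// mul0r.
    by move=> w _; rewrite mul1r.
  under eq_fun do rewrite expr0 invr1 mulr1.
  rewrite cmean_cst addr0 => /esym/eqP; rewrite -subr_eq0 addrC addKr => /eqP <-.
  by congr (_ * _); apply: eq_cmean; [exact: ltW|move=> w _; rewrite mul1r].
have Tc : cmean r (fun w => (L w)^* * k w) = 0.
  (* On the circle [w^* = r ^ 2 / w], so the conjugate of [k w] extends
     holomorphically to a neighbourhood of the closed disc; [F], the product of
     this extension with [L], vanishes at 0 and so has mean 0. *)
  pose F w := L w * (w ^+ N.+1 * (r%:C ^- (2 * N.+1) * (r%:C ^+ 2 * (r%:C ^+ 2 - z^* * w)^-1))).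
  have r20 w : cabs w < r ^+ 2 / (cabs z + (r - cabs z) / 2) -> r%:C ^+ 2 - z^* * w != 0.
    have z1 : 0 < cabs z + (r - cabs z) / 2 by have := cabs_ge0 z; lra.
    rewrite ltr_pdivlMr// => wr; rewrite -cabs_gt0 (lt_le_trans _ (cabs_lerB _ _))//.
    rewrite subr_gt0 cabsX cabs_real gtr0_norm// cabsM cabs_conj mulrC (le_lt_trans _ wr)//.
    by rewrite ler_wpM2l ?cabs_ge0//; lra.
  pose rho' := Order.min rho (r ^+ 2 / (cabs z + (r - cabs z) / 2)).
  have rr' : r < rho'.
    have z1 : 0 < cabs z + (r - cabs z) / 2 by have := cabs_ge0 z; lra.
    by rewrite lt_min rr/= ltr_pdivlMr// expr2 ltr_pM2l//; lra.
  have Fh : hold rho' F.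
    move=> w; rewrite lt_min => /andP[wr /r20 wn]; have [m Lm] := Lh w wr.
    have := cderM Lm (cderM (cderX w N.+1) (cderM (cder_cst (r%:C ^- (2 * N.+1)) w)
      (cderM (cder_cst (r%:C ^+ 2) w)
       (cder_inv (cderB (cder_cst (r%:C ^+ 2) w) (cderZ z^* (cder_id w))) wn)))).
    by set q := (X in cder _ _ X); exists q.
  have : cmean r F = 0 by rewrite (hold0 Fh)// /F L0 mul0r.
  move=> F0; have Fc := hold_ccirc Fh (ltW r0) rr'.
  rewrite -(@conjc0 R) -F0 -cmean_conj//; apply: eq_cmean => [|w wr]; first exact: ltW.
  have w0 : w != 0 by rewrite -cabs_gt0 wr.
  have ww : w^* = r%:C ^+ 2 / w.
    by apply: (mulIf w0); rewrite divfK// conj_mul wr rmorphXn.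
  rewrite -[k w](@conjcK R) -rmorphM /=; congr (_^*).
  rewrite /F /k; congr (_ * _).
  have rn0 : (r%:C : R[i]) != 0 by rewrite -cabs_gt0 cabs_real normr_gt0 gt_eqF.
  have kn : r%:C ^+ 2 - z^* * w != 0.
    apply: r20; rewrite wr; have z1 : 0 < cabs z + (r - cabs z) / 2 by have := cabs_ge0 z; lra.
    by rewrite ltr_pdivlMr// expr2 ltr_pM2l//; lra.
  rewrite rmorphM /= fmorphV rmorphXn /= rmorphM /= fmorphV rmorphB /= ww.
  rewrite expr_div_n invf_div exprM.
  have rN0 : (r%:C ^+ 2) ^+ N.+1 != 0 by rewrite !expf_neq0.
  have wN0 : w ^+ N.+1 != 0 by rewrite expf_neq0.
  have -> : r%:C ^+ 2 / w - z^* = (r%:C ^+ 2 - z^* * w) / w by field.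
  by rewrite -mulrA; congr (_ * (_ * _)); field; rewrite kn w0.
pose u w := 2 * (A - Re (L w)).
have uc : ccirc r (fun w => (u w)%:C).
  move=> t e e0; have e2 : 0 < e / 2 by rewrite divr_gt0.
  have [d d0 Hd] := Lc t _ e2.
  exists d => // w /Hd; rewrite -(rmorphB (real_complex R)) cabs_real.
  have -> : u w - u (cpt r t) = - 2 * Re (L w - L (cpt r t)) by rewrite /u cReB; ring.
  rewrite normrM normrN (ger0_norm (_ : 0 <= 2))// => H; have := Re_le_cabs (L w - L (cpt r t)).
  by rewrite cReB; lra.
have uE w : (u w)%:C = 2 * A%:C - L w - (L w)^*.
  by rewrite /u; case: (L w) => a b; apply: eq_ReIm; simpc => /=; ring.
have TL : z ^+ N.+1 * cmean r (fun w => L w * k w) =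
  - (z ^+ N.+1 * cmean r (fun w => (u w)%:C * k w)).
  have -> : cmean r (fun w => (u w)%:C * k w) =
      cmean r (fun w => 2 * A%:C * k w + ((-1) * (L w * k w) + (-1) * ((L w)^* * k w))).
    by apply: eq_cmean => [|w _]; [exact: ltW|rewrite uE; ring].
  have cA c (F : R[i] -> R[i]) : ccirc r F -> ccirc r (fun w => c * F w).
    by move=> Fc t; apply: ccontM; [exact: ccont_cst|exact: Fc].
  have cM (F : R[i] -> R[i]) : ccirc r F -> ccirc r (fun w => F w * k w).
    by move=> Fc t; apply: ccontM; [exact: Fc|exact: kc].
  rewrite cmeanD; last 2 first.
  - exact: cA.
  - by move=> t; apply: ccontD; [exact: (cA _ _ (cM _ Lc))|exact: (cA _ _ (cM _ Lcc))].
  rewrite cmeanD; last 2 first.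
  - exact: (cA _ _ (cM _ Lc)).
  - exact: (cA _ _ (cM _ Lcc)).
  rewrite !cmeanZ//; last 2 first.
  - exact: cM.
  - exact: cM.
  by rewrite Tc mulr0 addr0 mulrDr mulrCA T1 mulr0 add0r; ring.
rewrite TL cabsN cabsM cabsX expr_div_n.
have rz : 0 < r - cabs z by rewrite subr_gt0.
have -> : 4 * A * (r / (r - cabs z)) * (cabs z ^+ N.+1 / r ^+ N.+1) =
  cabs z ^+ N.+1 * (2 * (r ^- N.+1 * (r / (r - cabs z))) * (2 * A)) by ring.
rewrite ler_wpM2l ?exprn_ge0 ?cabs_ge0//.
have B0 : 0 <= r ^- N.+1 * (r / (r - cabs z)).
  by rewrite mulr_ge0 ?invr_ge0 ?exprn_ge0 ?divr_ge0 ?(ltW r0) ?(ltW rz).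
have u0 t : 0 <= u (cpt r t).
  by rewrite mulr_ge0// subr_ge0 LA// cabs_cpt// ltW.
have ukc : ccirc r (fun w => (u w)%:C * k w).
  by move=> t; apply: ccontM; [exact: uc|exact: kc].
apply: le_trans (@cmean_weight _ r _ u _ B0 ukc uc _) _.
  move=> t _; rewrite cabsM cabs_real ger0_norm// mulrC ler_wpM2r//.
  by rewrite cabs_kernel// cabs_cpt// ltW.
apply: ler_wpM2l; first exact: mulr_ge0.
have -> : cmean r (fun w => (u w)%:C) = 2 * A%:C.
  under eq_fun do rewrite uE.
  have cN (F : R[i] -> R[i]) : ccirc r F -> ccirc r (fun w => (-1) * F w).
    by move=> Fc t; apply: ccontM; [exact: ccont_cst|exact: Fc].
  transitivity (cmean r (fun w => 2 * A%:C + ((-1) * L w + (-1) * (L w)^*))).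
    by apply: eq_cmean => [|w _]; [exact: ltW|ring].
  rewrite cmeanD; last 2 first.
  - by move=> t; exact: ccont_cst.
  - by move=> t; apply: ccontD; [exact: cN|exact: (cN _ Lcc)].
  rewrite cmeanD; [|exact: cN|exact: (cN _ Lcc)].
  by rewrite (cmeanZ _ Lc) (cmeanZ _ Lcc) (cmean_conj Lc) (hold0 Lh)// L0 cmean_cst conjc0 !mulr0 !addr0.
by rewrite mulr_natl cReD /= mulr2n mulrDl mul1r.
Qed.

End holomorphic.

(** * Entire functions and the multiplicities of their zeroes *)

Opaque entire.

Section entire_functions.
Context {R : realType}.
Implicit Types (f g h : R[i] -> R[i]) (z w a b : R[i]) (r : R).

Lemma entire_hold rho f : entire f -> hold rho f.
Proof. by move=> /entireP H z _. Qed.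

Lemma entire_cont f z : entire f -> ccont f z.
Proof. by move=> /entireP/(_ z)[l /cder_cont]. Qed.

Lemma entire_cst c : entire (fun=> c : R[i]).
Proof. by apply/entireP => z; exists 0; exact: cder_cst. Qed.

Lemma entireD f g : entire f -> entire g -> entire (fun w => f w + g w).
Proof.
move=> /entireP fe /entireP ge; apply/entireP => z.
by have [l fl] := fe z; have [m gm] := ge z; exists (l + m); exact: cderD.
Qed.

Lemma entireM f g : entire f -> entire g -> entire (fun w => f w * g w).
Proof.
move=> /entireP fe /entireP ge; apply/entireP => z.
have [l fl] := fe z; have [m gm] := ge z; have := cderM fl gm.
by set q := (X in cder _ _ X); exists q.
Qed.

Lemma entire_id : entire (@id R[i]).
Proof. by apply/entireP => z; exists 1; exact: cder_id. Qed.

Lemma entire_shift f a : entire f -> entire (fun w => f (a + w)).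
Proof. by move=> /entireP fe; apply/entireP => z; have [l /cder_shift] := fe (a + z); exists l. Qed.

Lemma entire_subX a n : entire (fun w => (w - a) ^+ n).
Proof.
elim: n => [|n IH]; first by under eq_fun do rewrite expr0; exact: entire_cst.
under eq_fun do rewrite exprS; apply: entireM; last exact: IH.
by apply: entireD; [exact: entire_id|exact: entire_cst].
Qed.

Lemma entire_div0 f : entire f -> exists2 h, entire h & forall w, f w = f 0 + w * h w.
Proof.
move=> fe; have [psi ph fE] := hol_div0 ltr01 (entire_hold fe).
exists psi; last exact: fE.
apply/entireP => z; have [->|z0] := eqVneq z 0.
  by apply: ph; rewrite cabs0.
have [m fm] := (entireP f).1 fe z.
have := cderM (cderB fm (cder_cst (f 0) z)) (cderV z0).
set L := (X in cder _ _ X) => HL; exists L; apply: cder_near HL.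
exists (cabs z); first by rewrite cabs_gt0.
move=> v vz; rewrite fE addrC addKr mulrC mulKf//; apply: contraTneq vz => ->.
by rewrite sub0r cabsN ltxx.
Qed.

Lemma entire_div f a : entire f -> exists2 h, entire h & forall w, f w = f a + (w - a) * h w.
Proof.
move=> fe; have [h he hE] := entire_div0 (@entire_shift f a fe).
exists (fun w => h (- a + w)); first exact: entire_shift.
by move=> w; have := hE (- a + w); rewrite addNKr addr0 [- a + w]addrC.
Qed.

Lemma ccont_eq f g a : ccont f a -> ccont g a ->
  (exists2 d : R, 0 < d & forall w, w != a -> cabs (w - a) < d -> f w = g w) -> f a = g a.
Proof.
move=> fc gc [d d0 fg]; apply/eqP; rewrite -subr_eq0 -cabs_eq0.
apply/eqP/le_anti; rewrite cabs_ge0 andbT; apply/ler_addgt0Pl => e e0; rewrite addr0.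
have e2 : 0 < e / 2 by rewrite divr_gt0.
have [d1 d10 H1] := fc _ e2; have [d2 d20 H2] := gc _ e2.
pose m := Order.min d (Order.min d1 d2) / 2.
have m0 : 0 < m by rewrite divr_gt0// !lt_min d0 d10.
have mm : m < Order.min d (Order.min d1 d2) by move: m0; rewrite /m; lra.
move: mm; rewrite !lt_min => /and3P[md md1 md2].
have wa : cabs (a + m%:C - a) = m by rewrite addrC addKr cabs_real gtr0_norm.
have wne : a + m%:C != a by rewrite -subr_eq0 -cabs_gt0 wa.
have := H1 (a + m%:C); have := H2 (a + m%:C); rewrite wa (fg _ wne) ?wa// => /(_ md2) A /(_ md1) B.
have -> : f a - g a = (g (a + m%:C) - g a) - (g (a + m%:C) - f a) by ring.
by rewrite (le_trans (cabsB _ _))//; lra.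
Qed.

Lemma ccont_neq0 f a : ccont f a -> f a != 0 ->
  exists2 d : R, 0 < d & forall w, cabs (w - a) < d -> f w != 0.
Proof.
rewrite -cabs_gt0 => /[apply] -[d d0 H]; exists d => // w /H.
by apply: contraTneq => ->; rewrite sub0r cabsN ltxx.
Qed.

(** Otherwise [f] is divisible by every power of [w - a], and the maximum
    principle for the quotients forces [f] to vanish everywhere. *)
Lemma has_mult_ex f a : entire f -> (exists z, f z != 0) -> exists n, has_mult f a n.
Proof.
move=> fe [z0 fz0]; apply: contrapT => /forallNP H.
have div n : exists2 h, entire h & forall w, f w = (w - a) ^+ n * h w.
  elim: n => [|n [h he fE]]; first by exists f => // w; rewrite expr0 mul1r.
  have ha : h a = 0.
    by apply/eqP/negPn/negP => h0; apply: (H n); exists h.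
  have [k ke hE] := entire_div a he.
  by exists k => // w; rewrite fE hE ha add0r mulrA -exprSr.
pose d := cabs (z0 - a); pose r := 2 * d + 1.
have d0 : 0 <= d := cabs_ge0 _.
have r0 : 0 < r by rewrite ltr_wpDl ?mulr_ge0.
have dr : d < r by rewrite /r; lra.
have [|M M0 fM] := @hold_bounded _ (r + 1) _ r (entire_hold (@entire_shift f a fe)).
  by rewrite ltrDl.
pose B := 2 * M * (r / (r - d)).
have bnd n : cabs (f z0) <= B * (d / r) ^+ n.
  have [h he fE] := div n.
  have hM w : cabs w = r -> cabs (h (a + w)) <= M / r ^+ n.
    move=> wr; rewrite ler_pdivlMr ?exprn_gt0//.
    have := fM w; rewrite wr => /(_ (lexx _)); rewrite fE addrC addKr cabsM cabsX wr.
    by rewrite addrC mulrC.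
  have := @max_principle _ (r + 1) (fun w => h (a + w)) r (z0 - a) _ (entire_hold (@entire_shift h a he)) dr.
  rewrite ltrDl ltr01 subrKC -/d => /(_ _ isT hM) hz.
  rewrite fE cabsM cabsX -/d (le_trans (ler_wpM2l (exprn_ge0 n d0) hz))//.
  by rewrite /B expr_div_n le_eqVlt; apply/orP; left; apply/eqP; ring.
have B1 : 0 < B + 1.
  by rewrite ltr_wpDl// /B !mulr_ge0// ?invr_ge0 ?subr_ge0 ?(ltW r0) ?(ltW dr).
have f0 : 0 < cabs (f z0) by rewrite cabs_gt0.
have [||N HN] := @small_exp _ (d / r) (cabs (f z0) / (B + 1)).
- by rewrite divr_ge0 ?(ltW r0)//= ltr_pdivrMr// mul1r.
- by rewrite divr_gt0.
have := HN N (leqnn _); rewrite ltr_pdivlMr// => A.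
have := bnd N; have : 0 <= (d / r) ^+ N by rewrite exprn_ge0// divr_ge0 ?(ltW r0).
by lra.
Qed.

Lemma has_mult_uniq f a n m : has_mult f a n -> has_mult f a m -> n = m.
Proof.
wlog nm : n m / (n < m)%N => [H fn fm|].
  have [nm|mn|//] := ltngtP n m; first exact: H.
  by apply/esym; exact: H.
move=> [h [he h0 fh]] [k [ke k0 fk]].
suff : h a = 0 by move/eqP: h0.
have -> : h a = (fun w => (w - a) ^+ (m - n) * k w) a.
  apply: (@ccont_eq h (fun w => (w - a) ^+ (m - n) * k w)); first exact: entire_cont.
    by apply: entire_cont; apply: entireM; [exact: entire_subX|exact: ke].
  exists 1 => // w wa _; have wa0 : (w - a) ^+ n != 0 by rewrite expf_neq0// subr_eq0.
  by apply: (mulfI wa0); rewrite -fh fk mulrA -exprD subnKC// ltnW.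
by rewrite subrr expr0n subn_eq0 leqNgt nm mul0r.
Qed.

Lemma mult_unique f a n : has_mult f a n -> mult f a = n.
Proof.
by move=> fn; apply: (@has_mult_uniq f a) => //; exact: (@xgetPex _ 0%N [set n | has_mult f a n] (ex_intro _ n fn)).
Qed.

Lemma multP f a : entire f -> (exists z, f z != 0) -> has_mult f a (mult f a).
Proof. by move=> fe f0; have [n fn] := has_mult_ex a fe f0; rewrite (mult_unique fn). Qed.

Lemma mult_eq0 f a : entire f -> (exists z, f z != 0) -> (mult f a == 0%N) = (f a != 0).
Proof.
move=> fe f0; have [h [he h0 fE]] := multP a fe f0; rewrite [f a]fE subrr expr0n.
by case: (mult f a) => [|n] /=; rewrite ?mul1r ?h0 ?mul0r ?eqxx.
Qed.

Lemma mult_neq0 f a : entire f -> f a != 0 -> mult f a = 0%N.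
Proof. by move=> fe f0; apply/eqP; rewrite mult_eq0//; exists a. Qed.

Lemma has_multM f g a n m : has_mult f a n -> has_mult g a m ->
  has_mult (fun w => f w * g w) a (n + m).
Proof.
move=> [h [he h0 fE]] [k [ke k0 gE]]; exists (fun w => h w * k w); split.
- by apply: entireM; [exact: he|exact: ke].
- exact: mulf_neq0.
- by move=> w; rewrite fE gE exprD; ring.
Qed.

Lemma multM f g a : entire f -> entire g -> (exists z, f z != 0) -> (exists z, g z != 0) ->
  mult (fun w => f w * g w) a = (mult f a + mult g a)%N.
Proof. by move=> fe ge f0 g0; apply: mult_unique; apply: has_multM; exact: multP. Qed.

Lemma mult_punctured f a : entire f -> (exists z, f z != 0) ->
  exists2 d : R, 0 < d & forall w, w != a -> cabs (w - a) < d -> f w != 0.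
Proof.
move=> fe f0; have [h [he h0 fE]] := multP a fe f0.
have [d d0 H] := ccont_neq0 (entire_cont a he) h0; exists d => // w wa /H hw.
by rewrite fE mulf_neq0// expf_neq0// subr_eq0.
Qed.

(** Otherwise the zero [a] would be isolated. *)
Lemma entire_eq0 f a : entire f -> (forall t : R, f (a + t%:C) = 0) -> forall z, f z = 0.
Proof.
move=> fe ft z; apply/eqP/negPn/negP => fz.
have [d d0 H] := mult_punctured a fe (ex_intro _ z fz).
have d2 : 0 < d / 2 by rewrite divr_gt0.
have wa : cabs (a + (d / 2)%:C - a) = d / 2 by rewrite addrC addKr cabs_real gtr0_norm.
have := H (a + (d / 2)%:C); rewrite ft eqxx wa => /(_ _ _)/negP; apply => //.
  by rewrite -subr_eq0 -cabs_gt0 wa.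
by lra.
Qed.

Lemma entire_prod I (s : seq I) (F : I -> R[i] -> R[i]) : (forall i, entire (F i)) ->
  entire (fun w => \prod_(i <- s) F i w).
Proof.
move=> Fe; elim: s => [|i s IH].
  by under eq_fun do rewrite big_nil; exact: entire_cst.
by under eq_fun do rewrite big_cons; apply: entireM; [exact: Fe|exact: IH].
Qed.

Lemma entire_factor f (s : seq R[i]) : entire f -> (exists z, f z != 0) -> uniq s ->
  exists2 h, entire h & [/\ forall w, f w = \prod_(a <- s) (w - a) ^+ mult f a * h w,
    forall a, a \in s -> h a != 0 & forall w, f w != 0 -> h w != 0].
Proof.
move=> fe f0; elim: s => [_|b s IH /= /andP[bs us]].
  by exists f => //; split => // w; rewrite big_nil mul1r.
have [h he [fE hs hz]] := IH us.
have h0 : exists z, h z != 0 by have [z /hz] := f0; exists z.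
pose P w := \prod_(a <- s) (w - a) ^+ mult f a.
have Pe : entire P by apply: entire_prod => a; exact: entire_subX.
have Pb : P b != 0.
  rewrite /P prodf_seq_neq0; apply/allP => a sa /=; rewrite expf_neq0// subr_eq0.
  by apply: contraNneq bs => ->.
have hb : mult h b = mult f b.
  have := @multM P h b Pe he (ex_intro _ b Pb) h0; rewrite (mult_neq0 Pe Pb).
  by rewrite (_ : (fun w => P w * h w) = f) => [->//|]; apply/funext => w; rewrite fE.
have [k [ke kb hE]] := multP b he h0.
exists k => //; split.
- by move=> w; rewrite fE hE big_cons hb mulrCA mulrA.
- move=> a; rewrite inE => /predU1P[->//|sa].
  by have := hs a sa; rewrite hE mulf_eq0 negb_or => /andP[].
- by move=> w /hz; rewrite hE mulf_eq0 negb_or => /andP[].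
Qed.

Lemma entire_factor1 f (s : seq R[i]) : entire f -> (exists z, f z != 0) -> uniq s -> 0 \notin s ->
  exists2 h, entire h & [/\ forall w, f w = \prod_(a <- s) (1 - w / a) ^+ mult f a * h w,
    forall a, a \in s -> h a != 0 & forall w, f w != 0 -> h w != 0].
Proof.
move=> fe f0 us s0; have [h he [fE hs hz]] := entire_factor fe f0 us.
pose c := \prod_(a <- s) (- a) ^+ mult f a.
have c0 : c != 0.
  rewrite /c prodf_seq_neq0; apply/allP => a sa /=; rewrite expf_neq0// oppr_eq0.
  by apply: contraNneq s0 => <-.
exists (fun w => c * h w); first by apply: entireM; [exact: entire_cst|exact: he].
split=> [w|a /hs ha|w /hz hw]; last 2 first.
- exact: mulf_neq0.
- exact: mulf_neq0.
rewrite fE mulrA; congr (_ * _); rewrite /c -big_split /= big_seq [RHS]big_seq.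
apply: eq_bigr => a sa; rewrite -exprMn; congr (_ ^+ _).
by field; apply: contraNneq s0 => <-.
Qed.

(** Jensen's bound in a crude form: on the circle of radius [3 r] each factor
    [1 - w / a] has modulus at least 2. *)
Lemma zero_count f (s : seq R[i]) r (M : R) : entire f -> f 0 != 0 -> uniq s -> 0 < r ->
  (forall a, a \in s -> a != 0 /\ cabs a <= r) ->
  (forall w, cabs w = 3 * r -> cabs (f w) <= M) ->
  2 ^+ (\sum_(a <- s) mult f a) * cabs (f 0) <= 2 * M.
Proof.
move=> fe f0 us r0 sr fM.
have aux (x y : R) : 3 <= x -> x - 1 <= y -> 2 <= y by lra.
have s0 : 0 \notin s by apply/negP => /sr[]; rewrite eqxx.
have [h he [fE _ _]] := entire_factor1 fe (ex_intro _ 0 f0) us s0.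
have fh0 : f 0 = h 0.
  rewrite fE big1 ?mul1r// => a _; by rewrite mul0r subr0 expr1n.
set n := (\sum_(a <- s) mult f a)%N.
have n0 : 0 < 2 ^+ n :> R by rewrite exprn_gt0.
have hM w : cabs w = 3 * r -> cabs (h w) <= M / 2 ^+ n.
  move=> wr; rewrite ler_pdivlMr// mulrC; apply: le_trans (fM w wr).
  rewrite fE cabsM ler_wpM2r ?cabs_ge0// cabs_prod /n -prodrXr big_seq [leRHS]big_seq.
  apply: ler_prod => a /sr[a0 ar]; rewrite exprn_ge0//= cabsX.
  rewrite lerXn2r ?nnegrE ?cabs_ge0//.
  have a00 : 0 < cabs a by rewrite cabs_gt0.
  have : 3 <= cabs (w / a) by rewrite cabsf wr ler_pdivlMr// ler_pM2l.
  by move=> /aux; apply; have := cabs_lerB (w / a) 1; rewrite cabs1 cabsBC.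
have r30 : 0 < 3 * r by rewrite mulr_gt0.
have z0 : cabs (0 : R[i]) < 3 * r by rewrite cabs0.
have := @max_principle _ (3 * r + 1) h (3 * r) 0 (M / 2 ^+ n) (entire_hold he) z0.
rewrite ltrDl ltr01 cabs0 subr0 divff ?gt_eqF// mulr1 -fh0 => /(_ isT hM).
by rewrite mulrA ler_pdivlMr// mulrC.
Qed.

Lemma entire_bounded f r : entire f ->
  exists2 M : R, 0 <= M & forall z, cabs z <= r -> cabs (f z) <= M.
Proof. by move=> fe; apply: (@hold_bounded _ (r + 1)); [exact: entire_hold|rewrite ltrDl]. Qed.

Lemma mult_div0 f g m a : entire f -> entire g -> (exists z, f z != 0) -> g 0 != 0 ->
  (forall w, f w = (w - 0) ^+ m * g w) -> a != 0 -> mult f a = mult g a.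
Proof.
move=> fe ge f0 g0 fE a0; pose u w : R[i] := (w - 0) ^+ m.
have ue : entire u by exact: entire_subX.
have ua : u a != 0 by rewrite /u subr0 expf_neq0.
have -> : f = fun w => u w * g w by apply/funext => w; rewrite fE.
by rewrite multM//; [rewrite (mult_neq0 ue ua)|exists a|exists 0].
Qed.

(** [zero_count] bounds the number of zeroes in a disc, once the zero at the
    origin is divided out. *)
Lemma finite_zeros f r : entire f -> (exists z, f z != 0) ->
  finite_set [set a | mult f a != 0%N /\ cabs a <= r].
Proof.
move=> fe f0; have [g [ge g0 fE]] := multP 0 fe f0.
have fg a (a0 : a != 0) := esym (mult_div0 fe ge f0 g0 fE a0).
pose r1 : R := `|r| + 1; have r10 : 0 < r1 by rewrite ltr_wpDl.
have [M M0 gM] := entire_bounded (3 * r1) ge.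
have g00 : 0 < cabs (g 0) by rewrite cabs_gt0.
apply: contrapT => /(infinite_set_fset (Num.bound (2 * M / cabs (g 0))).+1) [X XA cX].
pose Y := (X `\ 0)%fset.
have YA a : a \in (Y : seq R[i]) -> a != 0 /\ cabs a <= r1.
  move=> aY; have : a \in Y by []; rewrite in_fsetD1 => /andP[a0 /XA [_ ar]]; split => //.
  by rewrite (le_trans ar)// /r1; have := ler_norm r; lra.
have gM' w : cabs w = 3 * r1 -> cabs (g w) <= M by move=> wr; rewrite gM// wr.
have := zero_count ge g0 (fset_uniq Y) r10 YA gM'; rewrite -ler_pdivlMr//.
apply/negP; rewrite -ltNge; set n := (\sum_(a <- _) _)%N.
have Bn : (Num.Def.archi_bound (2 * M / cabs (g 0))%R <= n)%N.
  rewrite /n (@leq_trans #|` Y|)//.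
    by move: cX; rewrite (cardfsD1 0 X); case: (0 \in X) => /=; rewrite ?add1n ?add0n ?ltnS// => /ltnW.
  rewrite cardfE -sum1_card (big_seq_fsetE _ _ (fun=> true) (mult g)) /=.
  apply: leq_sum => -[a /= aY] _; rewrite lt0n.
  move: aY; rewrite in_fsetD1 => /andP[a0 /XA [+ _]]; by rewrite fg.
rewrite (lt_le_trans (archi_boundP _)) ?divr_ge0 ?mulr_ge0 ?(ltW g00)//.
rewrite (@le_trans _ _ n%:R) ?ler_nat// -natrX ler_nat ltnW// ltn_expl//.
Qed.

End entire_functions.

(** * Unordered sums and products *)

Section unordered.
Context {R : realType} {V : Type} {idx : V} {op : Monoid.com_law idx}.
Variable dist : V -> V -> R.
Hypothesis dist0 : forall x, dist x x = 0.
Hypothesis distC : forall x y, dist x y = dist y x.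
Hypothesis dist_triangle : forall x y z, dist x z <= dist x y + dist y z.

Definition partial {T : choiceType} (A : set T) (F : T -> V) (X : {fset T}) :=
  \big[op/idx]_(i <- X | i \in A) F i.

(** Convergence of [F] over [A] along the finite sets, for the operation [op].
    Sums of reals and products of complex numbers are both instances. *)
Definition ucvg {T : choiceType} (A : set T) (F : T -> V) (l : V) :=
  forall e : R, 0 < e -> exists X0 : {fset T}, forall X : {fset T},
    (X0 `<=` X)%fset -> dist (partial A F X) l < e.

Lemma big_same (T : choiceType) (A : set T) (F : T -> V) (s s' : seq T) :
  uniq s -> uniq s' -> (forall i, i \in A -> (i \in s) = (i \in s')) ->
  \big[op/idx]_(i <- s | i \in A) F i = \big[op/idx]_(i <- s' | i \in A) F i.
Proof.
move=> us us' ss'; rewrite -[LHS]big_filter -[RHS]big_filter; apply: perm_big.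
apply: uniq_perm; rewrite ?filter_uniq// => i; rewrite !mem_filter.
by case: (boolP (i \in A)) => //= /ss'.
Qed.

Lemma ucvg_ext (T : choiceType) (A B : set T) (F G : T -> V) l :
  (forall i, (if i \in A then F i else idx) = (if i \in B then G i else idx)) ->
  ucvg A F l -> ucvg B G l.
Proof.
move=> FG H e /H[X0 HX]; exists X0 => X /HX; rewrite /partial [X in _ -> dist X _ < _]big_mkcond.
by rewrite (eq_bigr _ (fun i _ => esym (FG i))) -big_mkcond.
Qed.

Lemma ucvg_reindex (T T' : choiceType) (A : set T) (B : set T') (h : T -> T') (g : T' -> T)
    (F : T' -> V) l :
  (forall i, i \in A -> h i \in B /\ g (h i) = i) ->
  (forall j, j \in B -> g j \in A /\ h (g j) = j) ->
  ucvg B F l -> ucvg A (F \o h) l.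
Proof.
move=> hA gB H e /H[X0 HX]; exists [fset g j | j in X0]%fset => X XX.
pose Y := ([fset h i | i in [fset i in X | i \in A]] `|` X0)%fset.
have -> : partial A (F \o h) X = partial B F Y; last by apply: HX; exact: fsubsetUr.
pose s := [seq h i | i <- [seq i <- X | i \in A]].
have us : uniq s.
  rewrite map_inj_in_uniq ?filter_uniq ?fset_uniq// => i j.
  rewrite !mem_filter => /andP[/hA[_ Ei] _] /andP[/hA[_ Ej] _] hij.
  by rewrite -Ei -Ej hij.
have -> : partial A (F \o h) X = \big[op/idx]_(j <- s | j \in B) F j.
  rewrite /s big_map big_filter_cond /partial; apply: eq_bigl => i.
  by case: (boolP (i \in A)) => // /hA[-> _].
apply: big_same => // j jB; apply/mapP/idP; first case=> i.
  rewrite mem_filter => /andP[iA iX] ->; rewrite in_fsetU; apply/orP; left.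
  by apply/imfsetP; exists i => //=; rewrite !inE iX.
rewrite in_fsetU => /orP[/imfsetP[i /=]|jX].
  by rewrite !inE => /andP[iX iA] ->; exists i => //; rewrite mem_filter iA.
have [gA hg] := gB j jB; exists (g j) => //; rewrite mem_filter gA /=.
by apply: (fsubsetP XX); apply/imfsetP; exists j.
Qed.

Lemma ucvg_uniq (T : choiceType) (A : set T) (F : T -> V) l m :
  (forall x y, dist x y = 0 -> x = y) -> ucvg A F l -> ucvg A F m -> l = m.
Proof.
move=> d0 Fl Fm; apply: d0; apply/le_anti/andP; split; last first.
  by have := dist_triangle l m l; rewrite dist0 (distC m l); lra.
apply/ler_addgt0Pl => e e0; rewrite addr0; have e2 : 0 < e / 2 by rewrite divr_gt0.
have [X1 H1] := Fl _ e2; have [X2 H2] := Fm _ e2.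
have A1 := H1 (X1 `|` X2)%fset (fsubsetUl _ _); have A2 := H2 (X1 `|` X2)%fset (fsubsetUr _ _).
rewrite distC in A1; have := dist_triangle l (partial A F (X1 `|` X2)%fset) m.
by move=> /le_trans; apply; rewrite (splitr e) lerD ?ltW.
Qed.

(** Hadamard's argument collects the zeroes by discs of growing radius rather
    than by arbitrary finite sets. *)
Lemma ucvg_exhaust (T : choiceType) (A : set T) (F : T -> V) l (X : nat -> {fset T}) (e : R) :
  (forall Y : {fset T}, exists N, forall n, (N <= n)%N -> forall i, i \in Y -> i \in A -> i \in X n) ->
  ucvg A F l -> 0 < e -> exists N, forall n, (N <= n)%N -> dist (partial A F (X n)) l < e.
Proof.
move=> exh H /H[X0 HX]; have [N HN] := exh X0; exists N => n Nn.
have -> : partial A F (X n) = partial A F (X n `|` X0)%fset.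
  apply: big_same; rewrite ?fset_uniq// => i iA; rewrite in_fsetU.
  by case: (boolP (i \in X0)) => [/(HN n Nn)/(_ iA) ->|_]; rewrite ?orbF.
by apply: HX; exact: fsubsetUr.
Qed.

Hypothesis op_cont : forall (x y : V) (e : R), 0 < e -> exists2 d : R, 0 < d &
  forall x' y', dist x' x < d -> dist y' y < d -> dist (op x' y') (op x y) < e.

Lemma ucvg_op (T : choiceType) (A : set T) (F G : T -> V) l m :
  ucvg A F l -> ucvg A G m -> ucvg A (fun i => op (F i) (G i)) (op l m).
Proof.
move=> Fl Gm e /(op_cont l m)[d d0 Hd]; have [X1 H1] := Fl _ d0; have [X2 H2] := Gm _ d0.
exists (X1 `|` X2)%fset => X; rewrite fsubUset => /andP[/H1 A1 /H2 A2].
by rewrite /partial big_split; exact: Hd.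
Qed.

(** Over a large finite set of indices in [A], all the inner limits are
    approached simultaneously along one finite set of indices in [B]. *)
Lemma ucvg_fubini (T T' : choiceType) (A : set T) (B : set T') (F : T -> T' -> V) (G : T -> V) l :
  (forall i, i \in A -> ucvg B (F i) (G i)) ->
  ucvg (A `*` B) (fun ij => F ij.1 ij.2) l -> ucvg A G l.
Proof.
move=> FG H e e0; have e2 : 0 < e / 2 by rewrite divr_gt0.
have [W0 HW] := H _ e2; exists [fset ij.1 | ij in W0]%fset => X XX.
have fin (s : seq T) (d : R) : 0 < d -> exists Y0 : {fset T'}, forall Y : {fset T'}, (Y0 `<=` Y)%fset ->
    dist (\big[op/idx]_(i <- s | i \in A) partial B (F i) Y) (\big[op/idx]_(i <- s | i \in A) G i) < d.
  elim: s d => [d d0|i s IH d d0]; first by exists fset0 => Y _; rewrite !big_nil dist0.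
  have [iA|iA] := boolP (i \in A); last first.
    have [Y0 HY] := IH _ d0; exists Y0 => Y /HY; rewrite !big_cons (negbTE iA); exact.
  have [d1 d10 H1] := op_cont (G i) (\big[op/idx]_(i <- s | i \in A) G i) d0.
  have [Y1 HY1] := IH _ d10; have [Y2 HY2] := FG i iA _ d10.
  exists (Y1 `|` Y2)%fset => Y; rewrite fsubUset => /andP[/HY1 A1 /HY2 A2].
  by rewrite !big_cons iA; exact: H1.
have [Y0 HY] := fin X _ e2.
pose Y := (Y0 `|` [fset ij.2 | ij in W0])%fset.
have := HY Y (fsubsetUl _ _); rewrite -/(partial A G X) => A1.
pose s := [seq (i, j) | i <- enum_fset X, j <- enum_fset Y].
have us : uniq s by apply: allpairs_uniq; rewrite ?fset_uniq// => -[? ?] [? ?].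
pose W := [fset ij in s]%fset.
have sW : {subset W0 <= W}.
  move=> [i j] ijW; rewrite inE; apply/allpairsP; exists (i, j); split => //=.
    by apply: (fsubsetP XX); apply/imfsetP; exists (i, j).
  by rewrite in_fsetU; apply/orP; right; apply/imfsetP; exists (i, j).
have WE : partial (A `*` B) (fun ij => F ij.1 ij.2) W =
    \big[op/idx]_(i <- X | i \in A) partial B (F i) Y.
  rewrite /partial (@big_same _ _ _ _ s) ?fset_uniq//; last by move=> ij _; rewrite inE.
  rewrite big_mkcond big_allpairs [RHS]big_mkcond; apply: eq_bigr => i _.
  case: ifPn => iA; last first.
    rewrite big1// => j _; rewrite ifF//=; apply/negbTE; apply: contraNN iA.
    by rewrite in_setX => /andP[].
  rewrite [RHS]big_mkcond; apply: eq_bigr => j _ /=.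
  by rewrite in_setX iA.
have WW : (W0 `<=` W)%fset by apply/fsubsetP.
have := HW W WW; rewrite WE => A2.
rewrite distC in A1; rewrite (splitr e).
exact: le_lt_trans (dist_triangle _ _ _) (ltrD A1 A2).
Qed.

End unordered.

Section unordered_map.
Context {R : realType} {V V' : Type} {idx : V} {op : Monoid.com_law idx}.
Context {idx' : V'} {op' : Monoid.com_law idx'}.
Variables (dist : V -> V -> R) (dist' : V' -> V' -> R) (phi : V -> V').

Lemma ucvg_map (T : choiceType) (A : set T) (F : T -> V) l :
  {morph phi : x y / op x y >-> op' x y} -> phi idx = idx' ->
  (forall e : R, 0 < e -> exists2 d : R, 0 < d & forall x, dist x l < d -> dist' (phi x) (phi l) < e) ->
  ucvg (op := op) dist A F l -> ucvg (op := op') dist' A (phi \o F) (phi l).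
Proof.
move=> phiM phi1 phic H e /phic[d d0 Hd]; have [X0 HX] := H _ d0; exists X0 => X /HX /Hd.
by rewrite /partial (big_morph _ phiM phi1).
Qed.

End unordered_map.

Section numeric.
Context {R : realType}.

Definition cdist (z w : R[i]) : R := cabs (z - w).
Definition rdist (x y : R) : R := `|x - y|.

Lemma cdist0 z : cdist z z = 0. Proof. by rewrite /cdist subrr cabs0. Qed.
Lemma cdistC z w : cdist z w = cdist w z. Proof. exact: cabsBC. Qed.
Lemma cdist_triangle x y z : cdist x z <= cdist x y + cdist y z.
Proof. by rewrite /cdist -[x - z](subrKA y) (le_trans (cabsD _ _)). Qed.
Lemma cdist_eq0 x y : cdist x y = 0 -> x = y.
Proof. by move/eqP; rewrite cabs_eq0 subr_eq0 => /eqP. Qed.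

Lemma rdist0 x : rdist x x = 0. Proof. by rewrite /rdist subrr normr0. Qed.
Lemma rdistC x y : rdist x y = rdist y x. Proof. exact: distrC. Qed.
Lemma rdist_triangle x y z : rdist x z <= rdist x y + rdist y z.
Proof. exact: ler_distD. Qed.
Lemma rdist_eq0 x y : rdist x y = 0 -> x = y.
Proof. by move/eqP; rewrite normr_eq0 subr_eq0 => /eqP. Qed.

Lemma mulC_cont (x y : R[i]) (e : R) : 0 < e -> exists2 d : R, 0 < d &
  forall x' y', cdist x' x < d -> cdist y' y < d -> cdist (x' * y') (x * y) < e.
Proof.
move=> e0; pose B := cabs x + cabs y + 1.
have B0 : 0 < B by rewrite ltr_wpDl ?addr_ge0 ?cabs_ge0.
exists (Order.min 1 (e / B)); first by rewrite lt_min ltr01 divr_gt0.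
move=> x' y'; rewrite !lt_min => /andP[a a'] /andP[b b'].
have -> : cdist (x' * y') (x * y) = cabs ((x' - x) * (y' - y) + ((x' - x) * y + x * (y' - y))).
  by congr cabs; ring.
rewrite (le_lt_trans (cabsD _ _))// cabsM.
have A1 : cabs (x' - x) * cabs (y' - y) <= 1 * cabs (y' - y).
  by rewrite ler_wpM2r ?cabs_ge0// ltW.
have := cabsD ((x' - x) * y) (x * (y' - y)); rewrite !cabsM => A2.
have A3 : cabs (x' - x) * cabs y <= (e / B) * cabs y by rewrite ler_wpM2r ?cabs_ge0// ltW.
have A4 : cabs x * cabs (y' - y) <= cabs x * (e / B) by rewrite ler_wpM2l ?cabs_ge0// ltW.
have : (e / B) * B = e by rewrite divfK// gt_eqF.
by rewrite {2}/B => E; move: A1 A2 A3 A4 E b'; rewrite /cdist => *; lra.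
Qed.

Lemma addR_cont (x y : R) (e : R) : 0 < e -> exists2 d : R, 0 < d &
  forall x' y', rdist x' x < d -> rdist y' y < d -> rdist (x' + y') (x + y) < e.
Proof.
move=> e0; exists (e / 2); first by rewrite divr_gt0.
move=> x' y' a b; rewrite /rdist opprD addrACA (le_lt_trans (ler_normD _ _))//.
by rewrite (splitr e) ltrD.
Qed.

Definition pcvg {T : choiceType} (A : set T) (F : T -> R[i]) (l : R[i]) :=
  ucvg (op := *%R) cdist A F l.
Definition scvg {T : choiceType} (A : set T) (F : T -> R) (l : R) :=
  ucvg (op := +%R) rdist A F l.

Lemma uprodE (T : choiceType) (A : set T) (F : T -> R[i]) l : pcvg A F l -> uprod A F = l.
Proof.
move=> H; have FF := summability.totally_filter (I := T).
apply: (@cvg_lim (R[i]^o)); first exact: norm_hausdorff.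
apply/cvg_cabsP => e /H[X0 HX].
by exists X0 => // X /= /HX.
Qed.

Lemma usumE (T : choiceType) (A : set T) (F : T -> R) l : scvg A F l -> usum A F = l.
Proof.
move=> H; have FF := summability.totally_filter (I := T).
apply: (@cvg_lim R); first exact: norm_hausdorff.
apply/cvgrPdist_lt => e /H[X0 HX].
by exists X0 => // X /= /HX; rewrite distrC.
Qed.

Lemma net_complete (T : choiceType) (u : {fset T} -> R) :
  (forall e : R, 0 < e -> exists X0, forall X, (X0 `<=` X)%fset -> `|u X - u X0| <= e) ->
  exists l, forall e : R, 0 < e -> exists X0, forall X, (X0 `<=` X)%fset -> `|u X - l| < e.
Proof.
move=> H; have FF := summability.totally_filter (I := T).
have : cauchy (u @ summability.totally).
  apply: cauchy_exP => e e0; have e2 : 0 < e / 2 by rewrite divr_gt0.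
  have [X0 HX] := H _ e2; exists (u X0), X0 => // X /= /HX; rewrite /ball /= distrC => A.
  by rewrite (le_lt_trans A)//; lra.
move=> /cauchy_cvg/cvg_ex[l /= /cvgrPdist_lt Hl]; exists l => e /Hl[X0 _ HX].
by exists X0 => X /HX; rewrite distrC.
Qed.

Lemma esum_bounded (T : choiceType) (A : set T) (a : T -> R) : (forall i, 0 <= a i) ->
  (\esum_(i in A) (a i)%:E < +oo)%E <->
  exists B, forall X : {fset T}, \sum_(i <- X | i \in A) a i <= B.
Proof.
move=> a0; split=> [afin|[B HB]].
  have a00 : (0 <= \esum_(i in A) (a i)%:E)%E by apply: esum_ge0 => i _; rewrite lee_fin.
  exists (fine (\esum_(i in A) (a i)%:E)) => X.
  rewrite -lee_fin fineK; last by rewrite ge0_fin_numE.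
  apply: esum_ge; exists [set` [fset i in X | i \in A]%fset].
    split; first exact: finite_fset.
    by move=> i /=; rewrite !inE => /andP[_ /set_mem].
  rewrite -fsbig_seq ?fset_uniq//= -sumEFin.
  by rewrite big_fset_condE.
apply: (@le_lt_trans _ _ B%:E); last exact: ltry.
apply: ge_ereal_sup => _ [D [Dfin DA] <-].
rewrite fsbig_finite// sumEFin lee_fin; apply: le_trans (HB (fset_set D)).
rewrite [leRHS]big_mkcond [leLHS]big_seq [leRHS]big_seq; apply: ler_sum => i.
by rewrite in_fset_set// => /set_mem/DA/mem_set ->.
Qed.

Lemma partial_split (V : Type) (idx : V) (op : Monoid.com_law idx) (T : choiceType) (A : set T)
    (F : T -> V) (X0 X : {fset T}) : (X0 `<=` X)%fset ->
  \big[op/idx]_(i <- X | i \in A) F i =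
  op (\big[op/idx]_(i <- X0 | i \in A) F i) (\big[op/idx]_(i <- (X `\` X0)%fset | i \in A) F i).
Proof.
move=> X0X; rewrite -big_cat; apply: big_same; rewrite ?fset_uniq//.
  rewrite cat_uniq !fset_uniq andbT /=; apply/hasPn => i.
  by rewrite in_fsetD => /andP[].
move=> i _; rewrite mem_cat in_fsetD.
by case: (boolP (i \in X0)) => //= /(fsubsetP X0X).
Qed.

(** [X0] nearly attains the supremum of the partial sums. *)
Lemma sum_tail (T : choiceType) (A : set T) (a : T -> R) (B d : R) : (forall i, 0 <= a i) ->
  (forall X : {fset T}, \sum_(i <- X | i \in A) a i <= B) -> 0 < d ->
  exists X0 : {fset T}, forall X : {fset T}, (X0 `<=` X)%fset ->
    \sum_(i <- (X `\` X0)%fset | i \in A) a i <= d.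
Proof.
move=> a0 HB d0; pose E := [set \sum_(i <- (X : {fset T}) | i \in A) a i | X in setT].
have hE : has_sup E.
  by split; [exists (\sum_(i <- (fset0 : {fset T}) | i \in A) a i), fset0|exists B => _ [X _ <-]].
have [_ [X0 _ <-] HX] := sup_adherent d0 hE.
exists X0 => X X0X; have : \sum_(i <- X | i \in A) a i <= sup E.
  by apply: sup_upper_bound => //; exists X.
by rewrite (partial_split _ _ _ X0X) /=; lra.
Qed.

Lemma expR_sub1 (x : R) : 0 <= x <= 1 / 2 -> expR x - 1 <= 2 * x.
Proof.
move=> /andP[x0 x1]; have := expR_ge1Dx (- x); rewrite expRN => H.
have e0 := expR_gt0 x.
have : expR x * (1 - x) <= 1.
  by rewrite -ler_pdivlMl// mulr1.
nra.
Qed.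

(** Expanding the product, its distance to 1 is largest when the [F i - 1] are
    positive reals; and [1 + x <= expR x]. *)
Lemma cabs_prod_le I (s : seq I) (P : pred I) (F : I -> R[i]) :
  cabs (\prod_(i <- s | P i) F i) <= expR (\sum_(i <- s | P i) cabs (F i - 1)) /\
  cabs (\prod_(i <- s | P i) F i - 1) <= expR (\sum_(i <- s | P i) cabs (F i - 1)) - 1.
Proof.
elim: s => [|i s [IH1 IH2]]; first by rewrite !big_nil expR0 cabs1 !subrr cabs0.
rewrite !big_cons; case: ifP => // _; rewrite expRD.
set x := cabs (F i - 1); set p := \prod_(_ <- _ | _) _ in IH1 IH2 *.
set S := \sum_(_ <- _ | _) _ in IH1 IH2 *.
have x0 : 0 <= x := cabs_ge0 _; have ex := expR_ge1Dx x.
have Fx : cabs (F i) <= expR x.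
  by rewrite (le_trans _ ex)// /x -{1}[F i](subrK 1) (le_trans (cabsD _ _))// cabs1 addrC.
have e1 : 1 <= expR S by have := cabs_ge0 (p - 1); lra.
split; first by rewrite cabsM ler_pM ?cabs_ge0.
have -> : F i * p - 1 = (F i - 1) * p + (p - 1) by ring.
rewrite (le_trans (cabsD _ _))// cabsM -/x.
have : x * cabs p <= (expR x - 1) * expR S by rewrite ler_pM ?cabs_ge0//; lra.
by lra.
Qed.

(** Enlarging [X0] multiplies the product by a factor close to 1, while the
    products over finite sets are bounded by [expR B]. *)
Lemma abs_cvg_prod_cvg (T : choiceType) (A : set T) (F : T -> R[i]) :
  abs_cvg_prod A F -> exists l, pcvg A F l.
Proof.
move=> /(esum_bounded A (fun i => cabs_ge0 _))[B HB].
pose u (X : {fset T}) := \prod_(i <- X | i \in A) F i.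
have H e : 0 < e -> exists X0, forall X, (X0 `<=` X)%fset -> cabs (u X - u X0) <= e.
  move=> e0; pose d := Order.min (1 / 2) (e / (2 * expR B)).
  have eB : 0 < expR B := expR_gt0 B.
  have d0 : 0 < d by rewrite lt_min !divr_gt0// mulr_gt0.
  have [X0 HX] := sum_tail (fun i => cabs_ge0 _) HB d0; exists X0 => X X0X.
  rewrite /u (partial_split _ _ _ X0X) /= -[X in _ - X]mulr1 -mulrBr cabsM.
  have [p1 _] := cabs_prod_le X0 (fun i => i \in A) F.
  have [_ p2] := cabs_prod_le (X `\` X0)%fset (fun i => i \in A) F.
  have := HX X X0X; set S := \sum_(_ <- _ | _) _ in p2 * => Sd.
  have S0 : 0 <= S by apply: sumr_ge0 => i _; exact: cabs_ge0.
  have d1 : d <= 1 / 2 by rewrite ge_min lexx.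
  have d2 : d <= e / (2 * expR B) by rewrite ge_min lexx orbT.
  have S1 : 0 <= S <= 1 / 2 by rewrite S0 (le_trans Sd).
  have {}p2 := le_trans p2 (expR_sub1 S1).
  have {}p1 : cabs (\prod_(i <- X0 | i \in A) F i) <= expR B.
    by rewrite (le_trans p1)// ler_expR HB.
  have p3 := ler_pM (cabs_ge0 _) (cabs_ge0 _) p1 p2; apply: le_trans p3 _.
  rewrite mulrCA -ler_pdivlMl// -ler_pdivlMl// (le_trans Sd)// (le_trans d2)//.
  by rewrite le_eqVlt; apply/orP; left; apply/eqP; field; rewrite gt_eqF.
have [e /H[X0 HX]|a Ha] := @net_complete _ (fun X => Re (u X)).
  by exists X0 => X /HX; apply: le_trans; rewrite -cReB Re_le_cabs.
have [e /H[X0 HX]|b Hb] := @net_complete _ (fun X => Im (u X)).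
  by exists X0 => X /HX; apply: le_trans; rewrite -cImB Im_le_cabs.
exists (a +i* b) => e e0; have e2 : 0 < e / 2 by rewrite divr_gt0.
have [X1 H1] := Ha _ e2; have [X2 H2] := Hb _ e2.
exists (X1 `|` X2)%fset => X; rewrite fsubUset => /andP[/H1 A1 /H2 A2].
rewrite /cdist (le_lt_trans (cabs_le_ReIm _))// (splitr e) cReB cImB /=.
exact: ltrD.
Qed.

Lemma abs_cvg_sum_cvg (T : choiceType) (A : set T) (F : T -> R) :
  abs_cvg_sum A F -> exists l, scvg A F l.
Proof.
move=> /(esum_bounded A (fun i => normr_ge0 _))[B HB].
have [e e0|l Hl] := @net_complete _ (fun X => \sum_(i <- X | i \in A) F i).
  have [X0 HX] := sum_tail (fun i => normr_ge0 _) HB e0; exists X0 => X X0X.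
  rewrite (partial_split _ _ _ X0X) [X in `|X|](_ : _ = \sum_(i <- (X `\` X0)%fset | i \in A) F i).
    by rewrite (le_trans (ler_norm_sum _ _ _))// HX.
  by rewrite /= [X in X - _]addrC addrK.
by exists l.
Qed.

End numeric.

(** * Primary factors *)

Section primary_factor.
Context {R : realType}.
Implicit Types (u z : R[i]) (p : nat).

Definition psum p u : R[i] := \sum_(1 <= j < p.+1) u ^+ j / j%:R.

Lemma primaryE p u : primary p u = (1 - u) * expC (psum p u). Proof. by []. Qed.

Lemma psum0 u : psum 0 u = 0. Proof. by rewrite /psum big_geq. Qed.

Lemma psumS p u : psum p.+1 u = psum p u + u ^+ p.+1 / p.+1%:R.
Proof. by rewrite /psum big_nat_recr. Qed.

Lemma natC_neq0 n : n.+1%:R != 0 :> R[i]. Proof. by rewrite pnatr_eq0. Qed.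

Lemma primaryS p u : primary p.+1 u = primary p u * expC (u ^+ p.+1 / p.+1%:R).
Proof. by rewrite !primaryE psumS expCD mulrA. Qed.

(** The derivative of the exponent is the sum of the [u ^ j] for [j < p];
    multiplied by [1 - u] it telescopes. *)
Lemma cder_psum p u : exists2 d, cder (psum p) u d & (1 - u) * d = 1 - u ^+ p.
Proof.
elim: p => [|p [d dp dE]].
  exists 0; last by rewrite expr0 subrr mulr0.
  by rewrite (_ : psum 0 = fun=> 0); [exact: cder_cst|apply/funext => v; exact: psum0].
exists (d + u ^+ p); last by rewrite mulrDr dE exprS; ring.
rewrite (_ : psum p.+1 = fun v => psum p v + p.+1%:R^-1 * v ^+ p.+1); last first.
  by apply/funext => v; rewrite psumS mulrC.
apply: cderD => //; have := cderZ (p.+1%:R^-1) (cderX u p.+1).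
by rewrite mulKf ?natC_neq0.
Qed.

Lemma cder_primary p u : cder (primary p) u (- u ^+ p * expC (psum p u)).
Proof.
have [d dp dE] := cder_psum p u.
have := cderM (cderB (cder_cst 1 u) (cder_id u)) (cder_expC_comp dp).
congr (cder _ _ _); rewrite sub0r.
have -> : - u ^+ p = (1 - u ^+ p) - 1 by ring.
by rewrite -dE; ring.
Qed.

Lemma cabs_psum p u : cabs (psum p u) <= \sum_(1 <= j < p.+1) cabs u ^+ j.
Proof.
rewrite (le_trans (cabs_sum _ _ _))//; apply: ler_sum_nat => -[//|j] _.
rewrite cabsf cabsX cabs_nat ler_pdivrMr ?ltr0n//.
by rewrite ler_peMr ?exprn_ge0 ?cabs_ge0// ler1n.
Qed.

Lemma primary_id0 p : primary p 0 = 1 :> R[i].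
Proof.
rewrite primaryE subr0 mul1r /psum big_nat big1 ?expC0// => j /andP[j1 _].
by rewrite expr0n gtn_eqF// mul0r.
Qed.

(** The derivative of [primary p] is [O(|u| ^ p)] by [cder_primary]; apply the
    mean value inequality. *)
Lemma primary_bound p (rho : R) : 0 <= rho -> exists2 C : R, 0 <= C &
  forall u, cabs u <= rho -> cabs (primary p u - 1) <= C * cabs u ^+ p.+1.
Proof.
move=> rho0; pose B := expR (\sum_(1 <= j < p.+1) rho ^+ j).
exists (2 * B); first by rewrite mulr_ge0 ?expR_ge0.
move=> u ur; have := @cmvt _ (primary p) (fun v => - v ^+ p * expC (psum p v)) u (B * cabs u ^+ p).
rewrite primary_id0 exprSr mulrA mulrA; apply => t /andP[t0 t1]; split; first exact: cder_primary.
have tu : cabs (t%:C * u) <= cabs u.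
  by rewrite cabsM cabs_real ger0_norm// ler_piMl ?cabs_ge0.
rewrite cabsM cabsN cabsX mulrC ler_pM ?exprn_ge0 ?cabs_ge0//; last first.
  by rewrite lerXn2r ?nnegrE ?cabs_ge0.
rewrite cabs_expC /B ler_expR (le_trans (ler_norm _))// (le_trans (Re_le_cabs _))//.
rewrite (le_trans (cabs_psum _ _))//; apply: ler_sum_nat => j _.
by rewrite lerXn2r ?nnegrE ?cabs_ge0// (le_trans tu).
Qed.

Lemma primary_conj p u : (primary p u)^* = primary p u^*.
Proof.
pose J : {rmorphism R[i] -> R[i]} := conjc.
rewrite !primaryE -[LHS]/(J _) -[u^*]/(J u) (rmorphM J) (rmorphB J) (rmorph1 J).
congr (_ * _); rewrite -[LHS]/(expC _)^* expC_conj; congr expC.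
rewrite /psum -[LHS]/(J _) (rmorph_sum J); apply: eq_bigr => j _.
by rewrite (fmorph_div J) (rmorphXn J) (rmorph_nat J).
Qed.

Lemma expR_sub1_le (x : R) : expR x - 1 <= x * expR x.
Proof.
have := expR_ge1Dx (- x); rewrite expRN => H; have e0 := expR_gt0 x.
have : expR x * (1 - x) <= 1 by rewrite -ler_pdivlMl// mulr1.
lra.
Qed.

Lemma cabsX_sub1 z n : cabs (z ^+ n - 1) <= expR (n%:R * cabs (z - 1)) - 1.
Proof.
have [_] := cabs_prod_le (nseq n z) xpredT id.
by rewrite !big_nseq iter_mulr_1 iter_addr_0 mulr_natl.
Qed.

(** The [b i] stay away from 0, because each term of the bounded sum is
    bounded and [M i] is at least 1; so [primary_bound] applies to all the [z
    / b i] with one constant. *)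
Lemma abs_cvg_primary (T : choiceType) (A : set T) (b : T -> R[i]) (M : T -> nat) p (B : R) z :
  (forall i, i \in A -> b i != 0 /\ M i != 0%N) ->
  (forall X : {fset T}, \sum_(i <- X | i \in A) (M i)%:R / cabs (b i) ^+ p.+1 <= B) ->
  abs_cvg_prod A (fun i => primary p (z / b i) ^+ M i).
Proof.
move=> bA HB; apply/esum_bounded => [i|]; first exact: cabs_ge0.
have t0 i : 0 <= (M i)%:R / cabs (b i) ^+ p.+1 :> R by rewrite divr_ge0 ?exprn_ge0 ?cabs_ge0.
have B1 i : i \in A -> (M i)%:R / cabs (b i) ^+ p.+1 <= B.
  by move=> iA; have := HB [fset i]%fset; rewrite big_mkcond big_seq_fset1 iA.
pose d := Order.min 1 (B + 1)^-1.
have [A0|/existsNP[i0 i0A]] := pselect (forall i, i \notin A).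
  by exists 0 => X; rewrite big1// => i iA; have := A0 i; rewrite iA.
have {i0 i0A}B0 : 0 <= B.
  have i0A' : i0 \in A by apply/negPn/negP; exact: i0A.
  exact: le_trans (t0 i0) (B1 _ i0A').
have d0 : 0 < d by rewrite lt_min ltr01 invr_gt0; lra.
have db i : i \in A -> d <= cabs (b i).
  move=> iA; have [b1|b1] := leP 1 (cabs (b i)); first by rewrite /d (le_trans _ b1)// ge_min lexx.
  have [bi0 Mi0] := bA i iA; have bi : 0 < cabs (b i) by rewrite cabs_gt0.
  rewrite (@le_trans _ _ (B + 1)^-1)//; first by rewrite /d ge_min lexx orbT.
  rewrite -[leRHS]invrK lef_pV2 ?posrE ?invr_gt0//; last by lra.
  rewrite (@le_trans _ _ ((M i)%:R / cabs (b i) ^+ p.+1))//; last by have := B1 i iA; lra.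
  rewrite (@le_trans _ _ (cabs (b i) ^- p.+1))//; last first.
    by rewrite ler_peMl ?invr_ge0 ?exprn_ge0 ?cabs_ge0// ler1n lt0n.
  rewrite lef_pV2 ?posrE ?exprn_gt0//; by rewrite exprSr ler_piMl ?(ltW bi)// exprn_ile1 ?(ltW bi) ?(ltW b1).
have [C C0 HC] := @primary_bound p (cabs z / d) (divr_ge0 (cabs_ge0 _) (ltW d0)).
pose K := C * cabs z ^+ p.+1; have K0 : 0 <= K by rewrite mulr_ge0 ?exprn_ge0 ?cabs_ge0.
have xK i : i \in A -> (M i)%:R * cabs (primary p (z / b i) - 1) <=
    K * ((M i)%:R / cabs (b i) ^+ p.+1).
  move=> iA; have -> : K * ((M i)%:R / cabs (b i) ^+ p.+1) =
      (M i)%:R * (C * (cabs z / cabs (b i)) ^+ p.+1) by rewrite /K expr_div_n; ring.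
  rewrite ler_wpM2l ?ler0n// -cabsf HC// cabsf ler_wpM2l ?cabs_ge0//.
  by rewrite lef_pV2 ?posrE ?db ?cabs_gt0//; exact: (bA i iA).1.
exists (K * B * expR (K * B)) => X.
apply: (@le_trans _ _ (\sum_(i <- X | i \in A) K * ((M i)%:R / cabs (b i) ^+ p.+1) * expR (K * B))).
  apply: ler_sum => i iA; apply: le_trans (cabsX_sub1 _ _) _.
  apply: le_trans (expR_sub1_le _) _.
  have x1 := xK i iA; have x2 : K * ((M i)%:R / cabs (b i) ^+ p.+1) <= K * B by rewrite ler_wpM2l ?B1.
  by rewrite ler_pM ?mulr_ge0 ?ler0n ?cabs_ge0 ?expR_ge0// ler_expR (le_trans x1).
rewrite -mulr_suml -mulr_sumr ler_wpM2r ?expR_ge0// ler_wpM2l//; exact: HB.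
Qed.

End primary_factor.

(** * Zeroes of entire functions of finite order *)

Section growth.
Context {R : realType}.
Implicit Types (f g : R[i] -> R[i]) (z w a : R[i]).

Definition growth f (q : nat) (K : R) := forall z, cabs (f z) <= K * expR (cabs z ^+ q).

(** The exponent becomes an integer, to serve as an order of Taylor expansion;
    [q0] is there to make it at least the genus. *)
Lemma finite_order_growth f q0 : entire f -> finite_order f ->
  exists q K, [/\ (q0 <= q)%N, 0 < K & growth f q K].
Proof.
move=> fe [c [K [r [c0 fK]]]].
pose q := (maxn q0 (Num.Def.archi_bound c)); pose r1 := Order.max r 1.
have [M M0 fM] := entire_bounded r1 fe.
exists q, (`|K| + M + 1); split; first exact: leq_maxl.
  by rewrite ltr_wpDl// addr_ge0.
move=> z; have [zr|/ltW zr] := leP (cabs z) r1.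
  rewrite (le_trans (fM z zr))// (@le_trans _ _ ((`|K| + M + 1) * 1))//.
    by have := normr_ge0 K; lra.
  rewrite ler_wpM2l//; first by have := normr_ge0 K; lra.
  by rewrite -expR0 ler_expR exprn_ge0 ?cabs_ge0.
move: zr; rewrite ge_max => /andP[zr z1].
apply: le_trans (fK z zr) _; rewrite (@le_trans _ _ ((`|K| + M + 1) * expR (cabs z `^ c)))//.
  by rewrite ler_wpM2r ?expR_ge0//; have := ler_norm K; lra.
have q0' : 0 <= `|K| + M + 1 by have := normr_ge0 K; lra.
rewrite ler_wpM2l// ler_expR -powR_mulrn ?cabs_ge0// ler_powR//.
rewrite (@le_trans _ _ (Num.Def.archi_bound c)%:R)//.
  by rewrite ltW// archi_boundP// ltW.
by rewrite ler_nat leq_maxr.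
Qed.

(** Outside the unit disc [g] is at most [f] in modulus; inside it is bounded. *)
Lemma growth_div0 f g m q (K : R) : entire g -> growth f q K -> (forall w, f w = w ^+ m * g w) ->
  0 < K -> exists2 K', 0 < K' & growth g q K'.
Proof.
move=> ge fK fE K0; have [M M0 gM] := entire_bounded 1 ge.
exists (K + M); first by lra.
move=> z; have [z1|/ltW z1] := leP (cabs z) 1.
  rewrite (le_trans (gM z z1))// (@le_trans _ _ ((K + M) * 1))//; first by lra.
  by rewrite ler_wpM2l ?addr_ge0 ?(ltW K0)// -expR0 ler_expR exprn_ge0 ?cabs_ge0.
rewrite (@le_trans _ _ (cabs (f z)))//.
  by rewrite fE cabsM cabsX ler_peMl ?cabs_ge0// exprn_ege1.
by rewrite (le_trans (fK z))// ler_wpM2r ?expR_ge0//; lra.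
Qed.

(** [zero_count], with the growth of [f] on the circle of radius [3 * 2 ^ j]. *)
Lemma zero_count_dyadic f q (K : R) : entire f -> f 0 != 0 -> 0 < K -> growth f q K ->
  exists2 C : R, 0 <= C & forall j (s : seq R[i]), uniq s ->
    (forall a, a \in s -> a != 0 /\ cabs a <= 2 ^+ j) ->
    (\sum_(a <- s) mult f a)%:R <= C * 2 ^+ (j * q).
Proof.
move=> fe f0 K0 fK; have cf0 : 0 < cabs (f 0) by rewrite cabs_gt0.
pose L := 2 * K / cabs (f 0); have L0 : 0 < L by rewrite divr_gt0// mulr_gt0.
have l2 : 0 < ln 2 :> R by rewrite ln_gt0// ltr1n.
exists ((`|ln L| + 3 ^+ q) / ln 2).
  by rewrite divr_ge0 ?(ltW l2)// addr_ge0// exprn_ge0.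
move=> j s us sj; set n := (\sum_(a <- s) _)%N.
have j0 : 0 < 2 ^+ j :> R by rewrite exprn_gt0.
pose M := K * expR ((3 * 2 ^+ j) ^+ q).
have fM w : cabs w = 3 * 2 ^+ j -> cabs (f w) <= M by move=> wr; rewrite /M -wr fK.
have := zero_count fe f0 us j0 sj fM; rewrite -/n.
rewrite -ler_pdivlMr// (_ : 2 * M / cabs (f 0) = L * expR ((3 * 2 ^+ j) ^+ q)); last first.
  by rewrite /M /L; ring.
move=> H; have : ln (2 ^+ n) <= ln (L * expR ((3 * 2 ^+ j) ^+ q)).
  by rewrite ler_ln ?posrE ?exprn_gt0// (mulr_gt0 L0 (expR_gt0 _)).
rewrite lnXn// lnM ?posrE ?expR_gt0// expRK -(mulr_natl (ln 2)) => {}H.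
have E : (3 * 2 ^+ j) ^+ q = 3 ^+ q * 2 ^+ (j * q) :> R by rewrite exprMn -exprM.
rewrite mulrAC ler_pdivlMr//; apply: le_trans H _; rewrite E mulrDl.
have e1 : 1 <= 2 ^+ (j * q) :> R by rewrite exprn_ege1// ler1n.
rewrite lerD2r (le_trans (ler_norm _))// ler_peMr//.
Qed.

(** Compare [|a| ^ -(q+1)] with the sum of [2 ^ -(j (q+1))] over the dyadic discs
    that contain [a], and exchange the sums. *)
Lemma zero_sum f q (K : R) : entire f -> f 0 != 0 -> 0 < K -> growth f q K ->
  exists B : R, forall X : {fset R[i]},
    \sum_(a <- X | a \in msupp (mult f) `\ 0) (mult f a)%:R / cabs a ^+ q.+1 <= B.
Proof.
move=> fe f0 K0 fK; have [C C0 HC] := zero_count_dyadic fe f0 K0 fK.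
have [d d0 Hd] := ccont_neq0 (entire_cont 0 fe) f0.
have zd a : a \in msupp (mult f) `\ 0 -> a != 0 /\ d <= cabs a.
  move=> /set_mem[ma /eqP a0]; split => //; rewrite leNgt; apply/negP => ad.
  by have := Hd a; rewrite subr0 => /(_ ad) fa; move: ma; rewrite /msupp /= (mult_neq0 fe fa).
pose c := 2 ^+ q.+1 + d ^- q.+1.
have c0 : 0 <= c by rewrite addr_ge0 ?invr_ge0 ?exprn_ge0 ?(ltW d0).
exists (c * C * 2) => X.
have [J HJ] : exists J, forall a, a \in X -> cabs a <= 2 ^+ J.
  exists (Num.Def.archi_bound (\sum_(a <- X) cabs a)) => a aX.
  have aS : cabs a <= \sum_(a <- X) cabs a.
    by rewrite (big_rem a aX) lerDl sumr_ge0// => b _; exact: cabs_ge0.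
  rewrite (le_trans aS)// (le_trans (ltW (archi_boundP (le_trans (cabs_ge0 a) aS))))//.
  by rewrite -natrX ler_nat ltnW// ltn_expl.
pose t a j : R := if cabs a <= 2 ^+ j then 2 ^- (j * q.+1) else 0.
have t0 a j : 0 <= t a j by rewrite /t; case: ifP => // _; rewrite invr_ge0 exprn_ge0.
have key a : a \in X -> a \in msupp (mult f) `\ 0 ->
    cabs a ^- q.+1 <= c * \sum_(j < J.+1) t a j.
  move=> aX /zd[a0 da]; have ca : 0 < cabs a by rewrite cabs_gt0.
  have big j (jJ : (j <= J)%N) : t a j <= \sum_(j < J.+1) t a j.
    rewrite (bigD1 (Ordinal (jJ : (j < J.+1)%N)))//= lerDl sumr_ge0// => i _; exact: t0.
  have [a1|a1] := leP (cabs a) 1.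
    apply: (@le_trans _ _ (c * t a 0%N)); last by rewrite ler_wpM2l// big.
    rewrite /t expr0 a1 invr1 mulr1 /c.
    rewrite (@le_trans _ _ (d ^- q.+1))//; last by rewrite lerDr exprn_ge0.
    by rewrite lef_pV2 ?posrE ?exprn_gt0// lerXn2r ?nnegrE ?(ltW d0) ?(ltW ca).
  have exj : exists j, cabs a <= 2 ^+ j by exists J; exact: HJ.
  pose j := ex_minn exj; have := erefl j; rewrite {1}/j; case: ex_minnP => j' aj jmin jj'.
  have jJ : (j' <= J)%N by apply: jmin; exact: HJ.
  case: j' aj jmin jJ {jj'} => [|i] aj jmin jJ; first by move: aj; rewrite expr0 leNgt a1.
  have ai : 2 ^+ i < cabs a by rewrite ltNge; apply/negP => /jmin; rewrite ltnn.
  apply: (@le_trans _ _ (c * t a i.+1)); last by rewrite ler_wpM2l// big.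
  rewrite /t aj (@le_trans _ _ (2 ^+ q.+1 * 2 ^- (i.+1 * q.+1)))//; last first.
    by rewrite ler_wpM2r ?invr_ge0 ?exprn_ge0// lerDl invr_ge0 exprn_ge0 ?(ltW d0).
  have -> : 2 ^+ q.+1 * 2 ^- (i.+1 * q.+1) = (2 ^+ i) ^- q.+1 :> R.
    by rewrite mulSn exprD invfM mulrA mulfV ?mul1r ?exprM// expf_neq0.
  by rewrite lef_pV2 ?posrE ?exprn_gt0// lerXn2r ?nnegrE ?exprn_ge0 ?(ltW ca) ?(ltW ai).
apply: (@le_trans _ _ (\sum_(a <- X | a \in msupp (mult f) `\ 0)
    \sum_(j < J.+1) c * ((mult f a)%:R * t a j))).
  rewrite big_seq_cond [leRHS]big_seq_cond; apply: ler_sum => a /andP[aX aA].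
  rewrite -mulr_sumr -mulr_sumr mulrCA ler_wpM2l ?ler0n//; exact: key.
rewrite exchange_big /=.
apply: (@le_trans _ _ (\sum_(j < J.+1) c * C * 2 ^- j)).
  apply: ler_sum => j _.
  pose s := [seq a <- X | (a \in msupp (mult f) `\ 0) && (cabs a <= 2 ^+ j)].
  have us : uniq s by rewrite filter_uniq// fset_uniq.
  have sj a : a \in s -> a != 0 /\ cabs a <= 2 ^+ j.
    by rewrite mem_filter => /andP[/andP[/zd[a0 _] aj] _].
  have -> : \sum_(a <- X | a \in msupp (mult f) `\ 0) c * ((mult f a)%:R * t a j) =
      c * (2 ^- (j * q.+1) * (\sum_(a <- s) mult f a)%:R).
    rewrite -mulr_sumr; congr (c * _).
    rewrite natr_sum mulr_sumr /s big_filter [RHS]big_mkcondr.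
    by apply: eq_bigr => a _; rewrite /t; case: ifP => _; rewrite ?mulr0// mulrC.
  rewrite -mulrA ler_wpM2l//.
  apply: (@le_trans _ _ (2 ^- (j * q.+1) * (C * 2 ^+ (j * q)))).
    by rewrite ler_wpM2l ?invr_ge0 ?exprn_ge0// HC.
  rewrite mulnS exprD invfM le_eqVlt; apply/orP; left; apply/eqP.
  by field; rewrite !expf_neq0.
rewrite -mulr_sumr ler_wpM2l ?mulr_ge0//.
have : \sum_(j < J.+1) (2 ^- j : R) = 2 - 2 ^- J.
  elim: J {HJ key} => [|J IH]; first by rewrite big_ord1 expr0 invr1; ring.
  by rewrite big_ord_recr /= IH exprS; field; rewrite expf_neq0.
move=> ->; have : 0 <= 2 ^- J :> R by rewrite invr_ge0 exprn_ge0.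
by lra.
Qed.

End growth.

(** * Hadamard's factorisation *)

Section hadamard.
Context {R : realType}.
Implicit Types (f g U : R[i] -> R[i]) (z w a : R[i]) (q : nat).

Lemma expC_surj z : z != 0 -> exists c, expC c = z.
Proof.
move=> z0; have c0 : 0 < cabs z by rewrite cabs_gt0.
pose x := Re z / cabs z; pose y := Im z / cabs z.
have xy : x ^+ 2 + y ^+ 2 = 1.
  by rewrite /x /y !expr_div_n -mulrDl -cabs_sqr divff// expf_neq0// gt_eqF.
have x1 : -1 <= x <= 1.
  by rewrite -ler_norml -(@ler_pXn2r _ 2) ?nnegrE// real_normK ?num_real// expr1n -xy lerDl sqr_ge0.
have zE : z = (cabs z)%:C * (x +i* y).
  by apply: eq_ReIm; rewrite ?cReM ?cImM /= mul0r ?subr0 ?addr0 mulrC divfK// gt_eqF.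
have [t [ct st]] : exists t, cos t = x /\ sin t = y.
  have sy : Num.sqrt (1 - x ^+ 2) = `|y| by rewrite -xy addrC addKr sqrtr_sqr.
  have [y0|y0] := leP 0 y.
    by exists (acos x); rewrite acosK ?in_itv// sin_acos// sy ger0_norm.
  by exists (- acos x); rewrite cosN sinN acosK ?in_itv// sin_acos// sy ltr0_norm// opprK.
exists (ln (cabs z) +i* t); rewrite [RHS]zE /expC /= lnK ?posrE//.
by rewrite ct st.
Qed.

Lemma expC_sub1 w : cabs (expC w - 1) <= 2 * expR (cabs w) * cabs w.
Proof.
have := @cmvt _ expC expC w (expR (cabs w)); rewrite expC0; apply => t /andP[t0 t1].
split; first exact: cder_expC.
rewrite cabs_expC ler_expR (le_trans (ler_norm _))// (le_trans (Re_le_cabs _))//.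
by rewrite cabsM cabs_real ger0_norm// ler_piMl ?cabs_ge0.
Qed.

(** [U = 1 + O(z ^ (q+1))] at the origin. *)
Definition near1 q U := exists C d : R, [/\ 0 <= C, 0 < d &
  forall z, cabs z < d -> cabs (U z - 1) <= C * cabs z ^+ q.+1].

Lemma near1_cst q : near1 q (fun=> 1).
Proof. by exists 0, 1; split => // z _; rewrite subrr cabs0 mul0r. Qed.

Lemma near1M q U V : near1 q U -> near1 q V -> near1 q (fun z => U z * V z).
Proof.
move=> [C [d [C0 d0 HU]]] [C' [d' [C0' d0' HV]]].
exists (C * (1 + C') + C'), (Order.min 1 (Order.min d d')); split.
- by rewrite addr_ge0// mulr_ge0// addr_ge0.
- by rewrite !lt_min ltr01 d0.
move=> z; rewrite !lt_min => /and3P[z1 /HU zU /HV zV].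
have -> : U z * V z - 1 = (U z - 1) * (1 + (V z - 1)) + (V z - 1) by ring.
have c0 := cabs_ge0 z; set t := cabs z ^+ q.+1 in zU zV *.
have t0 : 0 <= t by rewrite exprn_ge0.
have t1 : t <= 1 by rewrite exprn_ile1 ?(ltW z1).
rewrite (le_trans (cabsD _ _))// cabsM mulrDl lerD// mulrAC ler_pM ?cabs_ge0//.
rewrite (le_trans (cabsD _ _))// cabs1 lerD2l (le_trans zV)//.
by rewrite -[leRHS]mulr1 ler_wpM2l.
Qed.

Lemma near1_prod q I (s : seq I) (F : I -> R[i] -> R[i]) : (forall i, near1 q (F i)) ->
  near1 q (fun z => \prod_(i <- s) F i z).
Proof.
move=> HF; elim: s => [|i s IH].
  by under eq_fun do rewrite big_nil; exact: near1_cst.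
by under eq_fun do rewrite big_cons; exact: near1M.
Qed.

Lemma near1X q U n : near1 q U -> near1 q (fun z => U z ^+ n).
Proof.
move=> HU; elim: n => [|n IH]; first by under eq_fun do rewrite expr0; exact: near1_cst.
by under eq_fun do rewrite exprS; exact: near1M.
Qed.

Lemma near1_primary q a : near1 q (fun z => primary q (z / a)).
Proof.
have [C C0 HC] := @primary_bound R q 1 ler01.
have [->|a0] := eqVneq a 0.
  by under eq_fun do rewrite invr0 mulr0 primary_id0; exact: near1_cst.
have ca : 0 < cabs a by rewrite cabs_gt0.
exists (C / cabs a ^+ q.+1), (cabs a); split => //; first by rewrite divr_ge0 ?exprn_ge0 ?(ltW ca).
move=> z za; rewrite (le_trans (HC _ _))//.
  by rewrite cabsf ler_pdivrMr// mul1r ltW.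
by rewrite cabsf expr_div_n mulrA mulrAC.
Qed.

Lemma near1_expC q (tau : R[i] -> R[i]) (C d : R) : 0 <= C -> 0 < d ->
  (forall z, cabs z < d -> cabs (tau z) <= C * cabs z ^+ q.+1) ->
  near1 q (fun z => expC (tau z)).
Proof.
move=> C0 d0 H; exists (2 * expR C * C), (Order.min 1 d); split.
- by rewrite !mulr_ge0 ?expR_ge0.
- by rewrite lt_min ltr01.
move=> z; rewrite lt_min => /andP[z1 /H zH]; apply: le_trans (expC_sub1 _) _.
have c0 := cabs_ge0 z.
rewrite -[leRHS]mulrA ler_pM ?mulr_ge0 ?expR_ge0 ?cabs_ge0// ler_pM2l// ler_expR.
by rewrite (le_trans zH)// -[leRHS]mulr1 ler_wpM2l// exprn_ile1 ?(ltW z1).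
Qed.

Lemma ccont_horner (p : {poly R[i]}) z : ccont (fun w => p.[w]) z.
Proof.
elim/poly_ind: p => [|p c IH].
  by under eq_fun do rewrite horner0; exact: ccont_cst.
under eq_fun do rewrite hornerMXaddC.
apply: ccontD; last exact: ccont_cst.
by apply: ccontM => //; exact: ccont_id.
Qed.

(** The lowest nonzero coefficient of [D] would dominate near the origin. *)
Lemma poly_small_eq0 q (D : {poly R[i]}) (C d : R) : (size D <= q.+1)%N -> 0 < d ->
  (forall z, cabs z < d -> cabs D.[z] <= C * cabs z ^+ q.+1) -> D = 0.
Proof.
move=> sD d0 H; apply/eqP/negPn/negP => D0.
have [m [G]] := multiplicity_XsubC D 0; rewrite D0 /= => G0 DE.
have mq : (m <= q)%N.
  have Gn0 : G != 0 by apply: contraNneq G0 => ->; rewrite root0.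
  move: sD; rewrite DE size_Mmonic ?monic_exp ?monicXsubC// size_exp_XsubC addnS /=.
  by move: Gn0; rewrite -size_poly_gt0; case: (size G) => // k _; rewrite addSn ltnS => /(leq_trans (leq_addl _ _)).
have g0 : 0 < cabs G.[0] by rewrite cabs_gt0.
have g2 : 0 < cabs G.[0] / 2 by rewrite divr_gt0.
have [d1 d10 H1] := ccont_horner G 0 g2.
pose C1 := `|C| + 1; have C10 : 0 < C1 by rewrite ltr_wpDl.
pose t := Order.min (Order.min 1 d) (Order.min d1 (cabs G.[0] / (2 * C1))) / 2.
have t0 : 0 < t by rewrite divr_gt0// !lt_min ltr01 d0 d10 divr_gt0// mulr_gt0.
have : t < Order.min (Order.min 1 d) (Order.min d1 (cabs G.[0] / (2 * C1))).
  by move: t0; rewrite /t; lra.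
rewrite !lt_min => /andP[/andP[t1 td] /andP[td1 tC]].
have ct : cabs (t%:C : R[i]) = t by rewrite cabs_real gtr0_norm.
have := H t%:C; rewrite ct => /(_ td); rewrite DE hornerM horner_exp hornerXsubC subr0.
rewrite cabsM cabsX ct => A.
have {}A : cabs G.[t%:C] <= C1 * t.
  have tm : 0 < t ^+ m by rewrite exprn_gt0.
  rewrite -(ler_pM2r tm) (le_trans A)// -mulrA.
  rewrite (@le_trans _ _ (C1 * t ^+ q.+1))//.
    by rewrite ler_wpM2r ?exprn_ge0 ?(ltW t0)// /C1; have := ler_norm C; lra.
  rewrite ler_pM2l// -{1}(subnK mq) exprS exprD ler_pM2l//.
  by rewrite ler_piMl ?exprn_ge0 ?exprn_ile1 ?(ltW t0) ?(ltW t1).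
have := H1 t%:C; rewrite subr0 ct => /(_ td1).
have := cabs_lerB G.[0] G.[t%:C]; rewrite cabsBC => B1 B2.
by move: tC; rewrite ltr_pdivlMr ?mulr_gt0// => tC; nra.
Qed.

(** Then [expC D - 1] is [O(z ^ (q+1))] at the origin, and so is [D], whose
    degree is too small for that. *)
Lemma exp_poly_uniq q (D : {poly R[i]}) U V (d : R) : (size D <= q.+1)%N -> D.[0] = 0 -> 0 < d ->
  near1 q U -> near1 q V -> (forall z, cabs z < d -> expC D.[z] * U z = V z) -> D = 0.
Proof.
move=> sD D0 d0 [C [d1 [C0 d10 HU]]] [C' [d2 [C0' d20 HV]]] H.
have h2 : 0 < 1 / 2 :> R by rewrite divr_gt0.
have [d3 d30 H3] := @expC_near0 R _ h2.
have m0 : 0 < Order.min 1 d3 by rewrite lt_min ltr01.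
have [d4 d40 H4] := ccont_horner D 0 m0.
apply: (@poly_small_eq0 q D (2 * (C' + 3 * C)) (Order.min (Order.min d d1) (Order.min d2 d4))) => //.
  by rewrite !lt_min d0 d10 d20.
move=> z; rewrite !lt_min => /andP[/andP[/H zd /HU zU] /andP[/HV zV z4]].
have := H4 z; rewrite subr0 D0 subr0 => /(_ z4); rewrite lt_min => /andP[Dz1 Dz3].
have A := H3 _ Dz3.
have B : cabs D.[z] <= 2 * cabs (expC D.[z] - 1).
  have := cabs_lerB D.[z] (D.[z] - (expC D.[z] - 1)).
  have -> : D.[z] - (D.[z] - (expC D.[z] - 1)) = expC D.[z] - 1 by ring.
  have -> : D.[z] - (expC D.[z] - 1) = - (expC D.[z] - 1 - D.[z]) by ring.
  by rewrite cabsN; lra.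
have E3 : cabs (expC D.[z]) <= 3.
  have := cabsD (expC D.[z] - 1 - D.[z]) (D.[z] + 1); rewrite (_ : _ + _ = expC D.[z]); last by ring.
  by have := cabsD D.[z] 1; rewrite cabs1; lra.
rewrite (le_trans B)// -mulrA ler_pM2l//.
have -> : expC D.[z] - 1 = (V z - 1) - expC D.[z] * (U z - 1) by rewrite -zd; ring.
rewrite (le_trans (cabsB _ _))// mulrDl lerD// cabsM -mulrA ler_pM ?cabs_ge0//.
Qed.

(** The polynomial in [z] with values [psum q (z / a)]; its constant
    coefficient is 0 because the inverse of 0 is 0. *)
Definition psump q a : {poly R[i]} := \poly_(j < q.+1) (a ^- j / j%:R).

Lemma psumpE q a z : (psump q a).[z] = psum q (z / a).
Proof.
rewrite horner_poly /psum -(big_mkord xpredT (fun j => a ^- j / j%:R * z ^+ j)).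
rewrite big_ltn// invr0 mulr0 mul0r add0r; apply: eq_bigr => j _.
by rewrite expr_div_n; ring.
Qed.

Lemma psum_id0 q : psum q (0 : R[i]) = 0.
Proof. by rewrite /psum big_nat big1// => j /andP[j1 _]; rewrite expr0n gtn_eqF// mul0r. Qed.

(** On a large disc the zeroes can be divided out and the quotient is the
    exponential of a function with a one-sided bound, which by
    Borel-Caratheodory is a polynomial up to a small error. *)
Lemma local_factor f q (K : R) : entire f -> f 0 != 0 -> 0 < K -> growth f q K ->
  exists2 B : R, 0 <= B & forall r : R, 1 <= r ->
  exists (X : {fset R[i]}) (P : {poly R[i]}) (tau : R[i] -> R[i]),
  [/\ forall a, (a \in X) <-> (mult f a != 0%N /\ cabs a <= 2 * r), (size P <= q.+1)%N, P.[0] = 0,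
      forall z, cabs z <= r / 2 -> cabs (tau z) <= B * cabs z ^+ q.+1 / r &
      forall z, cabs z <= r / 2 ->
        f z = f 0 * expC (P.[z] + tau z) * \prod_(a <- X) primary q (z / a) ^+ mult f a].
Proof.
move=> fe f0 K0 fK; have cf0 : 0 < cabs (f 0) by rewrite cabs_gt0.
pose C0 := `|ln (3 * K / cabs (f 0))|.
have L0 : 0 < 3 * K / cabs (f 0) by rewrite divr_gt0// mulr_gt0.
exists (8 * (C0 + 6 ^+ q)); first by rewrite mulr_ge0// addr_ge0 ?normr_ge0 ?exprn_ge0.
move=> r r1; have r0 : 0 < r by exact: lt_le_trans r1.
have fin := finite_zeros (2 * r) fe (ex_intro _ 0 f0).
pose X := fset_set [set a | mult f a != 0%N /\ cabs a <= 2 * r].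
have XP a : (a \in X) <-> (mult f a != 0%N /\ cabs a <= 2 * r).
  by rewrite /X in_fset_set//; split => [/set_mem//|aX]; apply/mem_set.
have X0 : 0 \notin (X : seq R[i]).
  by apply/negP => /XP[]; rewrite (mult_neq0 fe f0) eqxx.
have [h he [fE hX hz]] := entire_factor1 fe (ex_intro _ 0 f0) (fset_uniq X) X0.
have fh0 : f 0 = h 0 by rewrite fE big1 ?mul1r// => a _; rewrite mul0r subr0 expr1n.
have hn0 w : cabs w < 2 * r -> h w != 0.
  move=> wr; have [/hz//|] := boolP (f w != 0); rewrite -(mult_eq0 w fe (ex_intro _ 0 f0)) => mw.
  by apply: hX; apply/XP; split => //; exact: ltW.
pose M := K * expR ((6 * r) ^+ q).
have r60 : 0 < 6 * r by rewrite mulr_gt0.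
have hM w : cabs w = 6 * r -> cabs (h w) <= M.
  move=> wr; rewrite (@le_trans _ _ (cabs (f w)))//; last by rewrite /M -wr.
  rewrite fE cabsM ler_peMl ?cabs_ge0// cabs_prod big_seq.
  elim/big_ind: _ => // [x y x1 y1|a /XP[_ ar]]; first by rewrite mulr_ege1.
  have [->|a0] := eqVneq a 0; first by rewrite invr0 mulr0 subr0 expr1n cabs1.
  rewrite cabsX exprn_ege1//.
  have ca : 0 < cabs a by rewrite cabs_gt0.
  have : 3 <= cabs (w / a) by rewrite cabsf wr ler_pdivlMr//; lra.
  by have := cabs_lerB (w / a) 1; rewrite cabsBC cabs1; set x := cabs (w / a); set y := cabs (1 - _);
     clear; lra.
have hB w : cabs w = r -> cabs (h w) <= 3 * M.
  move=> wr; have w6 : cabs w < 6 * r by rewrite wr; lra.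
  have := @max_principle _ (6 * r + 1) h (6 * r) w M (entire_hold he) w6.
  rewrite ltrDl ltr01 => /(_ isT hM) /le_trans; apply; rewrite wr.
  have -> : 6 * r - r = 5 * r by ring.
  rewrite -mulf_div divff ?gt_eqF// mulr1 mulrAC ler_wpM2r; first by [].
    by rewrite mulr_ge0 ?expR_ge0 ?(ltW K0).
  by rewrite mulrA ler_pdivrMr//; clear; lra.
have [|L [Lh L00] hL] := @hold_log _ (2 * r) (3 / 2 * r) h _ (entire_hold he) hn0; first by lra.
pose A := C0 + (6 * r) ^+ q.
have rr : r < 3 / 2 * r by lra.
have LA w : cabs w = r -> Re (L w) <= A.
  move=> wr; have wr2 : cabs w < 3 / 2 * r by rewrite wr.
  have := hB w wr; rewrite (hL _ wr2) -fh0 cabsM cabs_expC mulrC -ler_pdivlMr//.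
  have -> : 3 * M / cabs (f 0) = 3 * K / cabs (f 0) * expR ((6 * r) ^+ q) by rewrite /M; ring.
  move=> H; have : ln (expR (Re (L w))) <= ln (3 * K / cabs (f 0) * expR ((6 * r) ^+ q)).
    by rewrite ler_ln ?posrE ?expR_gt0// (mulr_gt0 L0 (expR_gt0 _)).
  rewrite lnM ?posrE ?expR_gt0// !expRK => /le_trans; apply.
  by rewrite /A lerD2r ler_norm.
pose c k := cmean r (fun w => L w * w ^- k).
pose P := \poly_(k < q.+1) c k - \sum_(a <- X) (mult f a)%:R *: psump q a.
have PE z : P.[z] = \sum_(k < q.+1) c k * z ^+ k - \sum_(a <- X) (mult f a)%:R * psum q (z / a).
  rewrite hornerD hornerN horner_poly horner_sum; congr (_ - _); apply: eq_bigr => a _.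
  by rewrite hornerZ psumpE.
pose tau z := L z - \sum_(k < q.+1) c k * z ^+ k.
exists X, P, tau; split => //.
- rewrite (leq_trans (size_polyD _ _))// geq_max size_poly size_polyN.
  by rewrite (leq_trans (size_sum _ _ _))//; apply/bigmax_leqP_seq => a _ _;
    rewrite (leq_trans (size_scale_leq _ _))// size_poly.
- rewrite PE big_ord_recl /= big1; last by move=> k _; rewrite expr0n mulr0.
  rewrite big1; last by move=> a _; rewrite mul0r psum_id0 mulr0.
  rewrite expr0 mulr1 addr0 subr0 /c -[RHS]L00 -(hold0 Lh r0 rr).
  by apply: eq_cmean; [exact: ltW|move=> w _; rewrite expr0 invr1 mulr1].
- move=> z zr; have zr' : cabs z < r by lra.
  apply: le_trans (borel_caratheodory q Lh zr' rr L00 LA) _.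
  have A0 : 0 <= A by rewrite addr_ge0 ?normr_ge0// exprn_ge0 ?(ltW r60).
  apply: (@le_trans _ _ (4 * A * 2 * (cabs z / r) ^+ q.+1)).
    rewrite ler_wpM2r ?exprn_ge0 ?divr_ge0 ?cabs_ge0 ?(ltW r0)// ler_wpM2l ?mulr_ge0//.
    by rewrite ler_pdivrMr ?subr_gt0//; lra.
  have -> : 8 * (C0 + 6 ^+ q) * cabs z ^+ q.+1 / r =
      8 * ((C0 + 6 ^+ q) / r * cabs z ^+ q.+1) by ring.
  have -> : 4 * A * 2 * (cabs z / r) ^+ q.+1 = 8 * (A / r ^+ q.+1 * cabs z ^+ q.+1).
    by rewrite expr_div_n; ring.
  rewrite ler_pM2l// ler_wpM2r ?exprn_ge0 ?cabs_ge0// exprS invfM mulrCA mulrC.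
  rewrite ler_wpM2r ?invr_ge0 ?(ltW r0)// ler_pdivrMr ?exprn_gt0// /A exprMn mulrDl lerD2r.
  by rewrite ler_peMr ?normr_ge0// exprn_ege1.
- move=> z zr; have zr' : cabs z < 3 / 2 * r by lra.
  rewrite fE (hL _ zr') -fh0 /tau PE.
  set S := \sum_(a <- X) _; set T := \sum_(k < q.+1) _.
  have -> : T - S + (L z - T) = L z - S by ring.
  have -> : \prod_(a <- X) primary q (z / a) ^+ mult f a =
      \prod_(a <- X) (1 - z / a) ^+ mult f a * expC S.
    rewrite /S expC_sum -big_split /=; apply: eq_bigr => a _.
    by rewrite mulr_natl expCMn -exprMn primaryE.
  have -> : expC (L z) = expC (L z - S) * expC S by rewrite -expCD subrK.
  by ring.
Qed.

Lemma expCB z w : expC (z - w) = expC z / expC w.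
Proof. by rewrite expCD expCN. Qed.

(** The polynomials that [local_factor] attaches to the discs coincide by
    [exp_poly_uniq], and the error terms vanish in the limit of large discs. *)
Lemma hadamard0 f q (K : R) : entire f -> f 0 != 0 -> 0 < K -> growth f q K ->
  exists Q : {poly R[i]}, forall z l,
    pcvg (msupp (mult f) `\ 0) (fun a => primary q (z / a) ^+ mult f a) l ->
    f z = expC Q.[z] * l.
Proof.
move=> fe f0 K0 fK; have [B B0 H] := local_factor fe f0 K0 fK.
have [|W HW] := @choice nat ({fset R[i]} * {poly R[i]} * (R[i] -> R[i])) (fun n s =>
  [/\ forall a, (a \in s.1.1) <-> (mult f a != 0%N /\ cabs a <= 2 * n.+1%:R),
      (size s.1.2 <= q.+1)%N, s.1.2.[0] = 0,
      forall z, cabs z <= n.+1%:R / 2 -> cabs (s.2 z) <= B * cabs z ^+ q.+1 / n.+1%:R &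
      forall z, cabs z <= n.+1%:R / 2 ->
        f z = f 0 * expC (s.1.2.[z] + s.2 z) * \prod_(a <- s.1.1) primary q (z / a) ^+ mult f a]).
  move=> n; have [|X [P [tau HX]]] := H n.+1%:R; first by rewrite ler1n.
  by exists (X, P, tau).
pose X n := (W n).1.1; pose P n := (W n).1.2; pose tau n := (W n).2.
pose U n z := expC (tau n z) * \prod_(a <- X n) primary q (z / a) ^+ mult f a.
have fU n z : cabs z <= n.+1%:R / 2 -> f z = f 0 * (expC (P n).[z] * U n z).
  by move=> zn; have [_ _ _ _ /(_ z zn) ->] := HW n; rewrite expCD /U; ring.
have U1 n : near1 q (U n).
  have [_ _ _ tb _] := HW n; have n0 : 0 < n.+1%:R :> R by rewrite ltr0n.
  apply: near1M; last by apply: near1_prod => a; apply: near1X; exact: near1_primary.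
  apply: (@near1_expC q (tau n) (B / n.+1%:R) (n.+1%:R / 2)); rewrite ?divr_ge0 ?divr_gt0 ?(ltW n0)// => z /ltW zn.
  by rewrite mulrAC; exact: tb.
have PP n : P n = P 0%N.
  apply/eqP; rewrite -subr_eq0; apply/eqP.
  have [_ s1 p1 _ _] := HW n; have [_ s2 p2 _ _] := HW 0%N.
  apply: (@exp_poly_uniq q _ (U n) (U 0%N) (1 / 2)) => //.
  - by rewrite (leq_trans (size_polyD _ _))// geq_max s1 size_polyN.
  - by rewrite hornerD hornerN -[P n]/(W n).1.2 p1 p2 subrr.
  - move=> z /ltW z2; have A := fU 0%N z z2; have := fU n z.
    rewrite A hornerD hornerN expCB => C.
    have {}C : expC (P 0%N).[z] * U 0%N z = expC (P n).[z] * U n z.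
      apply: (mulfI f0); apply: C; rewrite (le_trans z2)// ler_pM2r// ler1n//.
    by rewrite mulrAC -C mulrC mulKf// expC_neq0.
have [c cE] := expC_surj f0; exists (P 0%N + c%:P) => z l Hl.
rewrite hornerD hornerC addrC expCD cE.
have c0 : f 0 * expC (P 0%N).[z] != 0 by rewrite mulf_neq0// expC_neq0.
suff : f z / (f 0 * expC (P 0%N).[z]) = l by move=> <-; rewrite mulrC divfK.
apply: cdist_eq0; apply/le_anti/andP; split; last exact: cabs_ge0.
apply/ler_addgt0Pl => e e0; rewrite addr0.
have [d d0 Hd] := mulC_cont 1 l e0.
have [d1 d10 Hd1] := cder_cont (cder_expC 0) d0.
have exh : forall Y : {fset R[i]}, exists N, forall n, (N <= n)%N -> forall i, i \in Y ->
    i \in msupp (mult f) `\ 0 -> i \in X n.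
  move=> Y; pose s := \sum_(a <- Y) cabs a; exists (Num.Def.archi_bound s) => n Nn a aY /set_mem[/= ma _].
  have [XP _ _ _ _] := HW n; apply/XP; split => //.
  have sa : cabs a <= s.
    by rewrite /s (big_fsetD1 a)//= lerDl sumr_ge0// => i _; exact: cabs_ge0.
  have s0 : 0 <= s by rewrite (le_trans (cabs_ge0 a)).
  have := archi_boundP s0; have : (Num.Def.archi_bound s)%:R <= n.+1%:R :> R by rewrite ler_nat leqW.
  move: sa; set x := cabs a; set y := _%:R; set t := n.+1%:R; move: (cabs_ge0 a); rewrite -/x; clear; lra.
have [N HN] := ucvg_exhaust exh Hl d0.
pose t := 2 * cabs z + B * cabs z ^+ q.+1 / d1.
have u0 : 0 <= B * cabs z ^+ q.+1 / d1.
  by rewrite divr_ge0 ?(ltW d10)// mulr_ge0// exprn_ge0// cabs_ge0.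
have t0 : 0 <= t by rewrite addr_ge0// mulr_ge0// cabs_ge0.
pose n := maxn N (Num.Def.archi_bound t).
have tn : t < n.+1%:R.
  by rewrite (lt_le_trans (archi_boundP t0))// ler_nat leqW// leq_maxr.
have n0 : 0 < n.+1%:R :> R by rewrite ltr0n.
have zn : cabs z <= n.+1%:R / 2.
  by rewrite ler_pdivlMr// (le_trans _ (ltW tn))// mulrC lerDl.
rewrite ltW//; have -> : f z / (f 0 * expC (P 0%N).[z]) = U n z.
  by rewrite (fU n z zn) PP mulrA mulrAC divff// mul1r.
rewrite -[l]mul1r; apply: Hd.
  rewrite /cdist -expC0; apply: Hd1; rewrite subr0.
  have [_ _ _ tb _] := HW n; rewrite (le_lt_trans (tb z zn))// ltr_pdivrMr// [ltRHS]mulrC -ltr_pdivrMr//.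
  by rewrite (le_lt_trans _ tn)// lerDr mulr_ge0// cabs_ge0.
have := HN n (leq_maxl _ _); congr (cdist _ _ < _); rewrite /partial.
rewrite big_seq_cond [RHS]big_seq; apply: eq_bigl => a; case: (boolP (a \in X n)) => //= aX.
have [/(_ a) XP _ _ _ _] := HW n; have [/(_ aX)[ma _] _] := XP.
by apply/mem_set; split => //= a0; move: ma; rewrite a0 (mult_neq0 fe f0) eqxx.
Qed.

End hadamard.

(** * Reduction of the exponent to the genus *)

Section factorisation.
Context {R : realType}.
Implicit Types (f g : R[i] -> R[i]) (z w a : R[i]) (M : R[i] -> nat) (p q : nat).

Lemma zeros_summableP M p : zeros_summable M p <->
  exists B, forall X : {fset R[i]},
    \sum_(a <- X | a \in msupp M `\ 0) (M a)%:R / cabs a ^+ p.+1 <= B.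
Proof. by apply: esum_bounded => a; rewrite divr_ge0 ?exprn_ge0 ?cabs_ge0. Qed.

Lemma ler_sum_bounded (T : choiceType) (A : set T) (a b : T -> R) :
  (forall i, i \in A -> a i <= b i) ->
  (exists B, forall X : {fset T}, \sum_(i <- X | i \in A) b i <= B) ->
  exists B, forall X : {fset T}, \sum_(i <- X | i \in A) a i <= B.
Proof. by move=> ab [B HB]; exists B => X; rewrite (le_trans _ (HB X))// ler_sum. Qed.

Lemma ccvg_abs (T : choiceType) (A : set T) (F : T -> R[i]) :
  (exists B, forall X : {fset T}, \sum_(i <- X | i \in A) cabs (F i) <= B) ->
  exists s, ucvg (op := +%R) (@cdist R) A F s.
Proof.
move=> HB; have part (phi : R[i] -> R) : (forall z, `|phi z| <= cabs z) ->
    exists l, scvg A (phi \o F) l.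
  move=> phib; apply: abs_cvg_sum_cvg; apply/esum_bounded => [i|]; first exact: normr_ge0.
  by apply: ler_sum_bounded HB => i _; rewrite phib.
have [s1 H1] := part (@complex.Re R) (@Re_le_cabs R).
have [s2 H2] := part (@complex.Im R) (@Im_le_cabs R).
exists (s1 +i* s2) => e e0; have e2 : 0 < e / 2 by rewrite divr_gt0.
have [X1 HX1] := H1 _ e2; have [X2 HX2] := H2 _ e2.
exists (X1 `|` X2)%fset => X; rewrite fsubUset => /andP[/HX1 A1 /HX2 A2].
rewrite /cdist (le_lt_trans (cabs_le_ReIm _))// (splitr e) ltrD//.
  apply: le_lt_trans A1; rewrite /rdist /partial cReB le_eqVlt; apply/orP; left; apply/eqP.
  by congr `|_ - _|; apply: (big_morph _ (@cReD R)).
apply: le_lt_trans A2; rewrite /rdist /partial cImB le_eqVlt; apply/orP; left; apply/eqP.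
by congr `|_ - _|; apply: (big_morph _ (@cImD R)).
Qed.

(** Passing from the exponent [q] to [q + 1] multiplies the canonical product by
    the exponential of a monomial of degree [q + 1], as long as the product of
    exponent [q] converges. *)
Lemma canonical_succ M q : zeros_summable M q -> exists c, forall z l,
  pcvg (msupp M `\ 0) (fun a => primary q (z / a) ^+ M a) l ->
  pcvg (msupp M `\ 0) (fun a => primary q.+1 (z / a) ^+ M a) (l * expC (c * z ^+ q.+1)).
Proof.
move=> /zeros_summableP HB.
have [|s Hs] := @ccvg_abs _ (msupp M `\ 0) (fun a => (M a)%:R / a ^+ q.+1).
  by apply: ler_sum_bounded HB => a _; rewrite cabsf cabs_nat cabsX.
exists (s / q.+1%:R) => z l Hl; pose d := z ^+ q.+1 / q.+1%:R.
have -> : s / q.+1%:R * z ^+ q.+1 = s * d by rewrite /d; ring.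
have Hd : pcvg (msupp M `\ 0) ((fun w => expC (w * d)) \o (fun a => (M a)%:R / a ^+ q.+1)) (expC (s * d)).
  apply: (@ucvg_map _ _ _ _ +%R _ *%R (@cdist R) (@cdist R) (fun w => expC (w * d))) Hs.
  - by move=> x y; rewrite mulrDl expCD.
  - by rewrite mul0r expC0.
  - move=> e e0; have : ccont (fun w => expC (w * d)) s.
      apply: (@ccont_comp _ expC (fun w => w * d)); last exact: cder_cont (cder_expC _).
      by apply: ccontM; [exact: ccont_id|exact: ccont_cst].
    by move=> /(_ e e0)[r r0 H]; exists r => // x /H.
apply: ucvg_ext (ucvg_op (@mulC_cont R) Hl Hd) => a; case: ifP => // _ /=.
have -> : primary q.+1 (z / a) ^+ M a = primary q (z / a) ^+ M a * expC ((M a)%:R / a ^+ q.+1 * d).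
  by rewrite primaryS exprMn -expCMn /d -mulr_natl expr_div_n; congr (_ * expC _); ring.
by [].
Qed.

Lemma zeros_away f : entire f -> (exists z, f z != 0) ->
  exists2 d : R, 0 < d & forall a, a \in msupp (mult f) `\ 0 -> d <= cabs a.
Proof.
move=> fe f0; have [d d0 H] := mult_punctured 0 fe f0; exists d => // a /set_mem[/= ma /eqP a0].
rewrite leNgt; apply/negP => ad; move: ma.
by rewrite /msupp /= (mult_neq0 fe (H a a0 _)) ?subr0.
Qed.

Lemma zeros_summableS f q : entire f -> (exists z, f z != 0) ->
  zeros_summable (mult f) q -> zeros_summable (mult f) q.+1.
Proof.
move=> fe f0 /zeros_summableP[B HB]; apply/zeros_summableP.
have [d d0 Hd] := zeros_away fe f0; exists (d^-1 * B) => X.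
apply: le_trans (_ : d^-1 * \sum_(a <- X | a \in msupp (mult f) `\ 0) (mult f a)%:R / cabs a ^+ q.+1 <= _).
  rewrite mulr_sumr; apply: ler_sum => a /Hd da.
  rewrite [cabs a ^+ q.+2]exprS invfM mulrCA ler_wpM2r ?divr_ge0 ?exprn_ge0 ?cabs_ge0//.
  by rewrite lef_pV2 ?posrE// (lt_le_trans d0).
by rewrite ler_pM2l ?invr_gt0.
Qed.

Lemma zeros_summable_le f p q : entire f -> (exists z, f z != 0) -> (p <= q)%N ->
  zeros_summable (mult f) p -> zeros_summable (mult f) q.
Proof.
move=> fe f0 /subnK <-; elim: (q - p)%N => [//|k IH] /IH; exact: zeros_summableS.
Qed.

Lemma hadamard_growth f q (K : R) : entire f -> (exists z, f z != 0) -> 0 < K -> growth f q K ->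
  zeros_summable (mult f) q /\ exists Q : {poly R[i]}, forall z l,
    pcvg (msupp (mult f) `\ 0) (fun a => primary q (z / a) ^+ mult f a) l ->
    f z = expC Q.[z] * z ^+ mult f 0 * l.
Proof.
move=> fe f0 K0 fK; have [g [ge g0 fE]] := multP 0 fe f0.
have [|K' K0' gK] := growth_div0 ge fK (m := mult f 0) _ K0; first by move=> w; rewrite fE subr0.
have fg a : a != 0 -> mult f a = mult g a by exact: (mult_div0 fe ge f0 g0 fE).
have AE a : a \in msupp (mult f) `\ 0 = (a \in msupp (mult g) `\ 0).
  by apply/idP/idP => /set_mem[/= ma /eqP a0]; apply/mem_set; split; try exact/eqP; move: ma;
    rewrite /msupp /= fg.
have AF a : a \in msupp (mult g) `\ 0 -> mult f a = mult g a.
  by move=> /set_mem[_ /eqP]; exact: fg.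
split.
  apply/zeros_summableP; have [B HB] := zero_sum ge g0 K0' gK; exists B => X.
  apply: le_trans (HB X); rewrite (eq_bigl _ _ AE) le_eqVlt; apply/orP; left; apply/eqP.
  by apply: eq_bigr => a /AF ->.
have [Q HQ] := hadamard0 ge g0 K0' gK; exists Q => z l Hl.
rewrite fE subr0 (HQ z l); first by rewrite mulrCA mulrA.
by apply: ucvg_ext Hl => a; rewrite AE; case: ifP => // /AF ->.
Qed.

(** The growth of [f] gives the factorisation with a large exponent, which
    [canonical_succ] lowers step by step to [p]. *)
Theorem hadamard f p : entire f -> finite_order f -> (exists z, f z != 0) ->
  zeros_summable (mult f) p -> exists Q : {poly R[i]}, forall z l,
    pcvg (msupp (mult f) `\ 0) (fun a => primary p (z / a) ^+ mult f a) l ->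
    f z = expC Q.[z] * z ^+ mult f 0 * l.
Proof.
move=> fe fo f0 fp; have [q [K [pq K0 fK]]] := finite_order_growth p fe fo.
have [_] := hadamard_growth fe f0 K0 fK; rewrite -(subnK pq).
elim: (q - p)%N => [//|k IH] [Q HQ]; apply: IH.
have [c Hc] := canonical_succ (zeros_summable_le fe f0 (leq_addl k p) fp).
pose n := (k + p).+1; exists (Q + c *: 'X^n) => z l /Hc/HQ ->.
by rewrite hornerD hornerZ hornerXn expCD [l * _]mulrC mulrACA mulrA.
Qed.

Lemma genusP f : entire f -> finite_order f -> (exists z, f z != 0) ->
  zeros_summable (mult f) (genus f).
Proof.
move=> fe fo f0; have [q [K [_ K0 fK]]] := finite_order_growth 0 fe fo.
have [fq _] := hadamard_growth fe f0 K0 fK.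
have ex : exists n, `[< zeros_summable (mult f) n >] by exists q; apply/asboolP.
have ex2 : exists p, zeros_summable (mult f) p /\
    forall q, zeros_summable (mult f) q -> (p <= q)%N.
  exists (ex_minn ex); case: ex_minnP => n /asboolP fn nmin; split => // m fm.
  by apply: nmin; apply/asboolP.
by have [] := xgetPex 0%N ex2.
Qed.

End factorisation.

(** * Double products and sums *)

Section double.
Context {R : realType}.

Lemma bounded_reindex (T T' : choiceType) (A : set T) (B : set T') (h : T -> T') (a : T' -> R) (C : R) :
  (forall i, i \in A -> h i \in B) ->
  (forall i j, i \in A -> j \in A -> h i = h j -> i = j) ->
  (forall Y : {fset T'}, \sum_(j <- Y | j \in B) a j <= C) ->
  forall X : {fset T}, \sum_(i <- X | i \in A) a (h i) <= C.
Proof.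
move=> hA hi HC X; rewrite -big_filter; set s := [seq i <- X | i \in A].
have us : uniq (map h s).
  rewrite map_inj_in_uniq ?filter_uniq// => i j; rewrite !mem_filter => /andP[iA _] /andP[jA _].
  exact: hi.
apply: le_trans (HC [fset j in map h s]%fset); rewrite -(big_map h xpredT a).
rewrite le_eqVlt; apply/orP; left; apply/eqP; rewrite big_seq_cond [RHS]big_seq_cond.
rewrite -[LHS]big_filter -[RHS]big_filter; apply: perm_big.
apply: uniq_perm; rewrite ?filter_uniq// => j; rewrite !mem_filter !inE /=.
case: (boolP (j \in map h s)) => //= js; rewrite ?andbT.
have /allP/(_ j js) -> // : all (fun j => j \in B) (map h s).
by rewrite all_map; apply/allP => i; rewrite mem_filter => /andP[/hA].
Qed.

Lemma slice_bounded (T T' : choiceType) (A : set T) (B : set T') (a : T * T' -> R) i :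
  (forall ij, 0 <= a ij) -> i \in A ->
  (exists C, forall X : {fset T * T'}, \sum_(ij <- X | ij \in A `*` B) a ij <= C) ->
  exists C, forall Y : {fset T'}, \sum_(j <- Y | j \in B) a (i, j) <= C.
Proof.
move=> a0 iA [C HC]; exists C; apply: (bounded_reindex (A := B) (h := fun j => (i, j))) HC.
  by move=> j jB; rewrite in_setX iA.
by move=> j j' _ _ [].
Qed.

(** The products over the orbits are iterated ones; absolute convergence turns
    them into limits over pairs, which can be reindexed. *)
Lemma iter_prod (T T' : choiceType) (A : set T) (B : set T') (F : T -> T' -> R[i]) :
  abs_cvg_prod (A `*` B) (fun ij => F ij.1 ij.2) ->
  pcvg (A `*` B) (fun ij => F ij.1 ij.2) (uprod A (fun i => uprod B (F i))).
Proof.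
move=> FF; have [l Hl] := abs_cvg_prod_cvg FF.
have : pcvg A (fun i => uprod B (F i)) l.
  apply: (ucvg_fubini (@cdist0 R) (@cdistC R) (@cdist_triangle R) (@mulC_cont R)) Hl => i iA.
  have [|m Hm] := @abs_cvg_prod_cvg _ _ B (F i); last by rewrite -/(pcvg _ _ _) (uprodE Hm).
  apply/esum_bounded => [j|]; first exact: cabs_ge0.
  move: FF => /(esum_bounded _ (fun _ => cabs_ge0 _)); exact: slice_bounded (fun _ => cabs_ge0 _) iA.
by move=> /uprodE ->.
Qed.

Lemma scvgZ (T : choiceType) (A : set T) (F : T -> R) (l c : R) : scvg A F l ->
  scvg A (fun i => c * F i) (c * l).
Proof.
apply: (@ucvg_map _ _ _ _ +%R _ +%R (@rdist R) (@rdist R) (fun x => c * x)).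
- by move=> x y; rewrite mulrDr.
- exact: mulr0.
- move=> e e0; exists (e / (`|c| + 1)); first by rewrite divr_gt0// ltr_wpDl.
  move=> x; rewrite /rdist -mulrBr normrM ltr_pdivlMr ?ltr_wpDl// => H.
  by apply: le_lt_trans H; rewrite mulrDr mulr1 mulrC lerDl.
Qed.

Lemma iter_sum (T T' : choiceType) (A : set T) (B : set T') (c : T -> R) (F : T -> T' -> R) :
  (forall i, i \in A -> c i != 0) ->
  abs_cvg_sum (A `*` B) (fun ij => c ij.1 * F ij.1 ij.2) ->
  scvg (A `*` B) (fun ij => c ij.1 * F ij.1 ij.2) (usum A (fun i => c i * usum B (F i))).
Proof.
move=> c0 FF; have [l Hl] := abs_cvg_sum_cvg FF.
have : scvg A (fun i => c i * usum B (F i)) l.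
  apply: (ucvg_fubini (@rdist0 R) (@rdistC R) (@rdist_triangle R) (@addR_cont R)
    (F := fun i j => c i * F i j)) Hl => i iA.
  have [|m Hm] := @abs_cvg_sum_cvg _ _ B (fun j => c i * F i j).
    apply/esum_bounded => [j|]; first exact: normr_ge0.
    move: FF => /(esum_bounded _ (fun _ => normr_ge0 _)); exact: slice_bounded (fun _ => normr_ge0 _) iA.
  have := scvgZ (c i)^-1 Hm; under eq_fun do rewrite (mulKf (c0 i iA)).
  by move=> /usumE ->; rewrite mulVKf ?c0.
by move=> /usumE ->.
Qed.

Lemma ln_dist1 (t : R) : `|t - 1| <= 1 / 2 -> `|ln t| <= 2 * `|t - 1|.
Proof.
move=> t1; have t0 : 1 / 2 <= t by move: t1; rewrite ler_norml => /andP[]; lra.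
have tp : 0 < t by lra.
have ln_le (x : R) : 0 < x -> ln x <= x - 1.
  move=> x0; have := @le_ln1Dx R (x - 1); rewrite (_ : 1 + (x - 1) = x); last by ring.
  by apply; lra.
have A := ln_le _ tp; have B := ln_le t^-1; rewrite invr_gt0 lnV ?posrE// in B; have {}B := B tp.
have C : t^-1 - 1 <= 2 * `|t - 1|.
  have -> : t^-1 - 1 = t^-1 * (1 - t) by field; rewrite gt_eqF.
  have V : 0 <= t^-1 <= 2 by rewrite invr_ge0 (ltW tp)/= -[leRHS]invrK lef_pV2 ?posrE// ?invr_gt0//; lra.
  have := ler_norm (1 - t); rewrite distrC; have := normr_ge0 (t - 1); move: V => /andP[]; nra.
rewrite ler_norml; have := ler_norm (t - 1); have := normr_ge0 (t - 1); lra.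
Qed.

(** The factors of an absolutely convergent product are close to 1 except for
    finitely many, and there their logarithms are summable. *)
Lemma abs_cvg_prod_ln (T : choiceType) (A : set T) (F : T -> R[i]) : abs_cvg_prod A F ->
  exists X0 : {fset T}, forall i, i \in A -> i \notin X0 ->
    F i != 0 /\ `|ln (cabs (F i))| <= 2 * cabs (F i - 1).
Proof.
move=> /(esum_bounded _ (fun _ => cabs_ge0 _))[B HB].
have h2 : 0 < 1 / 2 :> R by rewrite divr_gt0.
have [X0 H] := sum_tail (fun _ => cabs_ge0 _) HB h2; exists X0 => i iA iX.
have F2 : cabs (F i - 1) <= 1 / 2.
  apply: le_trans (H (i |` X0)%fset (fsubsetU1 _ _)).
  have -> : ((i |` X0) `\` X0)%fset = [fset i]%fset.
    apply/fsetP => j; rewrite in_fsetD in_fset1U in_fset1.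
    by case: eqVneq => [->|_]; rewrite ?iX//=; case: (j \in X0).
  by rewrite big_mkcond big_seq_fset1 iA.
have F1 : `|cabs (F i) - 1| <= cabs (F i - 1).
  rewrite ler_norml; have := cabs_lerB (F i) 1; have := cabs_lerB 1 (F i).
  by rewrite cabs1 (cabsBC 1); lra.
split; first by rewrite -cabs_gt0; move: F1; rewrite ler_norml => /andP[]; lra.
apply: le_trans (ln_dist1 (le_trans F1 F2)) _.
by rewrite ler_pM2l.
Qed.

(** The convergence of the series is inherited from that of the two products,
    through [abs_cvg_prod_ln]. *)
Lemma ratio_summable (T : choiceType) (A : set T) (F G : T -> R[i]) (t : T -> R) :
  abs_cvg_prod A F -> abs_cvg_prod A G ->
  (forall i, i \in A -> cabs (F i) = cabs (G i) * expR (t i)) -> abs_cvg_sum A t.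
Proof.
move=> FF GG FG; have [X1 H1] := abs_cvg_prod_ln FF; have [X2 H2] := abs_cvg_prod_ln GG.
move: FF => /(esum_bounded _ (fun _ => cabs_ge0 _))[B HB].
move: GG => /(esum_bounded _ (fun _ => cabs_ge0 _))[C HC].
pose X0 := (X1 `|` X2)%fset; apply/esum_bounded => [i|]; first exact: normr_ge0.
exists (\sum_(i <- X0 | i \in A) `|t i| + (2 * B + 2 * C)) => X.
have sub (a : T -> R) (Y Z : {fset T}) : (forall i, 0 <= a i) -> (Y `<=` Z)%fset ->
    \sum_(i <- Y | i \in A) a i <= \sum_(i <- Z | i \in A) a i.
  by move=> a0 YZ; rewrite (partial_split _ _ _ YZ) /= lerDl sumr_ge0.
have t0 i : 0 <= `|t i| by exact: normr_ge0.
apply: le_trans (sub _ _ _ t0 (fsubsetUl X X0)) _.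
rewrite (partial_split _ _ _ (fsubsetUr X X0)) /= lerD2l.
set Y := (_ `\` _)%fset.
apply: (@le_trans _ _ (\sum_(i <- Y | i \in A) (2 * cabs (F i - 1) + 2 * cabs (G i - 1)))).
  rewrite big_seq_cond [leRHS]big_seq_cond; apply: ler_sum => i /andP[].
  rewrite in_fsetD [i \in X0]in_fsetU negb_or => /andP[/andP[iX1 iX2] _] iA.
  have [F0 lF] := H1 i iA iX1; have [G0 lG] := H2 i iA iX2.
  have -> : t i = ln (cabs (F i)) - ln (cabs (G i)).
    by rewrite FG// lnM ?posrE ?expR_gt0 ?cabs_gt0// expRK addrC addKr.
  by rewrite (le_trans (ler_normB _ _))// lerD.
by rewrite big_split /= -!mulr_sumr lerD// ler_pM2l.
Qed.

(** In multiplicative form, so as to cover vanishing products. *)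
Lemma ratio_limit (T : choiceType) (A : set T) (F G : T -> R[i]) (t : T -> R) lf lg s :
  pcvg A F lf -> pcvg A G lg -> scvg A t s ->
  (forall i, i \in A -> cabs (F i) = cabs (G i) * expR (t i)) ->
  cabs lf = cabs lg * expR s.
Proof.
move=> Fl Gl ts FG; pose phi (z : R[i]) := (cabs z)%:C : R[i].
have phic (H : T -> R[i]) l : pcvg A H l -> pcvg A (phi \o H) (phi l).
  apply: (@ucvg_map _ _ _ _ *%R _ *%R (@cdist R) (@cdist R) phi).
  - by move=> x y; rewrite /phi cabsM rmorphM.
  - by rewrite /phi cabs1.
  - move=> e e0; exists e => // x; apply: le_lt_trans.
    rewrite /cdist /phi -rmorphB cabs_real ler_norml.
    by have := cabs_lerB x l; have := cabs_lerB l x; rewrite (cabsBC l); lra.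
have et : pcvg A ((fun x : R => (expR x)%:C) \o t) (expR s)%:C.
  apply: (@ucvg_map _ _ _ _ +%R _ *%R (@rdist R) (@cdist R) (fun x => (expR x)%:C)) ts.
  - by move=> x y; rewrite expRD rmorphM.
  - by rewrite expR0.
  - move=> e e0; have /cvgrPdist_lt/(_ e e0) := @continuous_expR R s.
    move=> /nbhs_ballP[d /= d0 H]; exists d => // x xd.
    by rewrite /cdist -rmorphB cabs_real distrC; apply: H; rewrite /ball /= distrC.
have := ucvg_op (@mulC_cont R) (phic _ _ Gl) et.
move=> /(ucvg_ext (G := phi \o F) (B := A)) H.
have : pcvg A (phi \o F) (phi lg * (expR s)%:C).
  apply: H => i; case: ifP => // iA /=; rewrite /phi FG// rmorphM//.
move=> /(ucvg_uniq (@cdist0 R) (@cdistC R) (@cdist_triangle R) (@cdist_eq0 R) (phic _ _ Fl)).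
by rewrite /phi -rmorphM => -[].
Qed.

End double.

(** * Reflections *)

Section reflection.
Context {R : realType}.
Implicit Types (f g : R[i] -> R[i]) (z w a : R[i]) (y : R).

(** The reflection across the line [Im z = y]. *)
Definition refl y z : R[i] := conjc z + 0 +i* (2 * y).

Lemma reflK y : involutive (refl y).
Proof. by move=> [a b]; apply: eq_ReIm; rewrite /refl !(cReD, cImD) /=; ring. Qed.

Lemma reflB y z w : refl y z - refl y w = conjc (z - w).
Proof. by case: z w => [a b] [c d]; apply: eq_ReIm; rewrite /refl !(cReD, cImD, cReB, cImB) /=; ring. Qed.

Lemma refl_line y z : Im z = y -> refl y z = z.
Proof. by case: z => [a b] /= ->; apply: eq_ReIm; rewrite /refl !(cReD, cImD) /=; ring. Qed.

Lemma conjcM z w : conjc (z * w) = conjc z * conjc w.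
Proof. by pose J : {rmorphism R[i] -> R[i]} := conjc; rewrite -[LHS]/(J _) (rmorphM J). Qed.

Lemma conjcX z n : conjc (z ^+ n) = conjc z ^+ n.
Proof. by pose J : {rmorphism R[i] -> R[i]} := conjc; rewrite -[LHS]/(J _) (rmorphXn J). Qed.

Lemma entire_refl f y : entire f -> entire (fun w => conjc (f (refl y w))).
Proof.
move=> /entireP fe; apply/entireP => z; have [l [phi [phic phil fE]]] := fe (refl y z).
exists (conjc l), (fun w => conjc (phi (refl y w))); split.
- apply: (@ccont_comp _ conjc (fun w => phi (refl y w))); last exact: ccont_conj.
  apply: (@ccont_comp _ phi (refl y)) => //.
  by apply: (@ccontD _ conjc (fun=> 0 +i* (2 * y))); [exact: ccont_conj|exact: ccont_cst].
- by rewrite phil.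
- move=> w; rewrite (fE (refl y w)) reflB; pose J : {rmorphism R[i] -> R[i]} := conjc.
  by rewrite -[LHS]/(J _) (rmorphD J) /J /= conjcM conjcK.
Qed.

Lemma has_mult_refl f y a n : has_mult f (refl y a) n ->
  has_mult (fun w => conjc (f (refl y w))) a n.
Proof.
move=> [h [he h0 fE]]; exists (fun w => conjc (h (refl y w))); split.
- exact: entire_refl.
- by rewrite fmorph_eq0.
- by move=> w; rewrite fE conjcM conjcX reflB conjcK.
Qed.

(** On the line [Im z = y] the entire function [f z * conj (f (refl z))] is the
    square of the modulus of [f]; so it determines, and is determined by, that
    modulus, and its zeroes are those of [f] together with their reflections. *)
Lemma mult_reflect f g y : entire f -> entire g -> (exists z, f z != 0) -> (exists z, g z != 0) ->
  (forall z, Im z = y -> cabs (f z) = cabs (g z)) ->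
  forall a, (mult f a + mult f (refl y a) = mult g a + mult g (refl y a))%N.
Proof.
move=> fe ge f0 g0 fg a.
have re u : entire u -> (exists z, u z != 0) ->
    [/\ entire (fun w => conjc (u (refl y w))), exists z, conjc (u (refl y z)) != 0 &
        mult (fun w => conjc (u (refl y w))) a = mult u (refl y a)].
  move=> ue [z uz]; split; first exact: entire_refl.
    by exists (refl y z); rewrite reflK fmorph_eq0.
  exact: mult_unique (has_mult_refl (multP (refl y a) ue (ex_intro _ z uz))).
have [f'e f'0 <-] := re f fe f0; have [g'e g'0 <-] := re g ge g0.
rewrite -(multM a fe f'e f0 f'0) -(multM a ge g'e g0 g'0); congr mult; apply/funext => w.
apply/eqP; rewrite -subr_eq0; apply/eqP; move: w.
apply: (@entire_eq0 _ _ (0 +i* y)) => [|t].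
  have F := entireM fe f'e; have G := entireM ge g'e.
  move/entireP: F => F; move/entireP: G => G; apply/entireP => w.
  have [l Hl] := F w; have [m Hm] := G w; exists (l - m); exact: (cderB Hl Hm).
pose w := 0 +i* y + t%:C; rewrite -/w; have wy : Im w = y by rewrite /w cImD /= addr0.
have sq u : u w * conjc (u w) = (cabs (u w) ^+ 2)%:C.
  case: (u w) => [c d]; rewrite cabs_sqr; apply: eq_ReIm; rewrite ?cReM ?cImM /=; ring.
by rewrite refl_line// !sq fg// subrr.
Qed.

End reflection.

(** * Products over the orbits of a translation *)

Section orbits.
Context {R : realType}.
Variables (y0 : R) (p : nat) (D : R[i] -> nat) (S : set R[i]).
Implicit Types (z a b : R[i]) (k n : int).

Lemma tauD k n z : tau y0 k (tau y0 n z) = tau y0 (k + n) z.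
Proof. by rewrite /tau; apply: eq_ReIm; rewrite !(cReD, cImD) /= ?intrD; ring. Qed.

Lemma tau0 z : tau y0 0 z = z.
Proof. by rewrite /tau; apply: eq_ReIm; rewrite !(cReD, cImD) /=; ring. Qed.

Lemma Im_tau k z : Im (tau y0 k z) = Im z + 2 * k%:~R * y0.
Proof. by rewrite /tau cImD. Qed.

Lemma conj_tau k z : conjc (tau y0 k z) = tau y0 (- k) (conjc z).
Proof.
by case: z => [a b]; rewrite /tau; apply: eq_ReIm; rewrite !(cReD, cImD) /= ?intrN; ring.
Qed.

Lemma tau_conj k a : tau y0 k (conjc a) = conjc (tau y0 (- k) a).
Proof. by rewrite conj_tau opprK. Qed.

Lemma Re_psum (u : R[i]) : Re (psum p u) = \sum_(1 <= l < p.+1) l%:R^-1 * Re (u ^+ l).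
Proof.
rewrite /psum (big_morph _ (@cReD R) (erefl : Re (0 : R[i]) = 0)); apply: eq_bigr => l _.
have -> : u ^+ l / l%:R = (l%:R^-1)%:C * u ^+ l by rewrite mulrC -[l%:R^-1 in LHS]/_ fmorphV rmorph_nat.
by rewrite cReM /= mul0r subr0.
Qed.

(** For [z] on the line [Im z = y0], [b = tau k a] and its reflection [c = tau
    (1 - k) (conj a)] are at the same distance from [z], so the linear factors
    are in the ratio [|c| / |b|], whose logarithm is the first term of
    [line_term]. *)
Lemma line_factor x a k : tau y0 k a != 0 -> tau y0 (1 - k) (conjc a) != 0 ->
  cabs (primary p ((x +i* y0) / tau y0 k a)) =
  cabs (primary p ((x +i* y0) / tau y0 (1 - k) (conjc a))) * expR (line_term y0 p x a k).
Proof.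
move=> b0 c0; rewrite /line_term.
have -> : tau y0 (- k) (conjc a) + 0 +i* (2 * y0) = tau y0 (1 - k) (conjc a).
  by rewrite /tau; apply: eq_ReIm; rewrite !(cReD, cImD) /= ?intrD ?intrN; ring.
have cE : tau y0 (1 - k) (conjc a) = refl y0 (tau y0 k a).
  rewrite /refl conj_tau /tau; apply: eq_ReIm; rewrite !(cReD, cImD) /= ?intrD ?intrN; ring.
move: c0; rewrite {}cE; set b := tau y0 k a in b0 *; set c := refl y0 b => c0.
set z := x +i* y0; have zc : cabs (c - z) = cabs (b - z).
  have E : refl y0 z = z by exact: refl_line.
  by rewrite -[in LHS]E reflB cabs_conj.
have cb : 0 < cabs b by rewrite cabs_gt0.
have cc : 0 < cabs c by rewrite cabs_gt0.
have E1 : cabs (1 - (0 +i* (2 * y0)) / b) = cabs c / cabs b.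
  have -> : 1 - (0 +i* (2 * y0)) / b = (b - (0 +i* (2 * y0))) / b by rewrite mulrBl divff.
  rewrite cabsf; congr (_ / _); rewrite -cabs_conj; congr cabs.
  by rewrite /c /refl; case: (b) => s t; apply: eq_ReIm; rewrite !(cReD, cImD, cReB, cImB) /=; ring.
have E2 d : d != 0 -> cabs (primary p (z / d)) = cabs (d - z) / cabs d * expR (Re (psum p (z / d))).
  move=> d0; rewrite primaryE cabsM cabs_expC; congr (_ * _).
  by rewrite -cabsf mulrBl divff.
rewrite !E2// zc E1 expRD lnK ?posrE ?divr_gt0//.
have -> : Re (psum p (z / b)) = Re (psum p (z / c)) +
    \sum_(1 <= l < p.+1) l%:R^-1 * Re ((z / b) ^+ l - (z / c) ^+ l).
  rewrite !Re_psum -big_split /=; apply: eq_bigr => l _; rewrite cReB; ring.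
rewrite expRD; set u := expR _; set v := expR _.
have : cabs b != 0 by rewrite gt_eqF.
have : cabs c != 0 by rewrite gt_eqF.
by move=> ? ?; field; apply/andP.
Qed.

Let I := S `*` [set: int].

Lemma flipI n (ak : R[i] * int) : ak \in I -> ((ak.1, n - ak.2) : R[i] * int) \in I.
Proof. by move=> /set_mem[aS _]; apply/mem_set. Qed.

(** Used with the symmetries [k -> - k] and [k -> 1 - k] of the orbits, which
    belong to the real line and to the line [Im z = y0]. *)
Lemma flip_pcvg (F : R[i] -> int -> R[i]) n l : pcvg I (fun ak => F ak.1 ak.2) l ->
  pcvg I (fun ak => F ak.1 (n - ak.2)) l.
Proof.
by apply: (ucvg_reindex (h := fun ak => (ak.1, n - ak.2)) (g := fun ak => (ak.1, n - ak.2))) =>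
  -[a k] aI; rewrite flipI//= subKr.
Qed.

Lemma flip_abs_cvg (F : R[i] -> int -> R[i]) n : abs_cvg_prod I (fun ak => F ak.1 ak.2) ->
  abs_cvg_prod I (fun ak => F ak.1 (n - ak.2)).
Proof.
move=> /(esum_bounded _ (fun _ => cabs_ge0 _))[B HB].
apply/esum_bounded => [ak|]; first exact: cabs_ge0.
exists B; apply: (bounded_reindex (B := I) (h := fun ak => (ak.1, n - ak.2))
  (a := fun ak => cabs (F ak.1 ak.2 - 1))) HB => [ak|[a k] [b m] _ _ /= [-> /addrI/oppr_inj ->]//].
exact: flipI.
Qed.

Let Ff z a k := primary p (z / tau y0 k a) ^+ D a.
Let Fg z a k := primary p (z / tau y0 k (conjc a)) ^+ D a.

(** On the real line the two products are conjugate. *)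
Lemma orbit_modulus_real z lf lg : Im z = 0 ->
  pcvg I (fun ak => Ff z ak.1 ak.2) lf -> pcvg I (fun ak => Fg z ak.1 ak.2) lg ->
  cabs lf = cabs lg.
Proof.
move=> z0 Hf Hg.
have zc : conjc z = z by case: z z0 {Hf Hg} => a b /= ->; rewrite oppr0.
have {}Hf := @flip_pcvg (Ff z) 0 _ Hf.
have : pcvg I (conjc \o (fun ak => Ff z ak.1 (0 - ak.2))) (conjc lf).
  apply: (@ucvg_map _ _ _ _ *%R _ *%R (@cdist R) (@cdist R) conjc) Hf.
  - exact: conjcM.
  - by apply: eq_ReIm; rewrite /= ?oppr0.
  - by move=> e e0; exists e => // x; rewrite /cdist -rmorphB cabs_conj.
have -> : conjc \o (fun ak => Ff z ak.1 (0 - ak.2)) = fun ak => Fg z ak.1 ak.2.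
  apply/funext => -[a k] /=; rewrite /Ff /Fg conjcX primary_conj.
  pose J : {rmorphism R[i] -> R[i]} := conjc.
  by rewrite -[(_ / _)^*]/(J _) (fmorph_div J) /J /= zc conj_tau sub0r opprK.
move=> /(ucvg_uniq (@cdist0 R) (@cdistC R) (@cdist_triangle R) (@cdist_eq0 R) Hg) ->.
by rewrite cabs_conj.
Qed.

Hypothesis S0 : forall a k, S a -> tau y0 k a != 0.
Hypothesis D0 : forall a, S a -> D a != 0%N.

(** The factor of index [k] on the left is paired with that of index [1 - k]
    on the right. *)
Lemma orbit_modulus_line x : let z := x +i* y0 in
  abs_cvg_prod I (fun ak => Ff z ak.1 ak.2) -> abs_cvg_prod I (fun ak => Fg z ak.1 ak.2) ->
  let s := fun a => (D a)%:R * usum [set: int] (fun k => line_term y0 p x a k) in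
  [/\ abs_cvg_sum I (fun ak => (D ak.1)%:R * line_term y0 p x ak.1 ak.2),
      scvg I (fun ak => (D ak.1)%:R * line_term y0 p x ak.1 ak.2) (usum S s) &
      cabs (uprod S (fun a => uprod [set: int] (Ff z a))) =
      cabs (uprod S (fun a => uprod [set: int] (Fg z a))) * expR (usum S s)].
Proof.
move=> z Hf Hg s; have Hg' := @flip_abs_cvg (Fg z) 1 Hg.
have FG ak : ak \in I -> cabs (Ff z ak.1 ak.2) =
    cabs (Fg z ak.1 (1 - ak.2)) * expR ((D ak.1)%:R * line_term y0 p x ak.1 ak.2).
  move=> /set_mem[aS _]; rewrite /Ff /Fg !cabsX /z line_factor; first by rewrite exprMn expRM_natl.
    exact: S0.
  by rewrite tau_conj fmorph_eq0 S0.
have tt := ratio_summable Hf Hg' FG.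
have ts : scvg I (fun ak => (D ak.1)%:R * line_term y0 p x ak.1 ak.2) (usum S s).
  apply: (@iter_sum _ _ _ S [set: int] (fun a => (D a)%:R) (fun a k => line_term y0 p x a k)) => // a.
  by move=> /set_mem /D0; rewrite pnatr_eq0.
split => //; apply: ratio_limit (iter_prod Hf) _ ts FG.
exact: (@flip_pcvg (Fg z) 1 _ (iter_prod Hg)).
Qed.

End orbits.

Section same_real_parts.
Context {R : realType}.

Lemma horner_bounded (Q : {poly R[i]}) d z : (size Q <= d.+1)%N ->
  Q.[z] = \sum_(0 <= l < d.+1) Q`_l * z ^+ l.
Proof.
move=> sQ; rewrite (horner_coef_wide _ sQ) -(big_mkord xpredT (fun l => Q`_l * z ^+ l)).
by [].
Qed.

Lemma Re_horner_diff (P Q : {poly R[i]}) d z : (size P <= d.+1)%N -> (size Q <= d.+1)%N ->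
  (forall l, Re P`_l = Re Q`_l) ->
  Re P.[z] = Re Q.[z] - \sum_(1 <= l < d.+1) (Im P`_l - Im Q`_l) * Im (z ^+ l).
Proof.
move=> sP sQ PQ; rewrite (horner_bounded _ sP) (horner_bounded _ sQ).
rewrite !(big_morph _ (@cReD R) (erefl : Re (0 : R[i]) = 0)) !(big_ltn (ltn0Sn d)).
have -> : Re (P`_0 * z ^+ 0) = Re (Q`_0 * z ^+ 0) by rewrite !expr0 !mulr1 PQ.
rewrite -addrA; congr (_ + _); rewrite -sumrN -big_split; apply: eq_bigr => l _ /=.
by rewrite !cReM PQ; ring.
Qed.

End same_real_parts.

(** The strip meets each orbit once, and it contains the origin. *)
Lemma strip_orbit {R : realType} (y0 : R) (D : R[i] -> nat) a k : 0 < y0 -> D 0 = 0%N ->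
  (msupp D `&` strip y0) a -> tau y0 k a != 0.
Proof.
move=> y00 D0 [Da /andP[a1 a2]]; apply/negP => /eqP E.
have ImE : Im a = - (2 * k%:~R * y0).
  by have := congr1 (@complex.Im R) E; rewrite Im_tau /=; lra.
have k1 : k%:~R < 1 :> R by rewrite ltNge; apply/negP => H; nra.
have k2 : -1 < k%:~R :> R by rewrite ltNge; apply/negP => H; nra.
have k0 : k = 0 by move: k1 k2; rewrite (ltr_int R k 1) -[-1]/((-1)%:~R) ltr_int; lia.
by move: Da; rewrite /msupp /= -[a](tau0 y0) -k0 E D0.
Qed.

(** * Finite differences *)

Section differences.
Context {R : realType}.
Variable h : R.
Implicit Types (F G : R -> R) (x c : R) (n m : nat).

Definition fdiff F x := F (x + h) - F x.

Definition killed n F := forall x, iter n fdiff F x = 0.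

(** Solving the vanishing [n]-th difference for [F x] extends the equation
    [F = 0] from nearby points to [x]. *)
Lemma fdiff_zero n F x : killed n F ->
  (forall i, (0 < i <= n)%N -> F (x + h *+ i) = 0) -> F x = 0.
Proof.
elim: n F => [|n IH] F kF F0; first exact: kF.
have : fdiff F x = 0.
  apply: IH => [y|i /andP[i0 iN]]; first by rewrite -iterSr.
  by rewrite /fdiff -addrA -mulrSr !F0 ?subr0 ?i0 ?ltnS ?(leqW iN)//=.
by rewrite /fdiff -[h in x + h]mulr1n F0// sub0r => /eqP; rewrite oppr_eq0 => /eqP.
Qed.

Lemma iter_fdiffD n F G c x :
  iter n fdiff (fun x => F x + c * G x) x = iter n fdiff F x + c * iter n fdiff G x.
Proof.
elim: n x => [//|n IH] x; rewrite !iterS {1}/fdiff !IH /fdiff; ring.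
Qed.

Lemma killedDZ n F G c : killed n F -> killed n G -> killed n (fun x => F x + c * G x).
Proof. by move=> kF kG x; rewrite iter_fdiffD kF kG mulr0 addr0. Qed.

Lemma iter_fdiff0 n x : iter n fdiff (fun=> 0) x = 0.
Proof. by elim: n x => [//|n IH] x; rewrite iterS /fdiff !IH subrr. Qed.

Lemma killedZ n F c : killed n F -> killed n (fun x => c * F x).
Proof.
move=> kF x; rewrite -[RHS](killedDZ c (iter_fdiff0 n) kF x).
by congr (iter n fdiff _ x); apply/funext => y; rewrite add0r.
Qed.

Lemma killedD n F G : killed n F -> killed n G -> killed n (fun x => F x + G x).
Proof.
move=> kF kG x; rewrite -[RHS](killedDZ 1 kF kG x).
by congr (iter n fdiff _ x); apply/funext => y; rewrite mul1r.
Qed.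

Lemma killed_leq n m F : (n <= m)%N -> killed n F -> killed m F.
Proof.
move=> /subnK <- kF x; rewrite iterD (_ : iter n fdiff F = fun=> 0) ?iter_fdiff0//.
exact/funext.
Qed.

Lemma killed_sum n l1 l2 (F : nat -> R -> R) : (forall l, (l1 <= l < l2)%N -> killed n (F l)) ->
  killed n (fun x => \sum_(l1 <= l < l2) F l x).
Proof.
move=> kF; rewrite (_ : (fun x => _) = fun x => \sum_(l <- index_iota l1 l2) (if (l1 <= l < l2)%N then F l x else 0)).
  elim: (index_iota _ _) => [|l s IH]; first by under eq_fun do rewrite big_nil; exact: iter_fdiff0.
  under eq_fun do rewrite big_cons; apply: killedD => //.
  by case: (boolP (l1 <= l < l2)%N) => [/kF//|_]; exact: iter_fdiff0.
by apply/funext => x; rewrite big_nat -big_mkcond.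
Qed.

Lemma iter_fdiff_shift n F a x : iter n fdiff (fun y => F (y + a)) x = iter n fdiff F (x + a).
Proof. by elim: n x => [//|n IH] x; rewrite !iterS /fdiff !IH addrAC. Qed.

Lemma killed_mulx n F : killed n F -> killed n.+1 (fun x => x * F x).
Proof.
elim: n F => [|n IH] F kF x.
  by rewrite /= /fdiff !(kF _ : F _ = 0) !mulr0 subrr.
rewrite iterSr (_ : fdiff _ = fun x => x * fdiff F x + h * F (x + h)); last first.
  by apply/funext => y; rewrite /fdiff; ring.
apply: killedDZ => [|y]; first by apply: IH => y; rewrite -iterSr.
by rewrite iter_fdiff_shift kF.
Qed.

Lemma Re_realM x (u : R[i]) : Re (x%:C * u) = x * Re u.
Proof. by case: u => s t; rewrite cReM /= mul0r subr0. Qed.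

(** [n + 1] differences annihilate the real part of a polynomial of degree at
    most [n] on a horizontal line. *)
Lemma killed_ReX (y : R) (c : R[i]) l : killed l.+1 (fun x => Re (c * (x +i* y) ^+ l)).
Proof.
elim: l c => [|l IH] c; first by move=> x; rewrite /= /fdiff !expr0 subrr.
rewrite (_ : (fun x => _) = fun x => x * Re (c * (x +i* y) ^+ l) +
    Re (c * (0 +i* y) * (x +i* y) ^+ l)); last first.
  apply/funext => x; rewrite exprS (_ : x +i* y = x%:C + 0 +i* y) ?mulrDl; last first.
    by apply: eq_ReIm; rewrite ?cReD ?cImD /= ?addr0 ?add0r.
  rewrite mulrDr cReD; congr (_ + _); last by rewrite mulrA.
  by rewrite (mulrCA c) Re_realM.
apply: killedD; first exact: killed_mulx.
exact: killed_leq (leqnSn _) (IH _).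
Qed.

Lemma scvg_iter_fdiff (T : choiceType) (A : set T) (G : T -> R -> R) (s : R -> R) n :
  (forall x, scvg A (fun i => G i x) (s x)) ->
  forall x, scvg A (fun i => iter n fdiff (G i) x) (iter n fdiff s x).
Proof.
move=> Gs; elim: n => [//|n IH] x.
have := ucvg_op (@addR_cont R) (IH (x + h)) (scvgZ (- 1) (IH x)); rewrite /= mulN1r.
by under eq_fun do rewrite mulN1r.
Qed.

(** Limits commute with finite differences, so the sum of the [line_term] is
    annihilated like its terms. *)
Lemma scvg_killed (T : choiceType) (A : set T) (G : T -> R -> R) (s : R -> R) n :
  (forall x, scvg A (fun i => G i x) (s x)) -> (forall i, killed n (G i)) -> killed n s.
Proof.
move=> Gs kG x; have := scvg_iter_fdiff n Gs x; under eq_fun do rewrite kG.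
move=> /(ucvg_uniq (@rdist0 R) (@rdistC R) (@rdist_triangle R) (@rdist_eq0 R)); apply.
by move=> e e0; exists fset0 => X _; rewrite /partial big1// rdist0.
Qed.

Lemma killed_line_term y0 p a k : killed p.+1 (fun x => line_term y0 p x a k).
Proof.
rewrite /line_term; apply: killedD => [x|].
  rewrite iterSr (_ : fdiff _ = fun=> 0) ?iter_fdiff0//.
  by apply/funext => y; rewrite /fdiff subrr.
set b := tau _ _ _; set c := _ + _; apply: killed_sum => l /andP[_ lp]; apply: killedZ.
rewrite (_ : (fun x => _) = fun x => Re ((b ^- l - c ^- l) * (x +i* y0) ^+ l)).
  exact: killed_leq lp (killed_ReX _ _ _).
by apply/funext => x; rewrite !expr_div_n mulrBl ![_ * (_ +i* _) ^+ l]mulrC.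
Qed.

Lemma killed_Im_sum (y : R) (c : nat -> R) d :
  killed d.+1 (fun x => \sum_(1 <= l < d.+1) c l * Im ((x +i* y) ^+ l)).
Proof.
apply: killed_sum => l /andP[_ ld]; apply: killedZ.
rewrite (_ : (fun x => _) = fun x => Re (- 'i * (x +i* y) ^+ l)).
  exact: killed_leq ld (killed_ReX _ _ _).
apply/funext => x; rewrite cReM cReN cImN /=; ring.
Qed.

End differences.

(** * From the factorisation to the moduli *)

(** The origin is its own reflection across the real line. *)
Lemma mult0_eq {R : realType} (f g : R[i] -> R[i]) : entire f -> entire g ->
  (exists z, f z != 0) -> (exists z, g z != 0) ->
  (forall z, Im z = 0 -> cabs (f z) = cabs (g z)) -> mult f 0 = mult g 0.
Proof.
by move=> fe ge f0 g0 fg; have := mult_reflect fe ge f0 g0 fg 0; rewrite refl_line//; lia.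
Qed.

Section backward.
Context {R : realType}.
Variables (y0 : R) (f g : R[i] -> R[i]).
Hypothesis y0_gt0 : 0 < y0.
Hypotheses (fe : entire f) (ge : entire g).
Hypotheses (f0 : exists z, f z != 0) (g0 : exists z, g z != 0).

Let p := genus f.
Let Md := diff_mult f g.
Let S := msupp Md `&` strip y0.
Let Ff z a k := primary p (z / tau y0 k a) ^+ Md a.
Let Fg z a k := primary p (z / tau y0 k (conjc a)) ^+ Md a.

Lemma ImX_real (z : R[i]) l : Im z = 0 -> Im (z ^+ l) = 0.
Proof.
move=> z0; elim: l => [|l IH]; first by rewrite expr0.
by rewrite exprS cImM z0 IH mulr0 mul0r addr0.
Qed.

Lemma cabs_factors (a b c : R[i]) : cabs (expC a * b * c) = expR (Re a) * cabs b * cabs c.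
Proof. by rewrite 2!cabsM cabs_expC. Qed.

Lemma combine_factors (rf rg L b c c' : R) : rf = rg - L -> c = c' * expR L ->
  expR rf * b * c = expR rg * b * c'.
Proof. by move=> -> ->; rewrite expRD expRN; field; rewrite gt_eqF ?expR_gt0. Qed.

(** The equality on the real line comes first: it makes the multiplicities at
    the origin equal, so that the orbits avoid the origin and
    [orbit_modulus_line] applies. *)
Lemma moduli_eq d (Qf Qg : {poly R[i]}) :
  (size Qf <= d.+1)%N -> (size Qg <= d.+1)%N -> (forall l, Re Qf`_l = Re Qg`_l) ->
  (forall z, abs_cvg_prod (S `*` [set: int]) (fun ak => Ff z ak.1 ak.2) /\
    f z = expC Qf.[z] * common_product f g z * uprod S (fun a => uprod [set: int] (Ff z a))) ->
  (forall z, abs_cvg_prod (S `*` [set: int]) (fun ak => Fg z ak.1 ak.2) /\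
    g z = expC Qg.[z] * common_product f g z * uprod S (fun a => uprod [set: int] (Fg z a))) ->
  (forall x, \sum_(1 <= l < d.+1) (Im Qf`_l - Im Qg`_l) * Im ((x +i* y0) ^+ l) =
     usum S (fun a => (Md a)%:R * usum [set: int] (fun k => line_term y0 p x a k))) ->
  forall z, Im z = 0 \/ Im z = y0 -> cabs (f z) = cabs (g z).
Proof.
move=> sf sg Q Hf Hg HL.
have fE z := etrans (congr1 cabs (Hf z).2) (cabs_factors _ _ _).
have gE z := etrans (congr1 cabs (Hg z).2) (cabs_factors _ _ _).
have real z : Im z = 0 -> cabs (f z) = cabs (g z).
  move=> z0; have Pf := @iter_prod _ _ _ S [set: int] (Ff z) (Hf z).1.
  have Pg := @iter_prod _ _ _ S [set: int] (Fg z) (Hg z).1.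
  rewrite fE gE; apply: (@combine_factors _ _ 0); last first.
    by rewrite expR0 mulr1; exact: (@orbit_modulus_real _ y0 p Md S z _ _ z0 Pf Pg).
  by rewrite (Re_horner_diff z sf sg Q) big1// => l _; rewrite ImX_real// mulr0.
move=> z [/real//|zy].
have D0 : Md 0 = 0%N by rewrite /Md /diff_mult (mult0_eq fe ge f0 g0 real) subnn.
have zE : z = Re z +i* y0 by apply: eq_ReIm.
have S0 a k : S a -> tau y0 k a != 0 by exact: strip_orbit.
have SD a : S a -> Md a != 0%N by case.
have If := (Hf z).1; have Ig := (Hg z).1; rewrite zE in If Ig.
have [_ _] := @orbit_modulus_line _ y0 p Md S S0 SD (Re z) If Ig; rewrite -zE => E.
rewrite fE gE; apply: combine_factors E.
by rewrite (Re_horner_diff z sf sg Q) {2}zE HL.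
Qed.

End backward.

(** * From the moduli to the factorisation *)

Section zero_sums.
Context {R : realType}.
Implicit Types (M N : R[i] -> nat).

Definition zterm M p (a : R[i]) : R := (M a)%:R / cabs a ^+ p.+1.

(** Terms off the support vanish, and so does the one at the origin because
    the inverse of 0 is 0; sums over the whole plane are easier to transport
    along maps. *)
Lemma zeros_summableT M p : zeros_summable M p <->
  exists B, forall X : {fset R[i]}, \sum_(a <- X | a \in [set: R[i]]) zterm M p a <= B.
Proof.
have E X : \sum_(a <- X | a \in msupp M `\ 0) zterm M p a = \sum_(a <- X | a \in [set: R[i]]) zterm M p a.
  rewrite [LHS]big_mkcond [RHS]big_mkcond; apply: eq_bigr => a _; rewrite in_setT.
  case: ifP => // /negbT/negP aM; apply/esym; have [Ma|Ma] := eqVneq (M a) 0%N.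
    by rewrite /zterm Ma mul0r.
  have [->|a0] := eqVneq a 0; first by rewrite /zterm cabs0 expr0n invr0 mulr0.
  by case: aM; apply/mem_set; split => //; exact/eqP.
split=> [/zeros_summableP[B HB]|[B HB]]; first by exists B => X; rewrite -E; exact: HB.
by apply/zeros_summableP; exists B => X; rewrite (E X); exact: HB.
Qed.

Lemma zeros_summable_mono M N p : (forall a, (M a <= N a)%N) ->
  zeros_summable N p -> zeros_summable M p.
Proof.
move=> MN /zeros_summableT[B HB]; apply/zeros_summableT; exists B => X; apply: le_trans (HB X).
by apply: ler_sum => a _; rewrite ler_wpM2r ?invr_ge0 ?exprn_ge0 ?cabs_ge0// ler_nat.
Qed.

Lemma zeros_summable_conj M p : zeros_summable M p -> zeros_summable (fun a => M (conjc a)) p.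
Proof.
move=> /zeros_summableT[B HB]; apply/zeros_summableT; exists B.
rewrite (_ : zterm _ _ = fun a => zterm M p (conjc a)).
  by apply: bounded_reindex HB => [a _|a b _ _ /(can_inj (@conjcK _))]; rewrite ?in_setT.
by apply/funext => a; rewrite /zterm cabs_conj.
Qed.

Lemma zeros_summableD M N p : zeros_summable M p -> zeros_summable N p ->
  zeros_summable (fun a => (M a + N a)%N) p.
Proof.
move=> /zeros_summableT[B HB] /zeros_summableT[C HC]; apply/zeros_summableT; exists (B + C) => X.
apply: le_trans (lerD (HB X) (HC X)); rewrite -big_split /= le_eqVlt; apply/orP; left; apply/eqP.
by apply: eq_bigr => a _; rewrite /zterm natrD mulrDl.
Qed.

Lemma pcvg_support (T : choiceType) (A B : set T) (F : T -> R[i]) l :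
  (forall i, (i \in A) != (i \in B) -> F i = 1) -> pcvg A F l -> pcvg B F l.
Proof.
move=> AB; apply: ucvg_ext => i; have := AB i.
by case: (i \in A); case: (i \in B) => //= ->.
Qed.

Definition zfactor M p z (a : R[i]) := primary p (z / a) ^+ M a.

(** At the origin [z / 0 = 0] and the factor is 1, so that products over the
    support and over the whole plane agree. *)
Lemma zfactor_supp M p z a : a \notin msupp M `\ 0 -> zfactor M p z a = 1.
Proof.
move=> aM; rewrite /zfactor; have [->|a0] := eqVneq a 0; first by rewrite invr0 mulr0 primary_id0 expr1n.
have [->//|Ma] := eqVneq (M a) 0%N.
by move/negP: aM; case; apply/mem_set; split => //; exact/eqP.
Qed.

Lemma zfactor_pcvg M p z l : pcvg (msupp M `\ 0) (zfactor M p z) l <-> pcvg [set: R[i]] (zfactor M p z) l.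
Proof.
by split; apply: pcvg_support => a; rewrite in_setT ?[true == _]eq_sym eqb_id => /zfactor_supp.
Qed.

Lemma zfactor_cvg M p z : zeros_summable M p -> exists l, pcvg [set: R[i]] (zfactor M p z) l.
Proof.
move=> /zeros_summableP[B HB].
have [|l Hl] := @abs_cvg_prod_cvg _ _ (msupp M `\ 0) (zfactor M p z).
  by apply: abs_cvg_primary HB => a /set_mem[Ma /eqP].
by exists l; apply/zfactor_pcvg.
Qed.

End zero_sums.

Section orbit_products.
Context {R : realType}.
Variables (y0 : R) (p : nat) (D : R[i] -> nat).
Hypothesis y0_gt0 : 0 < y0.
Hypothesis Dtau : forall k a, D (tau y0 k a) = D a.
Hypothesis D0 : D 0 = 0%N.
Hypothesis Dsum : zeros_summable D p.

Let S := msupp D `&` strip y0.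
Let I := S `*` [set: int].

(** The number of translations that take the strip to the one containing [b]. *)
Definition level (b : R[i]) : int := Num.ceil ((Im b - y0) / (2 * y0)).

Lemma level_tau (a : R[i]) k : strip y0 a -> level (tau y0 k a) = k.
Proof.
move=> /andP[a1 a2]; apply: ceil_def; rewrite Im_tau intrB.
by rewrite ltr_pdivlMr ?ler_pdivrMr ?mulr_gt0//; apply/andP; split; lra.
Qed.

Lemma level_strip (b : R[i]) : strip y0 (tau y0 (- level b) b).
Proof.
rewrite /strip /= Im_tau intrN; have := ceil_itv ((Im b - y0) / (2 * y0)); rewrite -/(level b) intrB.
rewrite ltr_pdivlMr ?ler_pdivrMr ?mulr_gt0// => /andP[b1 b2]; apply/andP; split; lra.
Qed.

Lemma tau_inj (a b : R[i]) k n : strip y0 a -> strip y0 b ->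
  tau y0 k a = tau y0 n b -> (a, k) = (b, n).
Proof.
move=> aS bS E; have kn : k = n by rewrite -(level_tau k aS) E level_tau.
congr pair => //; move: E; rewrite kn => /(congr1 (tau y0 (- n))).
by rewrite !tauD addNr !tau0.
Qed.

(** Taking [(a, k)] to [tau k a] is a bijection from [I] onto the support of
    [D]. *)
Lemma orbit_pcvg (F : R[i] -> R[i]) l : (forall b, D b = 0%N -> F b = 1) ->
  pcvg [set: R[i]] F l -> pcvg I (fun ak => F (tau y0 ak.2 ak.1)) l.
Proof.
move=> F1 H; have {}H : pcvg (msupp D) F l.
  apply: pcvg_support H => b; rewrite in_setT; case: (boolP (b \in msupp D)) => // bD _.
  by apply: F1; apply/eqP; apply: contraNT bD => Db; apply/mem_set.
apply: (ucvg_reindex (h := fun ak => tau y0 ak.2 ak.1)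
  (g := fun b => (tau y0 (- level b) b, level b))) H => [[a k]|b] /set_mem.
  move=> [[Da aS] _]; split; first by apply/mem_set; rewrite /msupp /= Dtau.
  by rewrite /= level_tau// tauD addNr tau0.
move=> Db; split; last by rewrite /= tauD addrN tau0.
by apply/mem_set; split => //; split; [rewrite /msupp /= Dtau|exact: level_strip].
Qed.

Lemma orbit_neq0 (a : R[i]) k : S a -> tau y0 k a != 0.
Proof. exact: strip_orbit. Qed.

(** For [f] the zero of index [(a, k)] is [tau k a]; for [g] it is the
    conjugate of [tau (- k) a], whence the map [n] of indices. *)
Lemma orbit_abs_cvg z (b : R[i] * int -> R[i]) (n : int -> int) : injective n ->
  (forall ak, ak \in I -> b ak != 0 /\ cabs (b ak) = cabs (tau y0 (n ak.2) ak.1)) ->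
  abs_cvg_prod I (fun ak => primary p (z / b ak) ^+ D ak.1).
Proof.
move=> ni Hb; have [B HB] := (zeros_summableT D p).1 Dsum.
apply: (@abs_cvg_primary _ _ I b (fun ak => D ak.1) p B) => [ak akI|X].
  by have [? _] := Hb ak akI; split => //; move: akI => /set_mem[[]].
apply: le_trans (bounded_reindex (A := I) (h := fun ak => tau y0 (n ak.2) ak.1) _ _ HB X).
- rewrite big_mkcond [leRHS]big_mkcond /=; apply: ler_sum => ak _; case: ifP => // akI.
  by rewrite /zterm Dtau; have [_ ->] := Hb ak akI.
- by move=> ak _; rewrite in_setT.
- move=> [a k] [a' k'] /set_mem[[_ aS] _] /set_mem[[_ aS'] _] /= E.
  by have [-> /ni ->] := tau_inj aS aS' E.
Qed.

Lemma orbit_f z : abs_cvg_prod I (fun ak => primary p (z / tau y0 ak.2 ak.1) ^+ D ak.1).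
Proof.
apply: (orbit_abs_cvg (n := id) z (b := fun ak => tau y0 ak.2 ak.1)) => // ak /set_mem[aS _].
by rewrite orbit_neq0.
Qed.

Lemma orbit_g z : abs_cvg_prod I (fun ak => primary p (z / tau y0 ak.2 (conjc ak.1)) ^+ D ak.1).
Proof.
apply: (orbit_abs_cvg (n := -%R) z (b := fun ak => tau y0 ak.2 (conjc ak.1))) => [|ak /set_mem[aS _]].
  exact: oppr_inj.
by rewrite tau_conj fmorph_eq0 cabs_conj orbit_neq0.
Qed.

Lemma orbit_f_limit z l : pcvg [set: R[i]] (zfactor D p z) l ->
  uprod S (fun a => uprod [set: int] (fun k => primary p (z / tau y0 k a) ^+ D a)) = l.
Proof.
move=> H; have {}H : pcvg I (fun ak => zfactor D p z (tau y0 ak.2 ak.1)) l.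
  by apply: orbit_pcvg H => b Db; rewrite /zfactor Db.
have G := @iter_prod _ _ _ S [set: int] (fun a k => primary p (z / tau y0 k a) ^+ D a) (orbit_f z).
apply: (ucvg_uniq (@cdist0 R) (@cdistC R) (@cdist_triangle R) (@cdist_eq0 R) G).
by move: H; rewrite /zfactor; under eq_fun do rewrite Dtau.
Qed.

Lemma orbit_g_limit z l : pcvg [set: R[i]] (zfactor (fun a => D (conjc a)) p z) l ->
  uprod S (fun a => uprod [set: int] (fun k => primary p (z / tau y0 k (conjc a)) ^+ D a)) = l.
Proof.
move=> H; have {}H : pcvg [set: R[i]] (fun a => zfactor (fun a => D (conjc a)) p z (conjc a)) l.
  by apply: (ucvg_reindex (h := conjc) (g := conjc)) H => a _; rewrite in_setT conjcK.
have C0 b : D b = 0%N -> zfactor (fun a => D (conjc a)) p z (conjc b) = 1.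
  by move=> Db; rewrite /zfactor conjcK Db.
have {}H : pcvg I (fun ak => primary p (z / tau y0 (- ak.2) (conjc ak.1)) ^+ D ak.1) l.
  by have := orbit_pcvg C0 H; rewrite /zfactor; under eq_fun do rewrite conjcK Dtau conj_tau.
have G := @iter_prod _ _ _ S [set: int] (fun a k => primary p (z / tau y0 k (conjc a)) ^+ D a) (orbit_g z).
apply: (ucvg_uniq (@cdist0 R) (@cdistC R) (@cdist_triangle R) (@cdist_eq0 R) G).
have := @flip_pcvg _ S (fun a k => primary p (z / tau y0 (- k) (conjc a)) ^+ D a) 0 l H.
by under eq_fun do rewrite sub0r opprK.
Qed.

End orbit_products.

Section forward.
Context {R : realType}.
Variables (y0 : R) (f g : R[i] -> R[i]).
Hypothesis y0_gt0 : 0 < y0.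
Hypotheses (fe : entire f) (ge : entire g).
Hypotheses (fo : finite_order f) (go : finite_order g).
Hypotheses (f0 : exists z, f z != 0) (g0 : exists z, g z != 0).
Hypothesis fg : forall z, Im z = 0 \/ Im z = y0 -> cabs (f z) = cabs (g z).

Let p := genus f.
Let Mc := common_mult f g.
Let Md := diff_mult f g.
Let S := msupp Md `&` strip y0.
Let Ff (z : R[i]) a k := primary p (z / tau y0 k a) ^+ Md a.
Let Fg (z : R[i]) a k := primary p (z / tau y0 k (conjc a)) ^+ Md a.

Lemma refl0 (a : R[i]) : refl 0 a = conjc a.
Proof. by rewrite /refl; apply: eq_ReIm; rewrite ?cReD ?cImD /=; ring. Qed.

Lemma mult_conj a : (mult f a + mult f (conjc a) = mult g a + mult g (conjc a))%N.
Proof. by rewrite -(refl0 a); apply: mult_reflect => // z z0; apply: fg; left. Qed.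

Lemma mult_refl a : (mult f a + mult f (refl y0 a) = mult g a + mult g (refl y0 a))%N.
Proof. by apply: mult_reflect => // z z0; apply: fg; right. Qed.

Lemma diff_conj a : diff_mult g f a = Md (conjc a).
Proof. by have := mult_conj a; rewrite /Md /diff_mult; lia. Qed.

Lemma diff_tau1 a : Md (tau y0 1 a) = Md a.
Proof.
have -> : tau y0 1 a = refl y0 (conjc a).
  by rewrite /refl /tau conjcK mulr1z mulr1.
have := mult_conj a; have := mult_refl (conjc a); rewrite /Md /diff_mult; lia.
Qed.

(** The excess of the zeroes of [f] over those of [g] changes sign under both
    reflections, hence is invariant under their composition, a translation. *)
Lemma diff_tau k a : Md (tau y0 k a) = Md a.
Proof.
elim: k a => [|n IH|n IH] a; first by rewrite tau0.
  by rewrite -addn1 PoszD -tauD IH diff_tau1.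
by rewrite -diff_tau1 tauD -[RHS](IH a); congr (Md (tau y0 _ a)); lia.
Qed.

Lemma diff0 : Md 0 = 0%N.
Proof.
by rewrite /Md /diff_mult (mult0_eq fe ge f0 g0) ?subnn// => z z0; apply: fg; left.
Qed.

Let fsum : zeros_summable (mult f) p. Proof. exact: genusP. Qed.

Lemma common_sum : zeros_summable Mc p.
Proof. by apply: zeros_summable_mono fsum => a; rewrite geq_minl. Qed.

Lemma diff_sum : zeros_summable Md p.
Proof. by apply: zeros_summable_mono fsum => a; rewrite leq_subr. Qed.

(** By [mult_conj], a zero of [g] is a zero of [f] or the conjugate of one. *)
Lemma other_sum : zeros_summable (mult g) p.
Proof.
apply: zeros_summable_mono (zeros_summableD fsum (zeros_summable_conj fsum)) => a.
by rewrite mult_conj leq_addr.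
Qed.

Lemma common_pcvg z : pcvg [set: R[i]] (zfactor Mc p z) (uprod (msupp Mc `\ 0) (zfactor Mc p z)).
Proof.
have [l Hl] := zfactor_cvg z common_sum.
by have /zfactor_pcvg/uprodE -> := Hl.
Qed.

Lemma zfactorD M N z l m : pcvg [set: R[i]] (zfactor M p z) l -> pcvg [set: R[i]] (zfactor N p z) m ->
  pcvg [set: R[i]] (zfactor (fun a => (M a + N a)%N) p z) (l * m).
Proof.
move=> Hl Hm; apply: ucvg_ext (ucvg_op (@mulC_cont R) Hl Hm) => a; rewrite in_setT /zfactor exprD.
by [].
Qed.

Lemma f_pcvg z : pcvg (msupp (mult f) `\ 0) (zfactor (mult f) p z)
  (uprod (msupp Mc `\ 0) (zfactor Mc p z) * uprod S (fun a => uprod [set: int] (Ff z a))).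
Proof.
have [l Hl] := zfactor_cvg z diff_sum.
have E := orbit_f_limit y0_gt0 diff_tau diff0 diff_sum Hl.
rewrite -{}E in Hl; apply/zfactor_pcvg.
rewrite (_ : mult f = fun a => (Mc a + Md a)%N); first exact: zfactorD (common_pcvg z) Hl.
by apply/funext => a; rewrite /Mc /Md /common_mult /diff_mult; lia.
Qed.

(** By [diff_conj], the zeroes that [g] has in excess are the conjugates of
    those of [f]. *)
Lemma g_pcvg z : pcvg (msupp (mult g) `\ 0) (zfactor (mult g) p z)
  (uprod (msupp Mc `\ 0) (zfactor Mc p z) * uprod S (fun a => uprod [set: int] (Fg z a))).
Proof.
have [l Hl] := zfactor_cvg z (zeros_summable_conj diff_sum).
have E := orbit_g_limit y0_gt0 diff_tau diff0 diff_sum Hl.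
rewrite -{}E in Hl; apply/zfactor_pcvg.
rewrite (_ : mult g = fun a => (Mc a + Md (conjc a))%N); first exact: zfactorD (common_pcvg z) Hl.
by apply/funext => a; rewrite -diff_conj /Mc /common_mult /diff_mult; lia.
Qed.

Lemma f_factor : exists Q : {poly R[i]}, forall z,
  f z = expC Q.[z] * common_product f g z * uprod S (fun a => uprod [set: int] (Ff z a)).
Proof.
have [Q HQ] := hadamard fe fo f0 fsum; exists Q => z.
by rewrite (HQ _ _ (f_pcvg z)) /common_product !mulrA.
Qed.

Lemma g_factor : exists Q : {poly R[i]}, forall z,
  g z = expC Q.[z] * common_product f g z * uprod S (fun a => uprod [set: int] (Fg z a)).
Proof.
have [Q HQ] := hadamard ge go g0 other_sum; exists Q => z.
rewrite (HQ _ _ (g_pcvg z)) /common_product !mulrA (mult0_eq fe ge f0 g0)// => w w0.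
by apply: fg; left.
Qed.

Let S0 a k : S a -> tau y0 k a != 0. Proof. exact: strip_orbit diff0. Qed.
Let SD a : S a -> Md a != 0%N. Proof. by case. Qed.

Let If z : abs_cvg_prod (S `*` [set: int]) (fun ak => Ff z ak.1 ak.2).
Proof. exact: (orbit_f y0_gt0 diff_tau diff0 diff_sum). Qed.
Let Ig z : abs_cvg_prod (S `*` [set: int]) (fun ak => Fg z ak.1 ak.2).
Proof. exact: (orbit_g y0_gt0 diff_tau diff0 diff_sum). Qed.

Section polynomials.
Variables Qf Qg : {poly R[i]}.
Hypothesis fE : forall z,
  f z = expC Qf.[z] * common_product f g z * uprod S (fun a => uprod [set: int] (Ff z a)).
Hypothesis gE : forall z,
  g z = expC Qg.[z] * common_product f g z * uprod S (fun a => uprod [set: int] (Fg z a)).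

Lemma cancel_factors (rf rg L b c c' : R) : expR rf * b * c = expR rg * b * c' ->
  expR rf * b * c != 0 -> c = c' * expR L -> rf = rg - L.
Proof.
move=> E N c'E; have b0 : b != 0 by apply: contraNneq N => ->; rewrite mulr0 mul0r.
have c0 : c' != 0 by apply: contraNneq N => c0; rewrite c'E c0 mul0r mulr0.
apply: expR_inj; rewrite expRD expRN; have eL : expR L != 0 by rewrite gt_eqF ?expR_gt0.
apply: (mulIf eL); rewrite divfK//; apply: (mulIf b0); apply: (mulIf c0).
by rewrite -E c'E; ring.
Qed.

Lemma Re_eq z L : Im z = 0 \/ Im z = y0 -> f z != 0 ->
  cabs (uprod S (fun a => uprod [set: int] (Ff z a))) =
  cabs (uprod S (fun a => uprod [set: int] (Fg z a))) * expR L ->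
  Re Qf.[z] = Re Qg.[z] - L.
Proof.
move=> zy fz; have E1 := etrans (congr1 cabs (fE z)) (cabs_factors _ _ _).
have E2 := etrans (congr1 cabs (gE z)) (cabs_factors _ _ _).
have E := etrans (esym E1) (etrans (fg zy) E2).
by apply: cancel_factors E _; rewrite -E1 gt_eqF// cabs_gt0.
Qed.

Lemma Re_real (t : R) : f t%:C != 0 -> Re Qf.[t%:C] = Re Qg.[t%:C].
Proof.
move=> ft; have Pf := @iter_prod _ _ _ S [set: int] (Ff t%:C) (If t%:C).
have Pg := @iter_prod _ _ _ S [set: int] (Fg t%:C) (Ig t%:C).
rewrite -[RHS]subr0; apply: Re_eq => //; first by left.
by rewrite expR0 mulr1; exact: (@orbit_modulus_real _ y0 p Md S t%:C _ _ (erefl _) Pf Pg).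
Qed.

Lemma Re_horner_real (Q : {poly R[i]}) d (t : R) : (size Q <= d.+1)%N ->
  Re Q.[t%:C] = \sum_(l < d.+1) Re Q`_l * t ^+ l.
Proof.
move=> sQ; rewrite (horner_coef_wide _ sQ) (big_morph _ (@cReD R) (erefl : Re (0 : R[i]) = 0)).
by apply: eq_bigr => l _; rewrite -rmorphXn mulrC Re_realM mulrC.
Qed.

(** The real parts of the two polynomials agree at the real points where [f]
    does not vanish, and there are infinitely many of these near the origin. *)
Lemma Re_coef l : Re Qf`_l = Re Qg`_l.
Proof.
pose d := maxn (size Qf) (size Qg).
have sf : (size Qf <= d.+1)%N by rewrite leqW// leq_maxl.
have sg : (size Qg <= d.+1)%N by rewrite leqW// leq_maxr.
pose P := \poly_(l < d.+1) (Re Qf`_l - Re Qg`_l).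
have [r r0 Hr] := mult_punctured 0 fe f0.
have PE t : P.[t] = Re Qf.[t%:C] - Re Qg.[t%:C].
  rewrite horner_poly (Re_horner_real t sf) (Re_horner_real t sg) -sumrB.
  by apply: eq_bigr => i _; rewrite mulrBl.
pose t i := r / i.+2%:R.
have tP i : P.[t i] = 0.
  have ti0 : 0 < t i by rewrite divr_gt0// ltr0n.
  rewrite PE Re_real ?subrr//; apply: Hr; first by rewrite -cabs_gt0 cabs_real gtr0_norm.
  rewrite subr0 cabs_real gtr0_norm// /t ltr_pdivrMr ?ltr0n// ltr_pMr// ltr1n//.
have P0 : P = 0.
  apply/eqP/negPn/negP => Pn0.
  have := @max_poly_roots _ P [seq t i | i <- iota 0 (size P)] Pn0.
  rewrite size_map size_iota ltnn => H; suff : false by []; apply: H.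
    by apply/allP => x /seq.mapP[i _ ->]; apply/eqP.
  rewrite map_inj_uniq ?iota_uniq// => i j /(mulfI (lt0r_neq0 r0))/invr_inj/eqP.
  by rewrite eqr_nat => /eqP[].
have [ld|ld] := ltnP l d.+1; last by rewrite !nth_default// (leq_trans _ ld).
by have := coef_poly d.+1 (fun l => Re Qf`_l - Re Qg`_l) l; rewrite -/P P0 coef0 ld => /eqP;
  rewrite eq_sym subr_eq0 => /eqP.
Qed.

(** Where [f] does not vanish, compare the moduli. Its zeroes on the line are
    isolated, and both sides of the identity are limits of polynomials in [x]
    of bounded degree, so differences with a small step carry the identity
    over to these zeroes. *)
Lemma line_identity d x : (size Qf <= d.+1)%N -> (size Qg <= d.+1)%N ->
  \sum_(1 <= l < d.+1) (Im Qf`_l - Im Qg`_l) * Im ((x +i* y0) ^+ l) =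
  usum S (fun a => (Md a)%:R * usum [set: int] (fun k => line_term y0 p x a k)).
Proof.
move=> sf sg; pose s x := usum S (fun a => (Md a)%:R * usum [set: int] (fun k => line_term y0 p x a k)).
pose L x := \sum_(1 <= l < d.+1) (Im Qf`_l - Im Qg`_l) * Im ((x +i* y0) ^+ l).
rewrite -/(L x) -/(s x); apply/eqP; rewrite -subr_eq0; apply/eqP.
have away u : f (u +i* y0) != 0 -> L u - s u = 0.
  move=> fu; have [_ _ E] := @orbit_modulus_line _ y0 p Md S S0 SD u (If _) (Ig _).
  have := Re_eq (z := u +i* y0) (or_intror (erefl _)) fu E.
  rewrite (Re_horner_diff _ sf sg Re_coef) => /addrI/oppr_inj.
  by rewrite -/(L u) -/(s u) => ->; rewrite subrr.
have [r r0 Hr] := mult_punctured (x +i* y0) fe f0.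
pose n := maxn p.+1 d.+1; pose h := r / n.+1%:R.
have h0 : 0 < h by rewrite divr_gt0// ltr0n.
have kL : killed h n L by exact: killed_leq (leq_maxr _ _) (killed_Im_sum _ _ _ _).
have ks : killed h n s.
  apply: (@scvg_killed _ h _ (S `*` [set: int])
    (fun ak u => (Md ak.1)%:R * line_term y0 p u ak.1 ak.2)) => [u|ak].
    by have [] := @orbit_modulus_line _ y0 p Md S S0 SD u (If _) (Ig _).
  by apply: killedZ; exact: killed_leq (leq_maxl _ _) (killed_line_term _ _ _ _ _).
apply: (@fdiff_zero _ h n (fun u => L u - s u)) => [u|i /andP[i0 iN]].
  have := killedDZ (- 1) kL ks u; rewrite (_ : (fun _ => _) = fun u => L u - s u)//.
  by apply/funext => v; rewrite mulN1r.
apply: away; have E : (x + h *+ i) +i* y0 - (x +i* y0) = (h *+ i)%:C.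
  by apply: eq_ReIm; rewrite ?cReB ?cImB /= ?subrr// addrC addKr.
have hi : 0 < h *+ i by rewrite pmulrn_rgt0.
apply: Hr; first by rewrite -subr_eq0 E -cabs_gt0 cabs_real gtr0_norm.
rewrite E cabs_real gtr0_norm// -mulr_natr /h mulrAC ltr_pdivrMr ?ltr0n// ltr_pM2l// ltr_nat.
by rewrite ltnS.
Qed.

End polynomials.

Lemma factorisation_ex : exists (d : nat) (Qf Qg : {poly R[i]}),
  [/\ [/\ (size Qf <= d.+1)%N, (size Qg <= d.+1)%N & forall l, Re Qf`_l = Re Qg`_l],
    forall z, abs_cvg_prod (S `*` [set: int]) (fun ak => Ff z ak.1 ak.2) /\
      f z = expC Qf.[z] * common_product f g z * uprod S (fun a => uprod [set: int] (Ff z a)),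
    forall z, abs_cvg_prod (S `*` [set: int]) (fun ak => Fg z ak.1 ak.2) /\
      g z = expC Qg.[z] * common_product f g z * uprod S (fun a => uprod [set: int] (Fg z a)) &
    forall x, abs_cvg_sum (S `*` [set: int]) (fun ak => (Md ak.1)%:R * line_term y0 p x ak.1 ak.2) /\
      \sum_(1 <= l < d.+1) (Im Qf`_l - Im Qg`_l) * Im ((x +i* y0) ^+ l) =
      usum S (fun a => (Md a)%:R * usum [set: int] (fun k => line_term y0 p x a k))].
Proof.
have [Qf fE] := f_factor; have [Qg gE] := g_factor.
pose d := maxn (size Qf) (size Qg).
have sf : (size Qf <= d.+1)%N by rewrite leqW// leq_maxl.
have sg : (size Qg <= d.+1)%N by rewrite leqW// leq_maxr.
exists d, Qf, Qg; split.
- by split => // l; exact: Re_coef fE gE l.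
- by move=> z; split; [exact: If|exact: fE].
- by move=> z; split; [exact: Ig|exact: gE].
- move=> x; split; last exact: line_identity fE gE _ _ sf sg.
  by have [] := @orbit_modulus_line _ y0 p Md S S0 SD x (If _) (Ig _).
Qed.

End forward.

Theorem theorem10 (R : realType) (y0 : R) (y0_gt0 : 0 < y0)
    (f g : R[i] -> R[i])
    (f_entire : entire f) (g_entire : entire g)
    (f_order : finite_order f) (g_order : finite_order g)
    (f_neq0 : exists z, f z != 0) (g_neq0 : exists z, g z != 0) :
  (forall z : R[i], Im z = 0 \/ Im z = y0 -> cabs (f z) = cabs (g z)) <->
  let p := genus f in
  let Md := diff_mult f g in
  let S := msupp Md `&` strip y0 in
  exists (d : nat) (Qf Qg : {poly R[i]}),
    [/\ [/\ (size Qf <= d.+1)%N, (size Qg <= d.+1)%N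
          & forall l : nat, Re Qf`_l = Re Qg`_l],
        forall z : R[i],
          abs_cvg_prod (S `*` [set: int])
            (fun ak => primary p (z / tau y0 ak.2 ak.1) ^+ Md ak.1) /\
          f z = expC Qf.[z] * common_product f g z *
            uprod S (fun a => uprod [set: int]
              (fun k => primary p (z / tau y0 k a) ^+ Md a)),
        forall z : R[i],
          abs_cvg_prod (S `*` [set: int])
            (fun ak => primary p (z / tau y0 ak.2 (conjc ak.1)) ^+ Md ak.1) /\
          g z = expC Qg.[z] * common_product f g z *
            uprod S (fun a => uprod [set: int]
              (fun k => primary p (z / tau y0 k (conjc a)) ^+ Md a))
      & forall x : R,
          abs_cvg_sum (S `*` [set: int])
            (fun ak => (Md ak.1)%:R * line_term y0 p x ak.1 ak.2) /\
          \sum_(1 <= l < d.+1)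
             (Im Qf`_l - Im Qg`_l) * Im ((x +i* y0) ^+ l) =
          usum S (fun a =>
            (Md a)%:R * usum [set: int] (fun k => line_term y0 p x a k))].
Proof.
split=> [fg|[d [Qf [Qg [[sf sg Q] Hf Hg HL]]]]].
  exact: (factorisation_ex y0_gt0 f_entire g_entire f_order g_order f_neq0 g_neq0 fg).
exact: (moduli_eq y0_gt0 f_entire g_entire f_neq0 g_neq0 sf sg Q Hf Hg (fun x => (HL x).2)).
Qed.
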